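(* Let $\nu$ be the centered Lévy noise measure on $\mathcal D'$ with Lévy measure $\sigma$ satisfying $\int_{(0,\infty)}\tau^2\,\sigma(d\tau)<\infty$, let $\varkappa:[0,\infty)^2\to[0,\infty)$ be measurable and locally bounded, let $X_{s,t}$ be the associated field, let $\mu_{s,t}$ be deterministic and continuous in $(s,t)$ on $\{0\le s\le t\}$, and let $F_{s,t}=\mu_{s,t}+X_{s,t}$, $0\le s\le t$, be the forward rates, with bond prices $P_{s,t}$, spot rates $R_s$, discounted bond prices $Z_{s,t}$ and $\sigma$-algebras $\mathcal F_s$ as defined in the context. Then the following statements are equivalent: (a) For each $t\ge 0$, the discounted bond-price process $\{Z_{s,t},\ \mathcal F_s,\ 0\le s\le t\}$ is a martingale (under $\nu$). (b) For all $s,t\ge 0$ with $s\le t$, $$\mu_{s,t}=\mu_{0,t}+\int_0^t\int_0^s\int_{(0,\infty)}\tau\,\varkappa(x,y)\bigl(1-e^{-\tau\varkappa(x,y)(t-(x\vee y))}\bigr)\,\sigma(d\tau)\,dx\,dy .$$ (c) For all $s,t\ge 0$ with $s\le t$, $$P_{s,t}=\mathbb E\Bigl(e^{-\int_s^t R_u\,du}\,\Big|\,\mathcal F_s\Bigr),$$ where $\mathbb E$ denotes expectation with respect to $\nu$.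
   Context: **Lévy noise.** Let $\mathcal D=C_0^\infty(\mathbb R^2)$ be the space of real-valued infinitely differentiable compactly supported functions on $\mathbb R^2$ with its standard nuclear topology, and $\mathcal D'$ its dual with respect to $L^2(\mathbb R^2,dx\,dy)$, so that $\mathcal D'\supset L^2(\mathbb R^2,dx\,dy)\supset\mathcal D$, with dual pairing $\langle\cdot,\cdot\rangle$ generated by the scalar product of $L^2(\mathbb R^2,dx\,dy)$. Let $\mathcal C(\mathcal D')$ be the cylinder $\sigma$-algebra on $\mathcal D'$. Let $\sigma$ be a positive measure on the Borel sets of $(0,\infty)$ with $\int_{(0,\infty)}\tau^2\,\sigma(d\tau)<\infty$. The centered Lévy noise measure with Lévy measure $\sigma$ is the probability measure $\nu$ on $(\mathcal D',\mathcal C(\mathcal D'))$ (existing by the Minlos theorem) with Fourier transform $$\int_{\mathcal D'}e^{i\langle\omega,\varphi\rangle}\,\nu(d\omega)=\exp\Bigl[\int_{\mathbb R^2}\int_{(0,\infty)}\bigl(e^{i\tau\varphi(x,y)}-1-i\tau\varphi(x,y)\bigr)\,\sigma(d\tau)\,dx\,dy\Bigr],\qquad\varphi\in\mathcal D .$$ One has $\int_{\mathcal D'}\langle\omega,\varphi\rangle^2\,\nu(d\omega)=\int_{(0,\infty)}\tau^2\sigma(d\tau)\int_{\mathbb R^2}\varphi^2\,dx\,dy$ for $\varphi\in\mathcal D$, so the map $\varphi\mapsto\langle\cdot,\varphi\rangle$ extends by continuity from $\mathcal D$ to a map $L^2(\mathbb R^2,dx\,dy)\to L^2(\mathcal D',\nu)$;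 its value at $f\in L^2(\mathbb R^2,dx\,dy)$ is again denoted $\langle\cdot,f\rangle$ (a random variable defined $\nu$-a.s.). **The field $X$.** For $s,t\ge0$, $$X_{s,t}(\omega)=\langle\omega(x,y),\mathbf 1_{[0,s]}(x)\mathbf 1_{[0,t]}(y)\varkappa(x,y)\rangle\quad\text{for }\nu\text{-a.e. }\omega\in\mathcal D',$$ where $x,y$ denote the variables in which the dualization is carried out. **Interest rates.** The forward rate for date $t$ at time $s$ is $F_{s,t}=\mu_{s,t}+X_{s,t}$, $0\le s\le t$. The bond price is $P_{s,t}=\exp\bigl[-\int_s^tF_{s,u}\,du\bigr]$, the spot rate is $R_s=F_{s,s}$, and the discounted bond-price process is $Z_{s,t}=P_{s,t}\exp\bigl[-\int_0^sR_u\,du\bigr]$. The integrals here are $\nu$-a.s. well defined, and $\nu$-a.s. $$\int_s^tX_{s,u}\,du=\langle\omega(x,y),\mathbf 1_{[0,s]}(x)\mathbf 1_{[0,t]}(y)\varkappa(x,y)(t-(s\vee y))\rangle,$$ $$\int_0^sR_u\,du=\int_0^s\mu_{u,u}\,du+\langle\omega(x,y),\mathbf 1_{[0,s]}(x)\mathbf 1_{[0,s]}(y)\varkappa(x,y)(s-(x\vee y))\rangle .$$ For $s\ge0$, $\mathcal F_s$ is the $\sigma$-algebra generated by the random variables $F_{u,v}$, $0\le u\le s$, $u\le v$. Notation: $x\vee y=\max(x,y)$. *)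

(* Defs.v *)
From HB Require Import structures.
From mathcomp Require Import all_boot all_order all_algebra.
From mathcomp Require Import all_classical all_reals all_analysis.
From mathcomp.real_closed Require Import complex.

Set Implicit Arguments.
Unset Strict Implicit.
Unset Printing Implicit Defensive.
Import Order.TTheory GRing.Theory Num.Theory numFieldNormedType.Exports.

Local Open Scope classical_set_scope.
Local Open Scope ring_scope.

Section test_functions.
Context {R : realType}.
Implicit Types (f g : R * R -> R) (w : seq bool).

Definition axis (b : bool) : R * R := if b then (1, 0) else (0, 1).

(* Mixed partial derivatives are indexed by words in the two coordinate
   directions; the length of the word is the order of the derivative. *)
Fixpoint iter_partial w f : R * R -> R :=
  if w is b :: w' then fun p => 'D_(axis b) (iter_partial w' f) p else f.

(* C^oo: partial derivatives of every order exist and are (Frechet)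
   differentiable, in particular continuous. *)
Definition smooth f := forall w p, differentiable (iter_partial w f) p.

Definition supported_in (K : set (R * R)) f := forall p, ~ K p -> f p = 0.

Definition test_fun : {pred R * R -> R} :=
  fun f => `[< smooth f /\ exists2 K, compact K & supported_in K f >].

Lemma iter_partial_lin (a : R) f g w : smooth f -> smooth g ->
  iter_partial w (a *: f + g) = a *: iter_partial w f + iter_partial w g.
Proof.
move=> sf sg; elim: w => [//|b w IH]; rewrite /= IH; apply/funext => p.
have df : derivable (iter_partial w f) p (axis b).
  by apply: diff_derivable; exact: sf.
have dg : derivable (iter_partial w g) p (axis b).
  by apply: diff_derivable; exact: sg.
by rewrite deriveD ?deriveZ//; exact: derivableZ.
Qed.

Lemma smooth0 : smooth (0 : R * R -> R).
Proof.
move=> w p; suff -> : iter_partial w (0 : R * R -> R) = cst 0.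
  exact: differentiable_cst.
elim: w => [//|b w IH] /=; rewrite IH; apply/funext => q.
by rewrite derive_cst.
Qed.

Lemma test_fun_submod_closed : submod_closed test_fun.
Proof.
split.
  rewrite unfold_in; apply/asboolP; split; first exact: smooth0.
  by exists set0 => //; exact: compact0.
move=> a f g; rewrite !unfold_in.
move=> /asboolP[sf [K cK Kf]] /asboolP[sg [L cL Lg]].
apply/asboolP; split.
  move=> w p; rewrite iter_partial_lin//.
  apply: differentiableD; last exact: sg.
  by apply: differentiableZ; exact: sf.
exists (K `|` L) => [|p /not_orP[Kp Lp]]; first exact: compactU.
have -> : (a *: f + g) p = a * f p + g p by [].
by rewrite Kf// Lg// mulr0 addr0.
Qed.

HB.instance Definition _ :=
  GRing.isSubmodClosed.Build R (R * R -> R) test_fun test_fun_submod_closed.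

End test_functions.

Section test_function_space.
Variable R : realType.

Record testfun := TestFun {
  testfun_val :> R * R -> R ;
  _ : testfun_val \in @test_fun R }.

HB.instance Definition _ := [isSub for testfun_val].
HB.instance Definition _ := [Choice of testfun by <:].
HB.instance Definition _ := [SubChoice_isSubLmodule of testfun by <:].

(* The usual topology of the space of test functions, i.e. the locally convex
   inductive limit of the Frechet spaces D_K of test functions supported in a
   compact set K, topologised by the seminorms
   max_{|w| <= m} sup_p |iter_partial w f p|. *)
Definition LF_nbhs0 (V : set testfun) :=
  [/\ forall (f g : testfun) (a : R), V f -> V g -> 0 <= a <= 1 ->
        V (a *: f + (1 - a) *: g),
      forall (f : testfun) (a : R), V f -> `|a| <= 1 -> V (a *: f) &
      forall K : set (R * R), compact K -> exists m : nat,
        exists2 e : R, 0 < e &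
        forall f : testfun, supported_in K f ->
          (forall w p, (size w <= m)%N -> `|iter_partial w f p| < e) -> V f].

Definition LF_open (U : set testfun) :=
  forall f, U f -> exists2 V, LF_nbhs0 V & forall g, V g -> U (f + g).

Lemma LF_openT : LF_open setT.
Proof.
move=> f _; exists setT => //; split=> // K _.
by exists 0%N; exists 1.
Qed.

Lemma LF_openI : setI_closed LF_open.
Proof.
move=> A B Ao Bo f [/Ao[V [Vc Vb VK] VA] /Bo[W [Wc Wb WK] WB]].
exists (V `&` W); last by move=> g [/VA ? /WB].
split=> [g h a [Vg Wg] [Vh Wh] a01|g a [Vg Wg] a1|K cK].
- by split; [exact: Vc|exact: Wc].
- by split; [exact: Vb|exact: Wb].
- have [m [d d0 VKd]] := VK _ cK; have [n [e e0 WKe]] := WK _ cK.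
  exists (maxn m n); exists (Num.min d e); first by rewrite lt_min d0.
  move=> g Kg gde; split.
  + apply: VKd => // w p wm.
    by have := gde w p (leq_trans wm (leq_maxl _ _)); rewrite lt_min => /andP[].
  + apply: WKe => // w p wn.
    by have := gde w p (leq_trans wn (leq_maxr _ _)); rewrite lt_min => /andP[].
Qed.

Lemma LF_open_bigU (I : Type) (F : I -> set testfun) :
  (forall i, LF_open (F i)) -> LF_open (\bigcup_i F i).
Proof.
move=> Fo f [i _ /Fo[V V0 VF]]; exists V => // g Vg.
by exists i => //; exact: VF.
Qed.

HB.instance Definition _ :=
  isOpenTopological.Build testfun LF_openT LF_openI LF_open_bigU.

Record gen_function := GenFunction {
  gen_function_val :> {linear testfun -> R^o} ;
  gen_function_continuous : continuous gen_function_val }.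

Lemma gen_function0_continuous :
  continuous (\0 : {linear testfun -> R^o}).
Proof. exact: (@cst_continuous testfun R^o 0). Qed.

HB.instance Definition _ := gen_eqMixin gen_function.
HB.instance Definition _ := gen_choiceMixin gen_function.
HB.instance Definition _ :=
  isPointed.Build gen_function (GenFunction gen_function0_continuous).

Definition pairing (om : gen_function) (phi : testfun) : R := om phi.

Definition cylinder : set (set gen_function) :=
  [set A | exists (phi : testfun) (B : set R),
     measurable B /\ A = [set om | B (pairing om phi)]].

Definition Dprime : Type := g_sigma_algebraType cylinder.

HB.instance Definition _ := Measurable.on Dprime.

End test_function_space.

Section levy_noise.
Context {R : realType}.
Local Open Scope complex_scope.

Definition cexp (z : R[i]) : R[i] :=
  let: x +i* y := z in (expR x * cos y) +i* (expR x * sin y).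

Definition cintegral d (T : measurableType d) (m : {measure set T -> \bar R})
    (D : set T) (f : T -> R[i]) : R[i] :=
  (\int[m]_(x in D) complex.Re (f x)) +i* (\int[m]_(x in D) complex.Im (f x)).

Definition plane_measure := (@lebesgue_measure R \x @lebesgue_measure R)%E.

HB.instance Definition _ := Measure.on plane_measure.

(* The Levy measure is a measure on (0, +oo): only the restriction of sigma to
   `]0, +oo[ is used. *)
Definition is_levy_noise (sigma : {measure set R -> \bar R})
    (nu : probability (Dprime R) R) :=
  forall phi : testfun R,
    cintegral nu setT (fun om => cexp (0 +i* pairing om phi)) =
    cexp (cintegral plane_measure setT (fun p =>
      cintegral sigma `]0, +oo[ (fun tau =>
        cexp (0 +i* (tau * phi p)) - 1 - (0 +i* (tau * phi p))))).

(* Y is a version of <., f>, the extension by L^2-continuity of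
   phi |-> <., phi>. *)
Definition is_pairing (nu : probability (Dprime R) R) (f : R * R -> R)
    (Y : Dprime R -> R) :=
  measurable_fun setT Y /\
  exists phi : nat -> testfun R,
    'N[plane_measure]_2%:E[(fun p => (phi n p - f p)%:E)]%E
      @[n --> \oo] --> 0%E /\
    'N[nu]_2%:E[(fun om => (pairing om (phi n) - Y om)%:E)]%E
      @[n --> \oo] --> 0%E.

End levy_noise.

Section conditional_expectation.
Context d (T : measurableType d) (R : realType) (P : probability T R).

(* W is a version of the conditional expectation of Y given G *)
Definition is_cond_exp (G : set (set T)) (Y W : T -> R) :=
  [/\ P.-integrable setT (EFin \o Y), P.-integrable setT (EFin \o W),
      forall B, measurable B -> G (W @^-1` B) &
      forall A, G A -> \int[P]_(x in A) W x = \int[P]_(x in A) Y x].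

Definition is_martingale (I : set R) (G : R -> set (set T))
    (M : R -> T -> R) :=
  [/\ forall s, I s -> P.-integrable setT (EFin \o M s),
      forall s, I s -> forall B, measurable B -> G s (M s @^-1` B) &
      forall r s, I r -> I s -> r <= s -> is_cond_exp (G r) (M s) (M r)].

End conditional_expectation.

Section interest_rates.
Context {R : realType}.
Implicit Types (nu : probability (Dprime R) R) (F : R -> R -> Dprime R -> R).

Definition quadrant : set (R * R) := [set p | 0 <= p.1 /\ 0 <= p.2].

Definition locally_bounded_on (A : set (R * R)) (f : R * R -> R) :=
  forall p, A p -> exists M : R, \forall q \near p, A q -> `|f q| <= M.

(* Each X s t is only determined nu-a.s.; joint measurability selects versions
   whose sample paths can be integrated in the time parameters. *)
Definition is_levy_field nu (kappa : R * R -> R) (X : R -> R -> Dprime R -> R) :=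
  measurable_fun (quadrant `*` [set: Dprime R])
    (fun q : (R * R) * Dprime R => X q.1.1 q.1.2 q.2) /\
  forall s t, 0 <= s -> 0 <= t ->
    is_pairing nu
      (fun p => \1_`[0, s] p.1 * \1_`[0, t] p.2 * kappa p) (X s t).

Definition forward_rate (mu : R -> R -> R) (X : R -> R -> Dprime R -> R) s t om :=
  mu s t + X s t om.

Definition bond_price F s t om :=
  expR (- \int[lebesgue_measure]_(u in `[s, t]) F s u om).

Definition spot_rate F s om := F s s om.

Definition int_spot_rate F s t om :=
  \int[lebesgue_measure]_(u in `[s, t]) spot_rate F u om.

Definition discounted_bond_price F s t om :=
  bond_price F s t om * expR (- int_spot_rate F 0 s om).

(* The F u v are random variables defined nu-a.s., so all their versions are
   taken as generators; equivalently, the nu-null events are adjoined to the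
   sigma-algebra generated by one choice of versions. *)
Definition information nu F (s : R) : set (set (Dprime R)) :=
  <<s [set A | exists (u v : R) (Y : Dprime R -> R) (B : set R),
         [/\ 0 <= u <= s, u <= v, measurable_fun setT Y, Y = F u v %[ae nu]
           & measurable B /\ A = Y @^-1` B]] >>.

End interest_rates.

(* Main.v *)
Require Import Defs.
From HB Require Import structures.
From mathcomp Require Import all_boot all_order all_algebra.
From mathcomp Require Import all_classical all_reals all_analysis.
From mathcomp Require Import measurable_realfun.
From mathcomp.real_closed Require Import complex.
From mathcomp Require Import ring lra.

(** Split the exponent of the discounted price as Z_{s,t} = exp(- A(s,t) - W(s,t)), where
      A(s,t) = int_s^t mu_{s,u} du + int_0^s mu_{u,u} du
    is deterministic and W(s,t) is the same expression in the field X. Exchanging the pathwise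
    integrals with the pairing, W(s,t) is the pairing of the noise with the nonnegative kernel
      1_[0,s](x) 1_[0,t](y) kappa(x,y) (t - max(x,y))
    ([discounting_pairing]). Replacing r by s > r changes this kernel only on the strip
    r < x <= s, whereas F_r is generated, up to null events, by the noise on x <= r, which is
    independent of the noise on the strip. Conditioning on F_r therefore amounts to multiplying
    by a Laplace transform ([conditional_laplace], [conditional_expectation_criterion]): with
    Lambda(s,t) = log E exp(- W(s,t)),
      E(Z_{s,t} | F_r) = Z_{r,t} exp((Lambda(s,t) - A(s,t)) - (Lambda(r,t) - A(r,t))).
    So (a) says that Lambda(s,t) - A(s,t) does not depend on s ([martingale_constant_mean]), and
    (c), which compares s with the final date t only, says the same
    ([pricing_constant_mean]).

    It remains to recognise (b). For the noise with Levy measure sigma,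
      Lambda(s,t) = int (exp(- tau f) - 1 + tau f), f the above kernel,
    whose derivative in t is the triple integral of (b), called [rate] below. Integrating in t,
    and once more along the diagonal, gives
      Lambda(s,t) = int_s^t rate(s,u) du + int_0^s rate(u,u) du   ([levy_laplace_rate]),
    an expression of the same shape as A(s,t). If mu_{s,t} = mu_{0,t} + rate(s,t), then
    A(s,t) - Lambda(s,t) = int_0^t mu_{0,u} du, which is free of s. Conversely, if
    A(s,t) - Lambda(s,t) = A(0,t), the derivative in t of this identity is (b)
    ([constant_mean_drift]).

    The noise is given by its characteristic functional alone, so the three probabilistic
    ingredients are extracted from expectations of cosines. Independence over disjoint regions
    holds for cosines by inspection and extends to bounded functions of the noise, because
    these are reached from cosines by linear combinations and bounded pointwise limits
    ([trig_closure_independent]). Laplace transforms, which are not bounded functions of the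
    noise, come from the identity
      E[Y h(Y)] = int z (E h(Y + z) - E h(Y)) dm(z),
    m the image of the jump intensity: it holds for cosines by differentiating the
    characteristic function, passes to Gaussian weights h(y) = exp(- l y - e y^2), there yields a
    bound on E h(Y) uniform in e, hence exponential integrability, and finally, for h
    exponential, a linear differential equation for l |-> E exp(- l Y) ([laplace_transform]).
    Pathwise integrals are compared with dyadic left-endpoint sums, which converge fast in
    L^2 since the increments of X satisfy E |X_v - X_u|^2 <= C |v - u| ([dyadic_sum_cvg]). *)

Set Implicit Arguments.
Unset Strict Implicit.
Unset Printing Implicit Defensive.
Import Order.TTheory GRing.Theory Num.Theory numFieldNormedType.Exports.

Local Open Scope classical_set_scope.
Local Open Scope ring_scope.

(** * Elementary bounds on sine and cosine *)

Section elementary.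
Context {R : realType}.
Implicit Types (f df : R -> R) (x y : R).

Lemma derive_lipschitz f df (M a b : R) : a <= b ->
  (forall x, is_derive x 1 f (df x)) ->
  (forall x, a <= x <= b -> `|df x| <= M) -> `|f b - f a| <= M * (b - a).
Proof.
move=> ab fdf dfM.
have [c cab ->] : exists2 c, c \in `[a, b] & f b - f a = df c * (b - a).
  apply: MVT_segment => //.
  by apply: derivable_within_continuous => x _; have := fdf x.
rewrite normrM (@ger0_norm _ (b - a)) ?subr_ge0// ler_wpM2r ?subr_ge0//.
by apply: dfM; rewrite in_itv in cab.
Qed.

Lemma derive_lipschitzN f df (M a b : R) :
  (forall x, is_derive x 1 f (df x)) ->
  (forall x, `|df x| <= M) -> `|f b - f a| <= M * `|b - a|.
Proof.
move=> fdf dfM; have [ab|/ltW ba] := leP a b.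
  by rewrite [X in _ * X]ger0_norm ?subr_ge0//; apply: derive_lipschitz fdf _.
by rewrite distrC [X in _ * X]distrC [X in _ * X]ger0_norm ?subr_ge0//; apply: derive_lipschitz fdf _.
Qed.

Lemma sin_lipschitz x y : `|sin x - sin y| <= `|x - y|.
Proof.
rewrite -[leRHS]mul1r; apply: (derive_lipschitzN (df := cos)) => z.
exact: cos_max.
Qed.

Lemma cos_lipschitz x y : `|cos x - cos y| <= `|x - y|.
Proof.
rewrite -[leRHS]mul1r; apply: (derive_lipschitzN (df := fun z => - sin z)) => z.
by rewrite normrN sin_max.
Qed.

Lemma normr_sin_le x : `|sin x| <= `|x|.
Proof. by have := sin_lipschitz x 0; rewrite sin0 !subr0. Qed.

Lemma normr_cosB1_le x : `|cos x - 1| <= `|x|.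
Proof. by have := cos_lipschitz x 0; rewrite cos0 !subr0. Qed.

(** For functions whose derivative is at most |z| at z: the cosine, with derivative - sin z, and
    sin z - z, with derivative cos z - 1. These are the real and imaginary parts of
    exp(i z) - 1 - i z, whose integral is the exponent of the characteristic functional. *)
Lemma sqr_lipschitz f df x y : (forall z : R, is_derive z 1 f (df z)) ->
  (forall z, `|df z| <= `|z|) -> `|f x - f y| <= `|x - y| * (`|x| + `|y|).
Proof.
move=> fdf dfz; wlog xy : x y / y <= x => [H|].
  have [/H//|/ltW/H] := leP y x.
  by rewrite distrC [`|y - x|]distrC [`|y| + _]addrC.
rewrite [X in X * _]ger0_norm ?subr_ge0// mulrC.
apply: derive_lipschitz fdf _ => // z /andP[yz zx].
rewrite (le_trans (dfz z))// ler_norml; apply/andP; split.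
  have := normr_ge0 x; have := ler_norm (- y); rewrite normrN; lra.
have := normr_ge0 y; have := ler_norm x; lra.
Qed.

Lemma cos_sqr_lipschitz x y : `|cos x - cos y| <= `|x - y| * (`|x| + `|y|).
Proof.
apply: (sqr_lipschitz (df := fun z => - sin z)) => z.
by rewrite normrN normr_sin_le.
Qed.

Lemma sinB_sqr_lipschitz x y :
  `|(sin x - x) - (sin y - y)| <= `|x - y| * (`|x| + `|y|).
Proof.
apply: (@sqr_lipschitz (fun z => sin z - z) (fun z => cos z - 1)) => z.
exact: normr_cosB1_le.
Qed.

Lemma cosB1_sqr x : `|cos x - 1| <= x ^+ 2.
Proof.
by have := cos_sqr_lipschitz x 0; rewrite cos0 subr0 normr0 addr0 -normrM -expr2 normrX real_normK ?num_real.
Qed.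

Lemma sinB_sqr x : `|sin x - x| <= x ^+ 2.
Proof.
by have := sinB_sqr_lipschitz x 0; rewrite sin0 !subr0 normr0 addr0 -normrM -expr2 normrX real_normK ?num_real.
Qed.

(** Replaces the unbounded x by bounded 1-Lipschitz functions that are sines of
    multiples of x. *)
Lemma cvg_Mn_sin x : n.+1%:R * sin (x / n.+1%:R) @[n --> \oo] --> x.
Proof.
apply/cvgrPdistC_le => e e0.
have : x ^+ 2 * harmonic n @[n --> \oo] --> 0.
  by rewrite -[X in _ --> X](mulr0 (x ^+ 2)); apply: cvgM; [exact: cvg_cst|exact: cvg_harmonic].
move/cvgr0_norm_le => /(_ e e0); apply: filterS => n; apply: le_trans.
have -> : n.+1%:R * sin (x / n.+1%:R) - x = n.+1%:R * (sin (x / n.+1%:R) - x / n.+1%:R).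
  by field.
rewrite normrM normr_nat.
apply: (le_trans (ler_wpM2l _ (sinB_sqr _))) => //.
rewrite (_ : n.+1%:R * (x / n.+1%:R) ^+ 2 = x ^+ 2 * harmonic n) ?ler_norm//.
by rewrite /harmonic /=; field.
Qed.

End elementary.

(** * Bounded functions generated by cosines *)

Section bounded_lipschitz.
Context {T : Type} {R : realType} (D : T -> T -> R).
Hypothesis D_ge0 : forall x y, 0 <= D x y.
Implicit Types (f g : T -> R) (M N : R).

(** One constant serves both as a bound and as a Lipschitz constant for D, so that a uniform
    control of a sequence of functions is a single number. With D constant this is mere
    boundedness; with D the distance on the line it bounds h(y + z) - h(y) by a multiple of
    |z|. *)
Definition bounded_lipschitz M f :=
  (forall x, `|f x| <= M) /\ (forall x y, `|f x - f y| <= M * D x y).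

Lemma bounded_lipschitzD M N f g : bounded_lipschitz M f -> bounded_lipschitz N g ->
  bounded_lipschitz (M + N) (fun x => f x + g x).
Proof.
move=> [fM fD] [gN gD]; split=> [x|x y].
  by rewrite (le_trans (ler_normD _ _))// lerD.
by rewrite opprD addrACA (le_trans (ler_normD _ _))// mulrDl lerD.
Qed.

Lemma bounded_lipschitzZ M a f : bounded_lipschitz M f ->
  bounded_lipschitz (`|a| * M) (fun x => a * f x).
Proof.
move=> [fM fD]; split=> [x|x y]; first by rewrite normrM ler_wpM2l.
by rewrite -mulrBr normrM -mulrA ler_wpM2l.
Qed.

Lemma bounded_lipschitzM M N f g : bounded_lipschitz M f -> bounded_lipschitz N g ->
  bounded_lipschitz (2 * (M * N)) (fun x => f x * g x).
Proof.
move=> [fM fD] [gN gD]; split=> [x|x y].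
  have : `|f x * g x| <= M * N by rewrite normrM ler_pM.
  by have := normr_ge0 (f x * g x); lra.
have -> : f x * g x - f y * g y = f x * (g x - g y) + (f x - f y) * g y by ring.
rewrite (le_trans (ler_normD _ _))// !normrM.
have -> : 2 * (M * N) * D x y = M * (N * D x y) + (M * D x y) * N by ring.
by rewrite lerD// ler_pM.
Qed.

Lemma cvg_series_exp_coeff (x : R) : series (exp_coeff x) n @[n --> \oo] --> expR x.
Proof. by rewrite /expR; exact: is_cvg_series_exp_coeff. Qed.

Lemma series_exp_coeff_le (x : R) n : 0 <= x -> series (exp_coeff x) n <= expR x.
Proof.
move=> x0; have H := @cvg_series_exp_coeff x.
rewrite -(cvg_lim _ H)//; apply: nondecreasing_cvgn_le; last by apply/cvg_ex; exists (expR x).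
by apply/nondecreasing_seqP => k; rewrite /series/= big_nat_recr//= lerDl exp_coeff_ge0.
Qed.

Lemma norm_series_exp_coeff (x M : R) n : `|x| <= M ->
  `|series (exp_coeff x) n| <= expR M.
Proof.
move=> xM; have M0 : 0 <= M by rewrite (le_trans _ xM).
apply: le_trans (series_exp_coeff_le n M0).
rewrite /series/= (le_trans (ler_norm_sum _ _ _))// ler_sum// => i _.
rewrite /exp_coeff /= normrM normfV normrX (@ger0_norm _ i`!%:R)//.
by rewrite ler_wpM2r ?invr_ge0// lerXn2r ?nnegrE.
Qed.

Lemma exprn_lipschitz (x y M : R) n : `|x| <= M -> `|y| <= M ->
  `|x ^+ n.+1 - y ^+ n.+1| <= n.+1%:R * M ^+ n * `|x - y|.
Proof.
move=> xM yM; have M0 : 0 <= M by rewrite (le_trans _ xM).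
elim: n => [|n IH]; first by rewrite !expr1 expr0 mulr1 mul1r.
rewrite (exprS x) (exprS y).
have -> : x * x ^+ n.+1 - y * y ^+ n.+1 =
  x * (x ^+ n.+1 - y ^+ n.+1) + (x - y) * y ^+ n.+1 by ring.
rewrite (le_trans (ler_normD _ _))// !normrM.
have -> : n.+2%:R * M ^+ n.+1 * `|x - y| =
  M * (n.+1%:R * M ^+ n * `|x - y|) + `|x - y| * M ^+ n.+1.
  by rewrite -(addn1 n.+1) natrD exprS; ring.
apply: lerD; first exact: ler_pM.
by rewrite ler_wpM2l// normrX lerXn2r ?nnegrE.
Qed.

(** The partial sums of the exponential series are Lipschitz uniformly in n, with the
    constant exp(M) of the full series, since k x^(k-1) / k! = x^(k-1) / (k-1)!. *)
Lemma series_exp_coeff_lipschitz (x y M : R) n : `|x| <= M -> `|y| <= M ->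
  `|series (exp_coeff x) n - series (exp_coeff y) n| <= expR M * `|x - y|.
Proof.
move=> xM yM; have M0 : 0 <= M by rewrite (le_trans _ xM).
case: n => [|n].
  by rewrite /series/= !big_geq// subrr normr0 mulr_ge0// expR_ge0.
apply: (@le_trans _ _ (series (exp_coeff M) n * `|x - y|)); last first.
  by rewrite ler_wpM2r// series_exp_coeff_le.
rewrite /series/=; elim: n => [|n IH].
  by rewrite !big_nat1 /exp_coeff/= !expr0 subrr normr0 big_geq// mul0r.
rewrite big_nat_recr//= [in X in _ - X]big_nat_recr//= [in leRHS]big_nat_recr//=.
rewrite opprD addrACA (le_trans (ler_normD _ _))// mulrDl lerD//.
rewrite /exp_coeff/= -mulrBl normrM normfV normr_nat ler_pdivrMr ?ltr0n ?fact_gt0//.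
rewrite (le_trans (exprn_lipschitz n xM yM))// factS natrM.
rewrite le_eqVlt; apply/orP; left; apply/eqP; field.
by rewrite pnatr_eq0 -lt0n fact_gt0.
Qed.

Lemma bounded_lipschitz_series_exp M f n : bounded_lipschitz M f ->
  bounded_lipschitz (expR M * (1 + M)) (fun x => series (exp_coeff (f x)) n).
Proof.
move=> [fM fD].
have M0 (x : T) : 0 <= M by rewrite (le_trans _ (fM x)).
split=> [x|x y].
  by rewrite (le_trans (norm_series_exp_coeff n (fM x)))// ler_peMr ?expR_ge0// lerDl (M0 x).
rewrite (le_trans (series_exp_coeff_lipschitz n (fM x) (fM y)))// -mulrA ler_wpM2l ?expR_ge0//.
by rewrite (le_trans (fD x y))// ler_wpM2r// lerDr.
Qed.

End bounded_lipschitz.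

Section trig_closure.
Context {T : Type} {R : realType} (D : T -> T -> R).
Hypothesis D_ge0 : forall x y, 0 <= D x y.
Implicit Types (V : set (T -> R)) (f g : T -> R).

(** The functions to which an identity that is linear and stable under dominated limits
    extends as soon as it holds for the cosines of V. Sines are included through the phase c. *)
Inductive trig_closure V : (T -> R) -> Prop :=
| trig_closure_cos Z c M : V Z -> bounded_lipschitz D M (fun x => cos (Z x + c)) ->
    trig_closure V (fun x => cos (Z x + c))
| trig_closureD f g : trig_closure V f -> trig_closure V g ->
    trig_closure V (fun x => f x + g x)
| trig_closureZ a f : trig_closure V f -> trig_closure V (fun x => a * f x)
| trig_closure_lim (f_ : nat -> T -> R) f M :
    (forall n, trig_closure V (f_ n)) -> (forall n, bounded_lipschitz D M (f_ n)) ->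
    (forall x, f_ n x @[n --> \oo] --> f x) -> trig_closure V f.

Definition linear_set V :=
  V (cst 0) /\ forall a f g, V f -> V g -> V (fun x => a * f x + g x).

Lemma linear_setZ V a f : linear_set V -> V f -> V (fun x => a * f x).
Proof.
move=> [V0 VD] Vf; have := VD a f (cst 0) Vf V0.
by congr (V _); apply/funext => x /=; rewrite addr0.
Qed.

Lemma cvg_norm_le (u : nat -> R) (l M : R) :
  (forall n, `|u n| <= M) -> u n @[n --> \oo] --> l -> `|l| <= M.
Proof.
move=> uM /cvg_norm H.
by apply: (closed_cvg _ (@closed_le R M) _ _ H); near=> n; exact: uM.
Unshelve. all: by end_near. Qed.

Lemma trig_closure_bounded_lipschitz V f : trig_closure V f ->
  exists M, bounded_lipschitz D M f.
Proof.
elim=> {f} [Z c M _ ZM|f g _ [M fM] _ [N gN]|a f _ [M fM]|f_ f M _ _ fM ff].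
- by exists M.
- by exists (M + N); exact: bounded_lipschitzD.
- by exists (`|a| * M); exact: bounded_lipschitzZ.
- exists M; split=> [x|x y]; first by apply: cvg_norm_le (ff x) => n; exact: (fM n).1.
  by apply: cvg_norm_le (cvgB (ff x) (ff y)) => n; exact: (fM n).2.
Qed.

Lemma trig_closure_bounded V f : trig_closure V f ->
  exists M, forall x, `|f x| <= M.
Proof. by move=> /trig_closure_bounded_lipschitz[M [fM _]]; exists M. Qed.

Lemma cosMcos (x y : R) : cos x * cos y = 2^-1 * (cos (x + y) + cos (x - y)).
Proof. by rewrite !cosD cosN sinN; field. Qed.

Definition trig_space V := linear_set V /\
  forall Z, V Z -> exists M, forall c, bounded_lipschitz D M (fun x => cos (Z x + c)).

Lemma trig_closure_cosV V Z c : trig_space V -> V Z ->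
  trig_closure V (fun x => cos (Z x + c)).
Proof. by move=> [_ VD] VZ; have [M ZM] := VD _ VZ; exact: trig_closure_cos (ZM c). Qed.

Lemma trig_closure_sin V Z c : trig_space V -> V Z ->
  trig_closure V (fun x => sin (Z x + c)).
Proof.
move=> tV VZ; have := trig_closure_cosV (c - pi / 2) tV VZ.
by congr (trig_closure V _); apply/funext => x /=; rewrite addrA cosBpihalf.
Qed.

Lemma trig_closure_cst V a : trig_space V -> trig_closure V (cst a).
Proof.
move=> tV; have := trig_closureZ a (trig_closure_cosV 0 tV tV.1.1).
by congr (trig_closure V _); apply/funext => x /=; rewrite addr0 cos0 mulr1.
Qed.

(** A product of two cosines is a combination of cosines because V is a vector space; the
    general case follows by induction on both factors. Hence the closure is an algebra, which
    contains the exponentials of its elements. *)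
Lemma trig_closureM V f g : trig_space V ->
  trig_closure V f -> trig_closure V g -> trig_closure V (fun x => f x * g x).
Proof.
move=> tV tf tg; elim: tf => {f} [Z c N VZ ZN|f h _ IHf _ IHh|a f _ IHf|f_ f M _ IH fM ff].
- elim: tg => {g} [Y d M VY _|g h _ IHg _ IHh|a g _ IHg|g_ g M _ IH gM gg].
  + under eq_fun do rewrite cosMcos.
    apply/trig_closureZ/trig_closureD.
      have := trig_closure_cosV (c + d) tV (tV.1.2 1 Y Z VY VZ).
      congr (trig_closure V _); apply/funext => x /=; congr cos; ring.
    have := trig_closure_cosV (c - d) tV (tV.1.2 (-1) Y Z VY VZ).
    congr (trig_closure V _); apply/funext => x /=; congr cos; ring.
  + under eq_fun do rewrite mulrDr; exact: trig_closureD.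
  + under eq_fun do rewrite mulrCA; exact: trig_closureZ.
  + apply: (trig_closure_lim (f_ := fun n x => cos (Z x + c) * g_ n x)
      (M := 2 * (N * M))) => //.
      by move=> n; exact: bounded_lipschitzM.
    by move=> x; apply: cvgM; [exact: cvg_cst|exact: gg].
- under eq_fun do rewrite mulrDl; exact: trig_closureD.
- under eq_fun do rewrite -mulrA; exact: trig_closureZ.
- have [N gN] := trig_closure_bounded_lipschitz tg.
  apply: (trig_closure_lim (f_ := fun n x => f_ n x * g x) (M := 2 * (M * N))) => //.
    by move=> n; exact: bounded_lipschitzM.
  by move=> x; apply: cvgM; [exact: ff|exact: cvg_cst].
Qed.

Lemma trig_closureX V f n : trig_space V ->
  trig_closure V f -> trig_closure V (fun x => f x ^+ n).
Proof.
move=> lV tf; elim: n => [|n IH]; first by under eq_fun do rewrite expr0; exact: trig_closure_cst.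
by under eq_fun do rewrite exprS; exact: trig_closureM.
Qed.

Lemma trig_closure_expR V f : trig_space V ->
  trig_closure V f -> trig_closure V (fun x => expR (f x)).
Proof.
move=> lV tf; have [M fM] := trig_closure_bounded_lipschitz tf.
apply: (trig_closure_lim (f_ := fun n x => series (exp_coeff (f x)) n)
  (M := expR M * (1 + M))).
- elim=> [|n IH].
    under eq_fun do rewrite /series/= big_geq//; exact: trig_closure_cst.
  under eq_fun do rewrite /series/= big_nat_recr//=.
  apply: trig_closureD => //; rewrite /exp_coeff/=.
  under eq_fun do rewrite mulrC; exact/trig_closureZ/trig_closureX.
- by move=> n; exact: bounded_lipschitz_series_exp.
- by move=> x; exact: cvg_series_exp_coeff.
Qed.

End trig_closure.

Section trig_gauss.
Context {R : realType}.

Definition linear_funs : set (R -> R) := [set Z | exists u, Z = (fun x => u * x)].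

Definition rdist (x y : R) := `|x - y|.

Lemma trig_space_linear_funs : trig_space rdist linear_funs.
Proof.
split.
  split; first by exists 0; apply/funext => x /=; rewrite mul0r.
  move=> a f g [u ->] [v ->]; exists (a * u + v); apply/funext => x; ring.
move=> Z [u ->]; exists (1 + `|u|) => c; split=> [x|x y].
  by rewrite (le_trans (cos_max _))// lerDl.
rewrite (le_trans (cos_lipschitz _ _))//.
have -> : u * x + c - (u * y + c) = u * (x - y) by ring.
by rewrite normrM ler_wpM2r// lerDr.
Qed.

Lemma mulexpN_le1 (q : R) : q * expR (- q) <= 1.
Proof.
rewrite expRN ler_pdivrMr ?expR_gt0// mul1r (le_trans _ (expR_ge1Dx q))//.
by rewrite lerDr.
Qed.

(** Since q'^2 = 4 e q + l^2 for q(s) = e s^2 + l s, the derivative of exp(- q) is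
    controlled by q exp(- q) <= 1. *)
Lemma gauss_lipschitz (l e : R) : 0 < e -> exists M, forall (s s' : R),
  `|expR (- (l * s) - e * s ^+ 2)| <= M /\
  `|expR (- (l * s) - e * s ^+ 2) - expR (- (l * s') - e * s' ^+ 2)| <= M * `|s - s'|.
Proof.
move=> e0; pose q (s : R) := e * s ^+ 2 + l * s.
(* C is the maximum of exp(- q), found by completing the square *)
pose C := expR (l ^+ 2 / (4 * e)).
have qC s : expR (- q s) <= C.
  rewrite /C ler_expR -subr_ge0.
  have -> : l ^+ 2 / (4 * e) - (- q s) = e * (s + l / (2 * e)) ^+ 2.
    by rewrite /q; field; rewrite gt_eqF.
  by rewrite mulr_ge0 ?sqr_ge0// ltW.
have qE s : - (l * s) - e * s ^+ 2 = - q s by rewrite /q; ring.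
have C0 : 0 <= C by exact: expR_ge0.
exists ((1 + l ^+ 2) * C + 4 * e) => s s'; rewrite !qE; split.
  rewrite ger0_norm ?expR_ge0// (le_trans (qC s))// mulrDl mul1r -addrA lerDl.
  by rewrite addr_ge0// mulr_ge0 ?sqr_ge0// ltW.
apply: (@derive_lipschitzN R (fun s => expR (- q s))
  (fun s => expR (- q s) * - (e * (2 * s) + l))).
  move=> x; rewrite /q.
  have H : is_derive x (1:R) (fun s : R => - (e * s ^+ 2 + l * s)) (- (e * (2 * x) + l)).
    apply: is_derive_eq; by rewrite /GRing.scale/=; ring.
  have K : is_derive (- (e * x ^+ 2 + l * x)) 1 expR (expR (- (e * x ^+ 2 + l * x))).
    exact: is_derive_expR.
  exact: (@is_derive1_comp _ expR (fun s : R => - (e * s ^+ 2 + l * s)) _ _ _ K H).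
move=> x; rewrite normrM normrN ger0_norm ?expR_ge0//.
have h : `|e * (2 * x) + l| <= 1 + (4 * e * q x + l ^+ 2).
  have -> : 4 * e * q x + l ^+ 2 = (e * (2 * x) + l) ^+ 2 by rewrite /q; ring.
  rewrite -(real_normK (num_real (e * (2 * x) + l))).
  have : 0 <= (`|e * (2 * x) + l| - 1) ^+ 2 by exact: sqr_ge0.
  have := normr_ge0 (e * (2 * x) + l); nra.
rewrite (le_trans (ler_wpM2l (expR_ge0 _) h))//.
have -> : expR (- q x) * (1 + (4 * e * q x + l ^+ 2)) =
  (1 + l ^+ 2) * expR (- q x) + 4 * e * (q x * expR (- q x)) by ring.
apply: lerD.
  by rewrite ler_wpM2l// addr_ge0// sqr_ge0.
by rewrite ler_piMr ?mulexpN_le1// mulr_ge0// ltW.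
Qed.

(** The exponential of a polynomial in n sin(x / n), with n tending to infinity. The Lipschitz
    bound is uniform in n, since x |-> n sin(x / n) is 1-Lipschitz. *)
Lemma trig_closure_gauss (l e : R) : 0 < e ->
  trig_closure rdist linear_funs (fun x => expR (- (l * x) - e * x ^+ 2)).
Proof.
move=> e0; have tV := trig_space_linear_funs.
have D0 (x y : R) : 0 <= rdist x y by exact: normr_ge0.
pose s n (x : R) : R := n.+1%:R * sin (x / n.+1%:R).
have ts n : trig_closure rdist linear_funs (s n).
  apply: trig_closureZ.
  have := @trig_closure_sin _ _ _ _ (fun x => n.+1%:R^-1 * x) 0 tV.
  rewrite (_ : (fun x => sin (n.+1%:R^-1 * x + 0)) = (fun x => sin (x / n.+1%:R))).
    by apply; exists n.+1%:R^-1.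
  by apply/funext => x; rewrite addr0 mulrC.
have [M gM] := gauss_lipschitz l e0.
apply: (trig_closure_lim (M := M)
  (f_ := fun n x => expR (- (l * s n x) - e * s n x ^+ 2))).
- move=> n; apply: trig_closure_expR => //; apply: trig_closureD.
    by under eq_fun do rewrite -mulNr; exact: trig_closureZ.
  by under eq_fun do rewrite -mulNr; apply/trig_closureZ/trig_closureX.
- move=> n; split=> [x|x y]; first by have [] := gM (s n x) 0.
  have [M0 H] := gM (s n x) (s n y); rewrite (le_trans H)//.
  rewrite ler_wpM2l//; first by rewrite (le_trans _ M0).
  rewrite /s -mulrBr normrM normr_nat.
  rewrite (le_trans (ler_wpM2l _ (sin_lipschitz _ _)))//.
  by rewrite -mulrBl normrM normfV normr_nat mulrC divfK ?pnatr_eq0.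
- move=> x; apply: (@continuous_cvg _ _ _ _ _ _ expR); first exact: continuous_expR.
  have sY : s n x @[n --> \oo] --> x by exact: cvg_Mn_sin.
  apply: cvgB; first by apply: cvgN; apply: cvgM => //; exact: cvg_cst.
  apply: cvgM; [exact: cvg_cst|exact: cvgM].
Qed.

End trig_gauss.

(** With this constant distance every bounded function is Lipschitz, so that [trig_limit] is
    the closure of the cosines under bounded pointwise limits. *)
Definition dist2 {T : Type} {R : realType} (x y : T) : R := 2.
Notation trig_limit := (trig_closure dist2).

Section trig_sets.
Context {T : Type} {R : realType}.
Implicit Types (V : set (T -> R)) (f g : T -> R) (M : R).

Let dist2_ge0 (x y : T) : 0 <= dist2 x y :> R. Proof. by rewrite /dist2. Qed.

Lemma bounded_lipschitz2 M f : (forall x, `|f x| <= M) -> bounded_lipschitz dist2 M f.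
Proof.
move=> fM; split=> // x y; rewrite (le_trans (ler_normB _ _))// /dist2.
by have := fM x; have := fM y; lra.
Qed.

Lemma trig_space2 V : linear_set V -> trig_space dist2 V.
Proof.
by move=> lV; split=> // Z _; exists 1 => c; apply: bounded_lipschitz2 => x; exact: cos_max.
Qed.

(** A composite with Y inherits every step of the generation of the weight from the functions
    y |-> cos(u y + c). *)
Lemma trig_closure_gauss_comp V (Y : T -> R) (l e : R) : linear_set V -> V Y ->
  0 < e -> trig_limit V (fun x => expR (- (l * Y x) - e * Y x ^+ 2)).
Proof.
move=> lV VY e0.
suff H (g : R -> R) : trig_closure rdist linear_funs g -> trig_limit V (fun x => g (Y x)).
  exact: H (trig_closure_gauss l e0).
move=> tg; elim: tg => {g} [Z c M [u ->] _|f g _ tf _ tg|a f _ tf|f_ f M _ tf fM ff].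
- by apply: trig_closure_cosV; [exact: trig_space2|exact: linear_setZ].
- exact: trig_closureD.
- exact: trig_closureZ.
- apply: (trig_closure_lim tf (M := M)) => [n|x]; last exact: ff.
  by apply: bounded_lipschitz2 => x; exact: (fM n).1.
Qed.

Lemma cvgMexpN (c : R) : 0 < c -> n%:R * expR (- (n%:R * c)) @[n --> \oo] --> 0.
Proof.
move=> c0.
apply: (@squeeze_cvgr _ _ _ _ (cst 0) (fun n => 2 / c ^+ 2 * (harmonic n.-1))).
- near=> n; have n0 : (0 < n)%N by near: n; exact: nbhs_infty_gt.
  have n0R : 0 < n%:R :> R by rewrite ltr0n.
  rewrite mulr_ge0 ?expR_ge0//= /harmonic prednK// expRN.
  rewrite ler_pdivrMr ?expR_gt0//.
  apply: (@le_trans _ _ (2 / c ^+ 2 / n%:R * ((n%:R * c) ^+ 2 / 2))).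
    by rewrite le_eqVlt; apply/orP; left; apply/eqP; field; rewrite !gt_eqF.
  apply: ler_wpM2l; first by rewrite !divr_ge0// ?exprn_ge0// ltW.
  have := @expR_ge1Dxn _ (n%:R * c) 1 (mulr_ge0 (ltW n0R) (ltW c0)).
  by apply: le_trans; rewrite lerDr.
- exact: cvg_cst.
- rewrite -[X in _ --> X](mulr0 (2 / c ^+ 2)); apply: cvgM; first exact: cvg_cst.
  rewrite -(cvg_shiftS (fun n => harmonic n.-1 : R)) /=; exact: cvg_harmonic.
Unshelve. all: by end_near. Qed.

(** The double exponential exp(- n exp(n f)) tends to 1 where f < 0 and to 0 where
    f >= 0. *)
Lemma trig_closure_neg V f : linear_set V -> trig_limit V f ->
  trig_limit V (fun x => (f x < 0)%R%:R).
Proof.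
move=> lV tf; have tV := trig_space2 lV.
apply: (trig_closure_lim (f_ := fun n x => expR (- n%:R * expR (n%:R * f x))) (M := 1)).
- by move=> n; apply/trig_closure_expR => //; apply/trig_closureZ/trig_closure_expR => //; exact: trig_closureZ.
- move=> n; apply: bounded_lipschitz2 => x; rewrite ger0_norm ?expR_ge0// -[leRHS]expR0 ler_expR mulNr oppr_le0.
- move=> x; case: ltP => fx /=.
    rewrite -[X in _ --> X]expR0.
    apply: (@continuous_cvg _ _ _ _ _ _ expR); first exact: continuous_expR.
    under eq_fun do rewrite mulNr; rewrite -oppr0; apply: cvgN.
    have := @cvgMexpN (- f x); rewrite oppr_gt0 => /(_ fx).
    by under eq_fun do rewrite mulrN opprK.
  apply: (@squeeze_cvgr _ _ _ _ (cst 0) (fun n => expR (- n%:R))).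
  + near=> n; rewrite expR_ge0 ler_expR mulNr lerN2 ler_peMr//.
    by rewrite -expR0 ler_expR mulr_ge0.
  + exact: cvg_cst.
  + exact: cvgn_expR.
Unshelve. all: by end_near. Qed.

Lemma trig_closure_lt V Z (a : R) : linear_set V -> V Z ->
  trig_limit V (fun x => (Z x < a)%R%:R).
Proof.
move=> lV VZ.
apply: (trig_closure_lim (M := 1)
  (f_ := fun n x => (sin (n.+1%:R^-1 * Z x - a / n.+1%:R) < 0)%R%:R)).
- by move=> n; apply: trig_closure_neg => //; apply: trig_closure_sin; [exact: trig_space2|exact: linear_setZ].
- by move=> n; apply: bounded_lipschitz2 => x; rewrite ger0_norm// lern1 leq_b1.
- move=> x.
  have zE n : n.+1%:R^-1 * Z x - a / n.+1%:R = (Z x - a) / n.+1%:R by rewrite mulrC mulrBl.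
  (* between - pi and pi the sine has the sign of its argument *)
  have small : \forall n \near \oo, `|(Z x - a) / n.+1%:R| < pi.
    have : (Z x - a) / n.+1%:R @[n --> \oo] --> 0.
      by rewrite -[X in _ --> X](mulr0 (Z x - a)); apply: cvgM; [exact: cvg_cst|exact: cvg_harmonic].
    by move=> /cvgr0_norm_lt; apply; exact: pi_gt0.
  apply: cvg_near_cst; near=> n.
  have: `|(Z x - a) / n.+1%:R| < pi by near: n.
  rewrite zE; have [Za|Za] := ltP (Z x) a.
    have -> : Z x - a = - (a - Z x) by rewrite opprB.
    rewrite mulNr normrN sinN oppr_lt0 gtr0_norm ?divr_gt0 ?subr_gt0// => h.
    by rewrite sin_gt0_pi// h divr_gt0// subr_gt0.
  rewrite ger0_norm ?divr_ge0 ?subr_ge0// => h.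
  by rewrite ltNge sin_ge0_pi// divr_ge0 ?subr_ge0//= ltW.
Unshelve. all: by end_near. Qed.

Definition trig_sets V : set (set T) := [set A | trig_limit V \1_A].

(** Complements and intersections are affine operations and products of indicators, and a
    countable union is the limit of finite ones. Hence the events decided by V, which are
    generated by the sets Z < a, all have their indicator in the closure. *)
Lemma trig_sets_sigma_algebra V : linear_set V ->
  sigma_algebra setT (trig_sets V).
Proof.
move=> lV; have tV := trig_space2 lV.
have tC A : trig_sets V A -> trig_sets V (~` A).
  rewrite /trig_sets/= => tA.
  have := trig_closureD (trig_closure_cst 1 tV) (trig_closureZ (-1) tA).
  congr (trig_limit V _); apply/funext => x; rewrite /= !indicE in_setC.
  by case: (x \in A); rewrite ?mulr1 ?subrr// mulr0 addr0.
have tI A B : trig_sets V A -> trig_sets V B -> trig_sets V (A `&` B).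
  by rewrite /trig_sets/= => tA tB; rewrite indicI; exact: trig_closureM.
split.
- rewrite /trig_sets/= indic0; exact: (trig_closure_cst 0 tV).
- by move=> A tA; rewrite setTD; exact: tC.
- move=> A tA.
  have tU n : trig_sets V (\big[setU/set0]_(i < n) A i).
    elim: n => [|n IH]; first by rewrite big_ord0 /trig_sets/= indic0; exact: (trig_closure_cst 0 tV).
    rewrite big_ord_recr/= -[X in trig_sets _ X]setCK setCU; apply: (tC _); apply: (tI _ _); exact: (tC _).
  apply: (trig_closure_lim (M := 1) tU).
    by move=> n; apply: bounded_lipschitz2 => x; rewrite indicE ger0_norm// lern1 leq_b1.
  move=> x; rewrite indicE; have [|] := boolP (x \in _).
    rewrite inE => -[k _ Akx]; apply: cvg_near_cst; near=> n.
    rewrite indicE mem_set// -bigcup_mkord; exists k => //=.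
    by near: n; exact: nbhs_infty_gt.
  rewrite notin_setE => nA; apply: cvg_near_cst; near=> n.
  rewrite indicE memNset// -bigcup_mkord => -[k _ Ak]; apply: nA; by exists k.
Unshelve. all: by end_near. Qed.

Lemma trig_sets_preimage V Z (B : set R) : linear_set V -> V Z ->
  measurable B -> trig_sets V (Z @^-1` B).
Proof.
move=> lV VZ; have [s0 sC sU] := trig_sets_sigma_algebra lV.
rewrite (_ : measurable B = (RGenInftyO.G (R:=R)).-sigma.-measurable B); last first.
  by rewrite -RGenInftyO.measurableE.
move: B; apply: smallest_sub.
  split => /=.
  - by rewrite preimage_set0.
  - by move=> A; rewrite setTD preimage_setC => /sC; rewrite setTD.
  - by move=> A hA; rewrite preimage_bigcup; exact: sU.
move=> _ [a ->] /=.
rewrite /trig_sets/=; have := trig_closure_lt a lV VZ.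
congr (trig_limit V _); apply/funext => x; rewrite indicE; congr (_%:R).
by case: (ltP (Z x) a) => h; [rewrite mem_set//= in_itv/=|rewrite memNset//= in_itv/= ltNge h].
Qed.

Lemma trig_sets_smallest V (G : set (set T)) : linear_set V ->
  G `<=` trig_sets V -> <<s G >> `<=` trig_sets V.
Proof. by move=> lV GV; apply: smallest_sub => //; exact: trig_sets_sigma_algebra. Qed.

End trig_sets.

Section integration.
Context d (T : measurableType d) (R : realType).
Implicit Types (mu : {measure set T -> \bar R}) (P : probability T R) (M : R) (V W : set (T -> R)).

Lemma dominated_cvg_Rintegral mu (f_ : nat -> T -> R) (f g : T -> R) :
  (forall n, measurable_fun setT (f_ n)) ->
  (forall x, f_ n x @[n --> \oo] --> f x) ->
  mu.-integrable setT (EFin \o g) ->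
  (forall n x, `|f_ n x| <= g x) ->
  \int[mu]_x f_ n x @[n --> \oo] --> \int[mu]_x f x.
Proof.
move=> mf ff ig fg.
have mf' : measurable_fun setT f by apply: (measurable_fun_cvg mf) => x _; exact: ff.
have [] := @dominated_convergence _ _ _ mu _ measurableT
  (fun n => EFin \o f_ n) (EFin \o f) (EFin \o g).
- by move=> n; exact/measurable_EFinP.
- exact/measurable_EFinP.
- by apply: aeW => x _ /=; apply/fine_cvgP; split; [exact: nearW|exact: ff].
- exact: ig.
- by apply: aeW => x n _; rewrite lee_fin.
- move=> if_ _ cf; rewrite /Rintegral.
  by apply: fine_cvg; rewrite fineK//; exact: integrable_fin_num.
Qed.

Lemma bounded_integrable P (f : T -> R) M : measurable_fun setT f ->
  (forall x, `|f x| <= M) -> P.-integrable setT (EFin \o f).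
Proof.
move=> mf fM; apply: measurable_bounded_integrable => //.
  by rewrite -ge0_fin_numE ?fin_num_measure.
exists M; split; first exact: num_real.
by move=> z Mz x _ /=; rewrite (le_trans (fM x))// ltW.
Qed.

Lemma measurable_cos_comp (f : T -> R) : measurable_fun setT f ->
  measurable_fun setT (fun x => cos (f x)).
Proof.
move=> mf; apply: measurableT_comp => //; apply: continuous_measurable_fun; exact: continuous_cos.
Qed.

Lemma measurable_sin_comp (f : T -> R) : measurable_fun setT f ->
  measurable_fun setT (fun x => sin (f x)).
Proof.
move=> mf; apply: measurableT_comp => //; apply: continuous_measurable_fun; exact: continuous_sin.
Qed.

Lemma measurable_trig_closure D V (f : T -> R) :
  (forall Z, V Z -> measurable_fun setT Z) -> trig_closure D V f ->
  measurable_fun setT f.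
Proof.
move=> mV; elim=> {f} [Z c M /mV mZ _|f g _ mf _ mg|a f _ mf|f_ f M _ mf _ ff].
- by apply: measurable_cos_comp; exact: measurable_funD.
- exact: measurable_funD.
- exact: measurable_funM.
- by apply: (measurable_fun_cvg mf) => x _; exact: ff.
Qed.

Lemma trig_closure_integrable P V (f : T -> R) :
  (forall Z, V Z -> measurable_fun setT Z) -> trig_limit V f ->
  P.-integrable setT (EFin \o f).
Proof.
move=> mV tf; have [M fM] := trig_closure_bounded tf.
by apply: (@bounded_integrable P _ M) => //; exact: measurable_trig_closure tf.
Qed.

Lemma integrableM_bounded P (f g : T -> R) M : P.-integrable setT (EFin \o f) ->
  measurable_fun setT g -> (forall x, `|g x| <= M) ->
  P.-integrable setT (EFin \o (fun x => f x * g x)).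
Proof.
move=> intf mg gM; have mf : measurable_fun setT f.
  by apply/measurable_EFinP; exact: measurable_int intf.
have M0 (x : T) : 0 <= M by rewrite (le_trans _ (gM x)).
apply: (@le_integrable _ _ _ P setT measurableT _ (fun x => M%:E * (EFin \o f) x)%E).
- by apply/measurable_EFinP; exact: measurable_funM.
- move=> x _ /=; rewrite lee_fin !normrM mulrC ler_wpM2r//.
  by rewrite (le_trans (gM x))// ler_norm.
- exact: integrableZl.
Qed.

(** The product formula is bilinear and stable under bounded limits, so that it spreads from
    the cosines to both closures, one factor at a time. *)
Lemma trig_closure_independent P V W :
  (forall Z, V Z -> measurable_fun setT Z) ->
  (forall Z, W Z -> measurable_fun setT Z) ->
  (forall Y Z u v, V Y -> W Z ->
     \int[P]_x (cos (Y x + u) * cos (Z x + v)) =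
     (\int[P]_x cos (Y x + u)) * (\int[P]_x cos (Z x + v))) ->
  forall f g, trig_limit V f -> trig_limit W g ->
    \int[P]_x (f x * g x) = (\int[P]_x f x) * (\int[P]_x g x).
Proof.
move=> mV mW base f g tf tg.
have iM f' g' : trig_limit V f' -> trig_limit W g' ->
    P.-integrable setT (EFin \o (fun x => f' x * g' x)).
  move=> tf' tg'; have [M gM] := trig_closure_bounded tg'.
  apply: (integrableM_bounded (M := M)) => //.
    exact: trig_closure_integrable tf'.
  exact: measurable_trig_closure tg'.
have iV f' : trig_limit V f' -> P.-integrable setT (EFin \o f').
  exact: trig_closure_integrable.
have iW f' : trig_limit W f' -> P.-integrable setT (EFin \o f').
  exact: trig_closure_integrable.
elim: tf => {f} [Y u N VY YN|f h tf IHf th IHh|a f tf IHf|f_ f M tf IH fM ff].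
- have tY := @trig_closure_cos _ _ _ V Y u _ VY YN.
  elim: tg => {g} [Z v N' WZ _|g h tg IHg th IHh|a g tg IHg|g_ g M tg IH gM gg].
  + exact: base.
  + under eq_Rintegral do rewrite mulrDr.
    rewrite [LHS]RintegralD//; [|exact: iM..].
    rewrite IHg IHh.
    by rewrite RintegralD ?mulrDr//; exact: iW.
  + under eq_Rintegral do rewrite mulrCA.
    rewrite [LHS]RintegralZl ?IHg//; last exact: iM.
    by rewrite RintegralZl 1?mulrCA//; exact: iW.
  + have H1 : \int[P]_x (cos (Y x + u) * g_ n x) @[n --> \oo] -->
        \int[P]_x (cos (Y x + u) * g x).
      apply: (@dominated_cvg_Rintegral P
        (fun n x => cos (Y x + u) * g_ n x) (fun x => cos (Y x + u) * g x) (cst M)) => //.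
      * by move=> n; apply: measurable_funM; [exact: measurable_trig_closure tY|exact: (measurable_trig_closure mW (tg n))].
      * by move=> x; apply: cvgM; [exact: cvg_cst|exact: gg].
      * by apply: (@bounded_integrable P _ `|M|).
      * by move=> n x; rewrite normrM (le_trans _ ((gM n).1 x))// ler_piMl// cos_max.
    have H2 : \int[P]_x (cos (Y x + u) * g_ n x) @[n --> \oo] -->
        (\int[P]_x cos (Y x + u)) * (\int[P]_x g x).
      under eq_fun do rewrite IH.
      apply: cvgM; first exact: cvg_cst.
      apply: (@dominated_cvg_Rintegral P g_ g (cst M)) => //.
      - by move=> n; exact: (measurable_trig_closure mW (tg n)).
      - by apply: (@bounded_integrable P _ `|M|).
      - by move=> n x; exact: (gM n).1.
    by have := cvg_unique _ H1 H2; apply.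
- under eq_Rintegral do rewrite mulrDl.
  rewrite [LHS]RintegralD//; [|exact: iM..].
  rewrite IHf IHh.
  by rewrite RintegralD ?mulrDl//; exact: iV.
- under eq_Rintegral do rewrite -mulrA.
  rewrite [LHS]RintegralZl ?IHf//; last exact: iM.
  by rewrite RintegralZl ?mulrA//; exact: iV.
- have [N gN] := trig_closure_bounded tg.
  have H1 : \int[P]_x (f_ n x * g x) @[n --> \oo] --> \int[P]_x (f x * g x).
    apply: (@dominated_cvg_Rintegral P
        (fun n x => f_ n x * g x) (fun x => f x * g x) (cst (M * N))) => //.
    * by move=> n; apply: measurable_funM; [exact: (measurable_trig_closure mV (tf n))|exact: (measurable_trig_closure mW tg)].
    * by move=> x; apply: cvgM; [exact: ff|exact: cvg_cst].
    * by apply: (@bounded_integrable P _ `|M * N|).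
    * by move=> n x; rewrite normrM ler_pM// (fM n).1.
  have H2 : \int[P]_x (f_ n x * g x) @[n --> \oo] -->
      (\int[P]_x f x) * (\int[P]_x g x).
    under eq_fun do rewrite IH.
    apply: cvgM; last exact: cvg_cst.
    apply: (@dominated_cvg_Rintegral P f_ f (cst M)) => //.
    - by move=> n; exact: (measurable_trig_closure mV (tf n)).
    - by apply: (@bounded_integrable P _ `|M|).
    - by move=> n x; exact: (fM n).1.
  by have := cvg_unique _ H1 H2; apply.
Qed.

End integration.

(** * Real-valued integrals *)

Notation intble mu f := (mu.-integrable setT (EFin \o f)).

Section real_integrals.
Context d (T : measurableType d) (R : realType).
Implicit Types (mu : {measure set T -> \bar R}) (f g : T -> R).

Lemma intble_measurable mu f : intble mu f -> measurable_fun setT f.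
Proof. by move=> /measurable_int/measurable_EFinP. Qed.

Lemma intble_le mu f g : measurable_fun setT f -> (forall x, `|f x| <= g x) ->
  intble mu g -> intble mu f.
Proof.
move=> mf fg; apply: le_integrable => //; first exact/measurable_EFinP.
by move=> x _; rewrite /= lee_fin (le_trans (fg x))// ler_norm.
Qed.

Lemma intbleD mu f g : intble mu f -> intble mu g -> intble mu (fun x => f x + g x).
Proof. by move=> intf intg; apply: (integrableD measurableT intf intg). Qed.

Lemma intbleB mu f g : intble mu f -> intble mu g -> intble mu (fun x => f x - g x).
Proof. by move=> intf intg; apply: (integrableB measurableT intf intg). Qed.

Lemma intbleZ mu a f : intble mu f -> intble mu (fun x => a * f x).
Proof. by move=> intf; apply: (integrableZl measurableT a intf). Qed.

Lemma intble_norm mu f : intble mu f -> intble mu (fun x => `|f x|).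
Proof. by move=> /integrable_norm. Qed.

Lemma le_RintegralT mu f g : intble mu f -> intble mu g ->
  (forall x, f x <= g x) -> \int[mu]_x f x <= \int[mu]_x g x.
Proof. by move=> intf intg fg; apply: le_Rintegral. Qed.

Lemma normr_Rintegral_le mu f g : measurable_fun setT f -> intble mu g ->
  (forall x, `|f x| <= g x) -> `|\int[mu]_x f x| <= \int[mu]_x g x.
Proof.
move=> mf intg fg; have intf := intble_le mf fg intg.
by rewrite (le_trans (le_normr_Rintegral _ _))// le_RintegralT//; exact: intble_norm.
Qed.

Lemma intble_cst (P : probability T R) (k : R) : intble P (fun _ => k).
Proof. exact: (@bounded_integrable _ _ _ P (fun _ => k) `|k|). Qed.

Lemma Rintegral_cstP (P : probability T R) (k : R) : \int[P]_x k = k.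
Proof.
rewrite Rintegral_cst// (_ : fine _ = 1) ?mulr1//.
by have /= -> := @probability_setT _ _ _ P.
Qed.

Lemma intble_fineK mu f : intble mu f ->
  (\int[mu]_x f x)%:E = (\int[mu]_x (f x)%:E)%E.
Proof. by move=> intf; rewrite fineK//; exact: integrable_fin_num. Qed.

(** Integrability of the limit is part of the conclusion: this is how second moments and
    exponential moments are obtained from bounded approximations. *)
Lemma fatou_Rintegral mu (f_ : nat -> T -> R) f (c : nat -> R) l :
  (forall n, intble mu (f_ n)) -> (forall n x, 0 <= f_ n x) ->
  (forall x, f_ n x @[n --> \oo] --> f x) ->
  (forall n, \int[mu]_x f_ n x <= c n) -> c n @[n --> \oo] --> l ->
  intble mu f /\ \int[mu]_x f x <= l.
Proof.
move=> intf f0 ff fc cl.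
have mf : measurable_fun setT f.
  by apply: (measurable_fun_cvg (h := f_)) => [n|x _]; [exact: intble_measurable (intf n)|exact: ff].
have fx0 x : 0 <= f x.
  by apply: (closed_cvg _ (@closed_ge R 0) _ _ (ff x)); near=> n; exact: f0.
have H : (\int[mu]_x (f x)%:E <= l%:E)%E.
  have -> : (\int[mu]_x (f x)%:E = \int[mu]_x limn_einf (fun n => (f_ n x)%:E))%E.
    apply: eq_integral => x _; rewrite (_ : limn_einf _ = (f x)%:E)//.
    by apply: (cvg_limn_einf_sup _).1; apply/fine_cvgP; split; [exact: nearW|exact: ff].
  apply: le_trans; first apply: (@fatou _ _ _ mu setT measurableT (fun n x => (f_ n x)%:E)).
  - by move=> n; apply/measurable_EFinP; exact: intble_measurable (intf n).
  - by move=> n x _; rewrite lee_fin.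
  have cl' : (c n)%:E @[n --> \oo] --> l%:E.
    by apply/fine_cvgP; split; [exact: nearW|exact: cl].
  rewrite limn_einf_lim -(cvg_lim _ cl')//.
  apply: lee_lim; [exact: is_cvg_einfs|by apply/cvg_ex; exists l%:E|].
  near=> n; apply: (@le_trans _ _ (\int[mu]_x (f_ n x)%:E)%E).
    by apply: ereal_inf_lbound; exists n => /=.
  by rewrite -intble_fineK// lee_fin.
have intF : intble mu f.
  apply/integrableP; split; first exact/measurable_EFinP.
  rewrite (eq_integral (fun x => (f x)%:E)); last by move=> x _; rewrite /= ger0_norm.
  by rewrite (le_lt_trans H)// ltry.
by split => //; rewrite -lee_fin intble_fineK.
Unshelve. all: by end_near. Qed.

Lemma is_derive_Rintegral mu (f df : R -> T -> R) (G : T -> R) (a u v : R) :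
  u < a < v -> (forall x, u < x < v -> intble mu (f x)) ->
  (forall (x : R) y, is_derive x 1 (f^~ y) (df x y)) ->
  intble mu G -> (forall x y, u < x < v -> `|df x y| <= G y) ->
  is_derive a (1 : R) (fun x => \int[mu]_y f x y) (\int[mu]_y df a y).
Proof.
move=> auv intf fdf intG dfG.
have Ia : `]u, v[%classic a by rewrite /= in_itv.
have G0 y : 0 <= G y by rewrite (le_trans _ (dfG a y auv)).
have dE x y : 'D_1 (f^~ y) x = df x y by exact: derive_val.
have d1 : forall x y, `]u, v[%classic x -> setT y -> derivable (f ^~ y) x 1.
  by move=> x y _ _; have h := fdf x y; apply: ex_derive.
have d1G : forall x y, `]u, v[%classic x -> setT y -> `|(fun x y => (f ^~ y)^`()%classic x) x y| <= G y.
  by move=> x y /=; rewrite in_itv/= => xuv _; rewrite derive1E dE dfG.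
have i1 x : `]u, v[%classic x -> intble mu (f x).
  by rewrite /= in_itv/=; exact: intf.
apply: DeriveDef.
  exact: (derivable_under_integral measurableT Ia i1 d1 G0 intG d1G).
rewrite -derive1E (differentiation_under_integral measurableT Ia i1 d1 G0 intG d1G).
by apply: eq_Rintegral => y _; rewrite partial1of2E dE.
Qed.

End real_integrals.

(** * Exponential weights tempered by a Gaussian *)

Section gaussian_weight.
Context {R : realType}.
Implicit Types l e y z : R.

(** For e > 0 this bounded function is in the closure of the cosines; as e tends to 0 it
    increases to exp(- l y). *)
Definition gauss_weight l e y := expR (- (l * y) - e * y ^+ 2).

Lemma gauss_weight_le l e y : 0 <= e -> gauss_weight l e y <= expR (- (l * y)).
Proof. by move=> e0; rewrite ler_expR gerDl oppr_le0 mulr_ge0// sqr_ge0. Qed.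

Lemma gauss_weight_pos_le l e y : 0 < l -> 0 <= e -> y * gauss_weight l e y <= l^-1.
Proof.
move=> l0 e0; have [y0|y0] := leP y 0.
  by rewrite (@le_trans _ _ 0)// ?invr_ge0 ?(ltW l0)// mulr_le0_ge0// expR_ge0.
rewrite (le_trans (ler_wpM2l (ltW y0) (gauss_weight_le l y e0)))//.
by rewrite -(ler_pM2l l0) mulrA mulfV ?gt_eqF// mulexpN_le1.
Qed.

(** The decrease of the weight over z is at most z (l + 1 + 2 y^+) times the weight: for
    z <= 1 because the exponent drops by l z + 2 e y z + e z^2, for z >= 1 because it is at
    most the weight itself. The factor y^+ is absorbed by y h(y) <= 1 / l. No bound depends
    on e. *)
Lemma gauss_weight_increment l e y z : 0 < l -> 0 < e <= 1 -> 0 <= z ->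
  z * (gauss_weight l e y - gauss_weight l e (y + z)) <=
  z ^+ 2 * ((l + 1) * gauss_weight l e y + 2 / l).
Proof.
move=> l0 /andP[e0 e1] z0; pose yp := Num.max y 0.
have yp0 : 0 <= yp by rewrite le_max lexx orbT.
have yyp : y <= yp by rewrite le_max lexx.
pose x := l * z + 2 * e * y * z + e * z ^+ 2.
have -> : gauss_weight l e (y + z) = gauss_weight l e y * expR (- x).
  by rewrite /gauss_weight -expRD /x; congr expR; ring.
have h0 : 0 <= gauss_weight l e y := expR_ge0 _.
have H : 1 - expR (- x) <= z * (l + 1 + 2 * yp).
  have [z1|/ltW z1] := leP z 1.
    have := expR_ge1Dx (- x).
    have : x <= z * (l + 1 + 2 * yp).
      have -> : z * (l + 1 + 2 * yp) = l * z + 2 * yp * z + z by ring.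
      rewrite /x; apply: lerD; first apply: lerD => //.
        rewrite ler_wpM2r// -mulrA ler_wpM2l//.
        apply: (@le_trans _ _ (e * yp)); first by rewrite ler_wpM2l// ltW.
        by rewrite ler_piMl.
      by rewrite expr2 mulrA ler_piMl// mulr_ile1// ltW.
    lra.
  apply: (@le_trans _ _ 1); first by rewrite gerBl expR_ge0.
  by rewrite (le_trans z1)// ler_peMr//; have := ltW l0; lra.
have hyp : gauss_weight l e y * yp <= l^-1.
  have [y0|y0] := leP 0 y.
    by rewrite /yp (max_idPl y0) mulrC gauss_weight_pos_le// ltW.
  by rewrite /yp (max_idPr (ltW y0)) mulr0 invr_ge0 ltW.
rewrite -{1}(mulr1 (gauss_weight l e y)) -mulrBr.
rewrite (le_trans (ler_wpM2l z0 (ler_wpM2l h0 H)))//.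
have -> : z * (gauss_weight l e y * (z * (l + 1 + 2 * yp))) =
  z ^+ 2 * ((l + 1) * gauss_weight l e y + 2 * (gauss_weight l e y * yp)) by ring.
by rewrite ler_wpM2l ?sqr_ge0// lerD2l ler_wpM2l.
Qed.

(** Far to the left, for y <= - 2 A, the weight h(y) is at most - y h(y) / (2 A), which is
    accessible through E[Y h(Y)]. *)
Lemma gauss_weight_split l e y (A : R) : 0 < l -> 0 <= e -> 0 < A ->
  gauss_weight l e y <= expR (2 * A * l) + (l^-1 - y * gauss_weight l e y) / (2 * A).
Proof.
move=> l0 e0 A0; have yh := gauss_weight_pos_le y l0 e0.
have h0 : 0 <= gauss_weight l e y := expR_ge0 _.
have [yA|yA] := leP (- (2 * A)) y.
  apply: (@le_trans _ _ (expR (2 * A * l))).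
    rewrite (le_trans (gauss_weight_le l y e0))// ler_expR.
    have : 0 <= l * (y + 2 * A) by rewrite mulr_ge0 ?(ltW l0)//; lra.
    lra.
  by rewrite lerDl divr_ge0 ?subr_ge0// mulr_ge0// ltW.
apply: (@le_trans _ _ ((- y * gauss_weight l e y) / (2 * A))).
  rewrite ler_pdivlMr ?mulr_gt0// mulrC ler_wpM2r//; lra.
rewrite -[leLHS]add0r lerD ?expR_ge0// ler_pM2r ?invr_gt0 ?mulr_gt0//.
by rewrite mulNr lerDr invr_ge0 ltW.
Qed.

(** In the derivative (l + 2 e w) h(w) the term 2 e |w| is at most exp(e w^2), which is
    exactly the Gaussian factor of h; so the bound is free of e. *)
Lemma gauss_weight_lipschitz l e y z : 0 < l -> 0 < e <= 1 -> 0 <= z ->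
  `|gauss_weight l e (y + z) - gauss_weight l e y| <= (l + 1) * expR (- (l * y)) * z.
Proof.
move=> l0 /andP[e0 e1] z0.
rewrite -{2}(addKr y z) [- y + _]addrC.
apply: (@derive_lipschitz _ _ (fun w => gauss_weight l e w * - (l + e * (2 * w)))).
- by rewrite lerDl.
- move=> w.
  have H : is_derive w (1:R) (fun s : R => - (l * s) - e * s ^+ 2) (- (l + e * (2 * w))).
    by apply: is_derive_eq; rewrite /GRing.scale/=; ring.
  have K : is_derive (- (l * w) - e * w ^+ 2) (1 : R) expR (gauss_weight l e w).
    exact: is_derive_expR.
  exact: (@is_derive1_comp _ expR (fun s : R => - (l * s) - e * s ^+ 2) _ _ _ K H).
- move=> w /andP[yw _].
  have k1 : `|l + e * (2 * w)| <= l + expR (e * w ^+ 2).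
    rewrite (le_trans (ler_normD _ _))// ger0_norm ?(ltW l0)// lerD2l.
    rewrite (le_trans _ (expR_ge1Dx _))// normrM (ger0_norm (ltW e0)) normrM normr_nat.
    have := sqr_ge0 (`|w| - 1); rewrite -(real_normK (num_real w)).
    have := normr_ge0 w; nra.
  rewrite normrM normrN ger0_norm ?expR_ge0//.
  rewrite (le_trans (ler_wpM2l (expR_ge0 _) k1))//.
  have -> : gauss_weight l e w * (l + expR (e * w ^+ 2)) =
    l * gauss_weight l e w + expR (- (l * w)).
    rewrite mulrDr mulrC; congr (_ + _); rewrite /gauss_weight -expRD; congr expR; ring.
  have wy : expR (- (l * w)) <= expR (- (l * y)).
    by rewrite ler_expR lerN2 ler_wpM2l// ltW.
  rewrite mulrDl mul1r lerD// ler_wpM2l ?(ltW l0)//.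
  by rewrite (le_trans (gauss_weight_le l w (ltW e0))).
Qed.

Lemma cvg_gauss_weight l y :
  gauss_weight l (harmonic n) y @[n --> \oo] --> expR (- (l * y)).
Proof.
apply: (@continuous_cvg _ _ _ _ _ _ expR); first exact: continuous_expR.
rewrite -[X in _ --> X]subr0; apply: cvgB; first exact: cvg_cst.
rewrite -[X in _ --> X](mul0r (y ^+ 2)); apply: cvgM; [exact: cvg_harmonic|exact: cvg_cst].
Qed.

Lemma harmonic_le1 n : 0 < @harmonic R n <= 1.
Proof. by rewrite /harmonic/= invr_gt0 ltr0n/= invf_le1// ler1n. Qed.

Lemma norm_mul_expR_le l y : 0 <= l <= 2 ->
  `|y * expR (- (l * y))| <= `|y| + expR (- (3 * y)).
Proof.
move=> /andP[l0 l2]; rewrite normrM (ger0_norm (expR_ge0 _)).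
have [y0|/ltW y0] := leP 0 y.
  apply: (@le_trans _ _ `|y|); last by rewrite lerDl expR_ge0.
  by rewrite ler_piMr// -expR0 ler_expR oppr_le0 mulr_ge0.
apply: (@le_trans _ _ (expR (- (3 * y)))); last by rewrite lerDr.
rewrite ler0_norm// (@le_trans _ _ (expR (- y) * expR (- (2 * y))))//; last first.
  by rewrite -expRD ler_expR; lra.
rewrite ler_pM ?expR_ge0// ?oppr_ge0//.
  by rewrite (le_trans _ (expR_ge1Dx _))// lerDr.
rewrite ler_expR; nra.
Qed.

Lemma expRN_sub_sqr z : 0 <= z -> 0 <= expR (- z) - 1 + z <= z ^+ 2.
Proof.
move=> z0; apply/andP; split; first by have := expR_ge1Dx (- z); lra.
have := @derive_lipschitz R (fun x => expR (- x) + x) (fun x => 1 - expR (- x)) z 0 z z0.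
rewrite oppr0 expR0 !addr0 => L.
rewrite (_ : expR (- z) - 1 + z = expR (- z) + z - 1); last by ring.
rewrite (le_trans (ler_norm _))// expr2; apply: L.
  move=> x.
  have H1 : is_derive x (1:R) (fun s : R => - s) (- 1).
    by apply: is_derive_eq.
  have K : is_derive (- x) (1 : R) expR (expR (- x)) by exact: is_derive_expR.
  have L := @is_derive1_comp _ expR (fun s : R => - s) _ _ _ K H1.
  have E : (fun s : R => expR (- s) + s) = (expR \o (fun s : R => - s)) + id.
    by apply/funext => u; rewrite fctE.
  by rewrite E; apply: (is_derive_eq (is_deriveD L (is_derive_id _ _))); ring.
move=> x /andP[x0 xz]; have := expR_ge1Dx (- x).
have : expR (- x) <= 1 by rewrite -expR0 ler_expR oppr_le0.
by move=> h1 h2; rewrite ger0_norm; lra.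
Qed.

End gaussian_weight.

(** * From the characteristic function to the Laplace transform *)

Section laplace_transform.
Context d (T : measurableType d) (R : realType) (P : probability T R) (Y : T -> R).
Context d' (S : measurableType d') (m : {measure set S -> \bar R}) (z : S -> R).
Hypothesis mY : measurable_fun setT Y.
Hypothesis mz : measurable_fun setT z.
Hypothesis z0 : forall s, 0 <= z s.
Hypothesis iz2 : intble m (fun s => z s ^+ 2).

Let a (u : R) := \int[m]_s (cos (u * z s) - 1).
Let b (u : R) := \int[m]_s (sin (u * z s) - u * z s).

Hypothesis charY : forall u v,
  \int[P]_x cos (u * Y x + v) = expR (a u) * cos (b u + v).

Let M2 := \int[m]_s (z s ^+ 2).

Let M2_ge0 : 0 <= M2. Proof. by apply: Rintegral_ge0 => s _; exact: sqr_ge0. Qed.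

Let ma u : measurable_fun setT (fun s => cos (u * z s) - 1).
Proof. by apply: measurable_funB => //; apply: measurable_cos_comp; exact: measurable_funM. Qed.

Let mb u : measurable_fun setT (fun s => sin (u * z s) - u * z s).
Proof.
apply: measurable_funB; last exact: measurable_funM.
by apply: measurable_sin_comp; exact: measurable_funM.
Qed.

Let le_a u s : `|cos (u * z s) - 1| <= u ^+ 2 * z s ^+ 2.
Proof. by rewrite (le_trans (cosB1_sqr _))// exprMn. Qed.

Let le_b u s : `|sin (u * z s) - u * z s| <= u ^+ 2 * z s ^+ 2.
Proof. by rewrite (le_trans (sinB_sqr _))// exprMn. Qed.

Let ia u : intble m (fun s => cos (u * z s) - 1).
Proof. by apply: intble_le (le_a u) _ => //; exact: intbleZ. Qed.

Let ib u : intble m (fun s => sin (u * z s) - u * z s).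
Proof. by apply: intble_le (le_b u) _ => //; exact: intbleZ. Qed.

Let norm_a u : `|a u| <= u ^+ 2 * M2.
Proof.
rewrite /M2 -RintegralZl//; apply: normr_Rintegral_le => //; exact: intbleZ.
Qed.

Let norm_b u : `|b u| <= u ^+ 2 * M2.
Proof.
rewrite /M2 -RintegralZl//; apply: normr_Rintegral_le => //; exact: intbleZ.
Qed.

Let a_le0 u : a u <= 0.
Proof.
rewrite /a -oppr_ge0 -[leRHS]mulN1r -RintegralZl//; apply: Rintegral_ge0 => s _.
by rewrite mulN1r opprB subr_ge0 cos_le1.
Qed.

Let icos u v : intble P (fun x => cos (u * Y x + v)).
Proof.
apply: (@bounded_integrable _ _ _ P _ 1) => [|x]; last exact: cos_max.
by apply: measurable_cos_comp; apply: measurable_funD => //; exact: measurable_funM.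
Qed.

(** The characteristic function at u differs from 1 by O(u^2), which bounds the second moment
    of Y. *)
Let one_sub_char u : 1 - \int[P]_x cos (u * Y x) <= u ^+ 2 * M2 + (u ^+ 2 * M2) ^+ 2.
Proof.
have -> : \int[P]_x cos (u * Y x) = expR (a u) * cos (b u).
  by rewrite -[in RHS](addr0 (b u)) -charY; apply: eq_Rintegral => x _; rewrite addr0.
have e1 : expR (a u) <= 1 by rewrite -expR0 ler_expR.
have e0 := expR_gt0 (a u).
have h1 := expR_ge1Dx (a u).
have h2 := norm_a u; have h3 := cosB1_sqr (b u).
have h4 : b u ^+ 2 <= (u ^+ 2 * M2) ^+ 2.
  by rewrite -(real_normK (num_real (b u))) lerXn2r ?nnegrE// (le_trans _ (norm_b u)).
move: h2 h3; rewrite !ler_norml => /andP[h2 _] /andP[h3 h3'].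
have : expR (a u) * (1 - cos (b u)) <= 1 - cos (b u).
  by rewrite ler_piMl// subr_ge0 cos_le1.
lra.
Qed.

Lemma laplace_sqr_integrable : intble P (fun x => Y x ^+ 2) /\
  \int[P]_x Y x ^+ 2 <= 2 * M2.
Proof.
(* 2 n^2 (1 - cos(Y / n)) is nonnegative and tends to Y^2 *)
pose f_ n x : R := 2 * n.+1%:R ^+ 2 * (1 - cos (n.+1%:R^-1 * Y x)).
pose c n : R := 2 * M2 + 2 * M2 ^+ 2 * harmonic n ^+ 2.
apply: (@fatou_Rintegral _ _ _ P f_ _ c).
- move=> n; apply: intbleZ; apply: intbleB.
    by exact: intble_cst.
  by have := icos n.+1%:R^-1 0; under eq_fun do rewrite addr0.
- by move=> n x; rewrite !mulr_ge0// subr_ge0 cos_le1.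
- move=> x.
  have fE n : f_ n x = (2 * (n.+1%:R * sin ((Y x / 2) / n.+1%:R))) ^+ 2.
    rewrite /f_ (_ : n.+1%:R^-1 * Y x = (Y x / 2 / n.+1%:R) *+ 2); last by rewrite -mulr_natr; field.
    by rewrite cos_mulr2n cos2sin2; ring.
  have -> : (fun n => f_ n x) = (fun n => (2 * (n.+1%:R * sin ((Y x / 2) / n.+1%:R))) ^+ 2).
    by apply/funext => n; exact: fE.
  rewrite (_ : Y x ^+ 2 = (2 * (Y x / 2)) ^+ 2); last by field.
  by apply: cvgM; apply: cvgM; (exact: cvg_cst || exact: cvg_Mn_sin).
- move=> n; have i1 : intble P (fun x => cos (n.+1%:R^-1 * Y x)).
    by have := icos n.+1%:R^-1 0; under eq_fun do rewrite addr0.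
  have i2 : intble P (fun _ => 1 : R) by exact: intble_cst.
  rewrite /f_ RintegralZl//; last exact: intbleB.
  rewrite RintegralB// Rintegral_cstP.
  rewrite (le_trans (ler_wpM2l _ (one_sub_char _)))//.
  by rewrite /c /harmonic/= le_eqVlt; apply/orP; left; apply/eqP; field.
- rewrite /c -[X in _ --> X]addr0; apply: cvgD; first exact: cvg_cst.
  rewrite -[X in _ --> X](mulr0 (2 * M2 ^+ 2)); apply: cvgM; first exact: cvg_cst.
  rewrite -[X in _ --> X](mulr0 0); apply: cvgM; exact: cvg_harmonic.
Qed.


Let iY : intble P Y.
Proof.
apply: (@intble_le _ _ _ P Y (fun x => 1 + Y x ^+ 2)) => //.
  move=> x; have := sqr_ge0 (`|Y x| - 1); rewrite -(real_normK (num_real (Y x))).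
  have := normr_ge0 (Y x); nra.
by apply: intbleD; [exact: intble_cst|exact: laplace_sqr_integrable.1].
Qed.

Let da u := \int[m]_s (- z s * sin (u * z s)).
Let db u := \int[m]_s (z s * cos (u * z s) - z s).

Let mda u : measurable_fun setT (fun s => - z s * sin (u * z s)).
Proof.
apply: measurable_funM; first exact: measurable_funN.
by apply: measurable_sin_comp; exact: measurable_funM.
Qed.

Let mdb u : measurable_fun setT (fun s => z s * cos (u * z s) - z s).
Proof.
apply: measurable_funB => //; apply: measurable_funM => //.
by apply: measurable_cos_comp; exact: measurable_funM.
Qed.

Let le_da u s : `|- z s * sin (u * z s)| <= `|u| * z s ^+ 2.
Proof.
rewrite normrM normrN (ger0_norm (z0 s)) expr2 mulrCA ler_wpM2l//.
by rewrite (le_trans (normr_sin_le _))// normrM (@ger0_norm _ (z s)).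
Qed.

Let le_db u s : `|z s * cos (u * z s) - z s| <= `|u| * z s ^+ 2.
Proof.
rewrite -[X in _ - X]mulr1 -mulrBr normrM (ger0_norm (z0 s)) expr2 mulrCA ler_wpM2l//.
by rewrite (le_trans (normr_cosB1_le _))// normrM (@ger0_norm _ (z s)).
Qed.

Let ida u : intble m (fun s => - z s * sin (u * z s)).
Proof. by apply: intble_le (le_da u) _ => //; exact: intbleZ. Qed.

Let idb u : intble m (fun s => z s * cos (u * z s) - z s).
Proof. by apply: intble_le (le_db u) _ => //; exact: intbleZ. Qed.

Let near_u (u x : R) : u - 1 < x < u + 1 -> `|x| <= `|u| + 1.
Proof.
move=> /andP[h1 h2]; rewrite ler_norml.
by have := ler_norm u; have := ler_norm (- u); rewrite normrN; lra.
Qed.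

Let is_derive_a u : is_derive u (1 : R) a (da u).
Proof.
apply: (@is_derive_Rintegral _ _ _ m (fun u s => cos (u * z s) - 1)
  (fun u s => - z s * sin (u * z s)) (fun s => (`|u| + 1) * z s ^+ 2)
  u (u - 1) (u + 1)).
- lra.
- by move=> x _.
- move=> x s.
  have H : is_derive x (1 : R) (fun u : R => u * z s) (z s).
    by apply: is_derive_eq; rewrite /GRing.scale/=; ring.
  have K : is_derive (x * z s) (1 : R) cos (- sin (x * z s)) by exact: is_derive_cos.
  have L := @is_derive1_comp _ cos (fun u : R => u * z s) _ _ _ K H.
  by apply: is_derive_eq; rewrite /GRing.scale/=; ring.
- exact: intbleZ.
- by move=> x s /near_u xu; rewrite (le_trans (le_da x s))// ler_wpM2r// sqr_ge0.
Qed.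

Let is_derive_b u : is_derive u (1 : R) b (db u).
Proof.
apply: (@is_derive_Rintegral _ _ _ m (fun u s => sin (u * z s) - u * z s)
  (fun u s => z s * cos (u * z s) - z s) (fun s => (`|u| + 1) * z s ^+ 2)
  u (u - 1) (u + 1)).
- lra.
- by move=> x _.
- move=> x s.
  have H : is_derive x (1 : R) (fun u : R => u * z s) (z s).
    by apply: is_derive_eq; rewrite /GRing.scale/=; ring.
  have K : is_derive (x * z s) (1 : R) sin (cos (x * z s)) by exact: is_derive_sin.
  have L := @is_derive1_comp _ sin (fun u : R => u * z s) _ _ _ K H.
  by apply: is_derive_eq; rewrite /GRing.scale/=; ring.
- exact: intbleZ.
- by move=> x s /near_u xu; rewrite (le_trans (le_db x s))// ler_wpM2r// sqr_ge0.
Qed.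

Let charYsin u v : \int[P]_x sin (u * Y x + v) = expR (a u) * sin (b u + v).
Proof.
under eq_Rintegral do rewrite -cosBpihalf -addrA.
by rewrite charY addrA cosBpihalf.
Qed.

Let charY_deriv u v : \int[P]_x (Y x * cos (u * Y x + v)) =
  expR (a u) * (da u * sin (b u + v) + db u * cos (b u + v)).
Proof.
have H1 : is_derive u (1 : R) (fun u => \int[P]_x sin (u * Y x + v))
    (\int[P]_x (Y x * cos (u * Y x + v))).
  apply: (@is_derive_Rintegral _ _ _ P (fun u x => sin (u * Y x + v))
    (fun u x => Y x * cos (u * Y x + v)) (fun x => `|Y x|) u (u - 1) (u + 1)).
  - lra.
  - move=> x _; apply: (@bounded_integrable _ _ _ P _ 1) => [|y]; last exact: sin_max.
    by apply: measurable_sin_comp; apply: measurable_funD => //; exact: measurable_funM.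
  - move=> x y.
    have H : is_derive x (1 : R) (fun u : R => u * Y y + v) (Y y).
      by apply: is_derive_eq; rewrite /GRing.scale/=; ring.
    have K : is_derive (x * Y y + v) (1 : R) sin (cos (x * Y y + v)) by exact: is_derive_sin.
    have L := @is_derive1_comp _ sin (fun u : R => u * Y y + v) _ _ _ K H.
    by apply: is_derive_eq; rewrite mulrC.
  - exact: intble_norm.
  - by move=> x y _; rewrite normrM ler_piMr// cos_max.
have Ka : is_derive (a u) (1 : R) expR (expR (a u)) by exact: is_derive_expR.
have H2 : is_derive u (1 : R) (fun u => b u + v) (db u).
  have hb := is_derive_b u.
  by apply: is_derive_eq; rewrite addr0.
have Kb : is_derive (b u + v) (1 : R) sin (cos (b u + v)) by exact: is_derive_sin.
have La := @is_derive1_comp _ expR a _ _ _ Ka (is_derive_a u).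
have Lb := @is_derive1_comp _ sin (fun u => b u + v) _ _ _ Kb H2.
have H3 : is_derive u (1 : R) (fun u => expR (a u) * sin (b u + v))
  (expR (a u) * (da u * sin (b u + v) + db u * cos (b u + v))).
  have := is_deriveM La Lb; rewrite /GRing.scale/= => H.
  apply: (is_derive_eq H); ring.
have E : (fun u => \int[P]_x sin (u * Y x + v)) = (fun u => expR (a u) * sin (b u + v)).
  by apply/funext => w; exact: charYsin.
rewrite E in H1.
by rewrite -(@derive_val _ _ _ _ _ _ _ H1) (@derive_val _ _ _ _ _ _ _ H3).
Qed.

(** For the centered infinitely divisible variable Y with jumps z under the intensity m, this
    identity with h = exp(i u y) is the logarithmic derivative of the characteristic function. The
    measurability clause allows the right-hand side to be integrated. *)
Definition stein (h : R -> R) :=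
  measurable_fun setT (fun s => \int[P]_x h (Y x + z s)) /\
  \int[P]_x (Y x * h (Y x)) =
  \int[m]_s (z s * (\int[P]_x h (Y x + z s) - \int[P]_x h (Y x))).

Let stein_cos u v : stein (fun y => cos (u * y + v)).
Proof.
have E s : \int[P]_x cos (u * (Y x + z s) + v) = expR (a u) * cos (b u + (v + u * z s)).
  by rewrite -charY; apply: eq_Rintegral => x _; congr cos; ring.
split.
  under eq_fun do rewrite E; apply: measurable_funM => //; apply: measurable_cos_comp.
  by apply: measurable_funD => //; apply: measurable_funD => //; exact: measurable_funM.
rewrite charY_deriv charY.
have EE s : z s * (\int[P]_x cos (u * (Y x + z s) + v) - expR (a u) * cos (b u + v)) =
    expR (a u) * (sin (b u + v) * (- z s * sin (u * z s)) +
     cos (b u + v) * (z s * cos (u * z s) - z s)).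
  by rewrite E addrA cosD; ring.
under eq_Rintegral do rewrite EE.
rewrite RintegralZl//; last by apply: intbleD; exact: intbleZ.
rewrite RintegralD//; [|exact: intbleZ..].
by rewrite !RintegralZl// /da /db; ring.
Qed.

Let mYz s : measurable_fun setT (fun x => Y x + z s).
Proof. exact: measurable_funD. Qed.

Let linear_funs_measurable (Z : R -> R) : linear_funs Z -> measurable_fun setT Z.
Proof. by move=> [u ->]; exact: measurable_funM. Qed.

Let lip_comp (h : R -> R) M s : measurable_fun setT h -> bounded_lipschitz rdist M h ->
  intble P (fun x => h (Y x + z s)).
Proof.
move=> mh [hM _]; apply: (@bounded_integrable _ _ _ P _ M) => [|x]; last exact: hM.
by apply: measurableT_comp.
Qed.

Let lip_comp0 (h : R -> R) M : measurable_fun setT h -> bounded_lipschitz rdist M h ->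
  intble P (fun x => h (Y x)).
Proof.
move=> mh [hM _]; apply: (@bounded_integrable _ _ _ P _ M) => [|x]; last exact: hM.
exact: measurableT_comp.
Qed.

Let lip_Y (h : R -> R) M : measurable_fun setT h -> bounded_lipschitz rdist M h ->
  intble P (fun x => Y x * h (Y x)).
Proof.
move=> mh [hM _]; apply: (@intble_le _ _ _ P _ (fun x => M * `|Y x|)).
- by apply: measurable_funM => //; exact: measurableT_comp.
- by move=> x; rewrite normrM mulrC ler_wpM2r.
- by apply: intbleZ; exact: intble_norm.
Qed.

Let lip_diff (h : R -> R) M s : measurable_fun setT h -> bounded_lipschitz rdist M h ->
  `|z s * (\int[P]_x h (Y x + z s) - \int[P]_x h (Y x))| <= M * z s ^+ 2.
Proof.
move=> mh hM; rewrite normrM (ger0_norm (z0 s)) expr2 mulrCA ler_wpM2l//.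
rewrite -RintegralB//; [|exact: lip_comp hM|exact: lip_comp0 hM].
rewrite [leRHS](_ : _ = \int[P]_x (M * z s)); last first.
  by rewrite Rintegral_cstP.
apply: normr_Rintegral_le; last 2 first.
- exact: intble_cst.
- by move=> x; rewrite (le_trans (hM.2 _ _))// /rdist addrC addKr ger0_norm.
by apply: measurable_funB; exact: measurableT_comp.
Qed.

(** The identity is linear in h. In a limit, the left-hand side is dominated by M |Y| and, because
    all h are M-Lipschitz, the right-hand side by M z^2; both are integrable. *)
Lemma trig_closure_stein (h : R -> R) : trig_closure rdist linear_funs h -> stein h.
Proof.
have mtrig (h' : R -> R) : trig_closure rdist linear_funs h' -> measurable_fun setT h'.
  exact: measurable_trig_closure.
have iint (h' : R -> R) : trig_closure rdist linear_funs h' -> stein h' ->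
    intble m (fun s => z s * (\int[P]_x h' (Y x + z s) - \int[P]_x h' (Y x))).
  move=> th' [mh' _]; have [M h'M] := trig_closure_bounded_lipschitz th'.
  apply: (@intble_le _ _ _ m _ (fun s => M * z s ^+ 2)); last exact: intbleZ.
    by apply: measurable_funM => //; exact: measurable_funB.
  by move=> s; apply: lip_diff => //; exact: mtrig.
elim=> {h} [Z c M [u ->] _|f g tf sf tg sg|k f tf sf|f_ f M tf sf fM ff].
- exact: stein_cos.
- have [M fM] := trig_closure_bounded_lipschitz tf.
  have [N gN] := trig_closure_bounded_lipschitz tg.
  have [mf mg] := (mtrig _ tf, mtrig _ tg).
  have E s : \int[P]_x (f (Y x + z s) + g (Y x + z s)) =
      \int[P]_x f (Y x + z s) + \int[P]_x g (Y x + z s).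
    by rewrite RintegralD//; [exact: lip_comp fM|exact: lip_comp gN].
  split; first by under eq_fun do rewrite E; apply: measurable_funD; [exact: sf.1|exact: sg.1].
  under eq_Rintegral do rewrite mulrDr.
  rewrite [LHS]RintegralD//; [|exact: lip_Y fM|exact: lip_Y gN].
  rewrite sf.2 sg.2 -RintegralD//; [|exact: iint..].
  apply: eq_Rintegral => s _; rewrite E RintegralD//; [ring|exact: lip_comp0 fM|exact: lip_comp0 gN].
- have [M fM] := trig_closure_bounded_lipschitz tf.
  have mf := mtrig _ tf.
  have E s : \int[P]_x (k * f (Y x + z s)) = k * \int[P]_x f (Y x + z s).
    by rewrite RintegralZl//; exact: lip_comp fM.
  split; first by under eq_fun do rewrite E; apply: measurable_funM => //; exact: sf.1.
  under eq_Rintegral do rewrite mulrCA.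
  rewrite [LHS]RintegralZl//; last exact: lip_Y fM.
  rewrite sf.2 -RintegralZl//; last exact: iint.
  apply: eq_Rintegral => s _; rewrite E RintegralZl//; [ring|exact: lip_comp0 fM].
- have mf n := mtrig _ (tf n).
  have cE s : \int[P]_x f_ n (Y x + z s) @[n --> \oo] --> \int[P]_x f (Y x + z s).
    apply: (@dominated_cvg_Rintegral _ _ _ P _ _ (fun _ => M)).
    - by move=> n; apply: measurableT_comp.
    - by move=> x; exact: ff.
    - exact: intble_cst.
    - by move=> n x; exact: (fM n).1.
  have cE0 : \int[P]_x f_ n (Y x) @[n --> \oo] --> \int[P]_x f (Y x).
    apply: (@dominated_cvg_Rintegral _ _ _ P _ _ (fun _ => M)).
    - by move=> n; apply: measurableT_comp.
    - by move=> x; exact: ff.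
    - exact: intble_cst.
    - by move=> n x; exact: (fM n).1.
  split.
    apply: (@measurable_fun_cvg _ _ _ _ (fun n s => \int[P]_x f_ n (Y x + z s))) => [n|s _].
      exact: (sf n).1.
    exact: cE.
  have L : \int[P]_x (Y x * f_ n (Y x)) @[n --> \oo] --> \int[P]_x (Y x * f (Y x)).
    apply: (@dominated_cvg_Rintegral _ _ _ P _ _ (fun x => M * `|Y x|)).
    - by move=> n; apply: measurable_funM => //; exact: measurableT_comp.
    - by move=> x; apply: cvgM; [exact: cvg_cst|exact: ff].
    - by apply: intbleZ; exact: intble_norm.
    - by move=> n x; rewrite normrM mulrC ler_wpM2r// (fM n).1.
  have N : \int[m]_s (z s * (\int[P]_x f_ n (Y x + z s) - \int[P]_x f_ n (Y x)))
      @[n --> \oo] -->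
      \int[m]_s (z s * (\int[P]_x f (Y x + z s) - \int[P]_x f (Y x))).
    apply: (@dominated_cvg_Rintegral _ _ _ m _ _ (fun s => M * z s ^+ 2)).
    - move=> n; apply: measurable_funM => //; apply: measurable_funB => //; exact: (sf n).1.
    - by move=> s; apply: cvgM; [exact: cvg_cst|apply: cvgB; [exact: cE|exact: cE0]].
    - exact: intbleZ.
    - by move=> n s; apply: lip_diff.
  have N' : \int[P]_x (Y x * f_ n (Y x)) @[n --> \oo] -->
      \int[m]_s (z s * (\int[P]_x f (Y x + z s) - \int[P]_x f (Y x))).
    rewrite (_ : (fun n => \int[P]_x (Y x * f_ n (Y x))) = (fun n =>
      \int[m]_s (z s * (\int[P]_x f_ n (Y x + z s) - \int[P]_x f_ n (Y x))))) //.
    by apply/funext => n; exact: (sf n).2.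
  by have := cvg_unique _ L N'; apply.
Qed.


Let measurable_gauss (l e : R) : measurable_fun setT (gauss_weight l e).
Proof.
apply: measurableT_comp => //; apply: measurable_funB.
  by apply: measurable_funN; exact: measurable_funM.
by apply: measurable_funM => //; exact: measurable_funM.
Qed.

Let mexp l : measurable_fun setT (fun x => expR (- (l * Y x))).
Proof.
by apply: measurableT_comp => //; apply: measurable_funN; exact: measurable_funM.
Qed.

Section gauss_bound.
Variables l e : R.
Hypotheses (l0 : 0 < l) (e01 : 0 < e <= 1).
Let h := gauss_weight l e.
(* so large that M2 (l + 1) / (2 A) <= 1/2, which allows E h(Y) to be absorbed into
   the left-hand side of its own bound *)
Let A := M2 * (l + 1) + 1.

Let th : trig_closure rdist linear_funs h.
Proof. by apply: trig_closure_gauss; case/andP: e01. Qed.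

(** By the identity applied to h, - E[Y h(Y)] is an integral of decreases of h, at most
    M2 ((l + 1) E h(Y) + 2 / l); on the other hand E h(Y) is at most a constant plus
    - E[Y h(Y)] / (2 A). The resulting bound does not depend on e. *)
Lemma gauss_weight_expectation :
  \int[P]_x h (Y x) <= 2 * expR (2 * A * l) + (2 * M2 + 1) / (l * A).
Proof.
have [M hM] := trig_closure_bounded_lipschitz th.
have mh : measurable_fun setT h by exact: measurable_gauss.
have [mst st] := trig_closure_stein th.
have /andP[e0 _] := e01.
have ih0 := lip_comp0 mh hM.
set I := \int[P]_x h (Y x).
have I0 : 0 <= I by apply: Rintegral_ge0 => x _; exact: expR_ge0.
have A1 : 1 <= A by rewrite /A lerDr mulr_ge0// addr_ge0// ltW.
have A0 : 0 < A by rewrite (lt_le_trans _ A1).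
have H1 : \int[P]_x (- (Y x * h (Y x))) <= M2 * ((l + 1) * I + 2 / l).
  under eq_Rintegral do rewrite -mulN1r.
  rewrite RintegralZl//; last exact: lip_Y hM.
  rewrite st -RintegralZl//; last first.
    apply: (@intble_le _ _ _ m _ (fun s => M * z s ^+ 2)); last exact: intbleZ.
      by apply: (measurable_funM mz); apply: (measurable_funB mst); exact: measurable_cst.
    by move=> s; exact: lip_diff.
  rewrite [leRHS](_ : _ = \int[m]_s (((l + 1) * I + 2 / l) * z s ^+ 2)); last first.
    by rewrite RintegralZl// mulrC.
  apply: le_RintegralT.
  - apply: intbleZ; apply: (@intble_le _ _ _ m _ (fun s => M * z s ^+ 2)); last exact: intbleZ.
      by apply: (measurable_funM mz); apply: (measurable_funB mst); exact: measurable_cst.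
    by move=> s; exact: lip_diff.
  - exact: intbleZ.
  - move=> s; rewrite mulN1r -mulrN opprB.
    rewrite -RintegralB//; last exact: lip_comp hM.
    rewrite -RintegralZl//; last by apply: intbleB => //; exact: lip_comp hM.
    rewrite [leRHS](_ : _ = \int[P]_x (z s ^+ 2 * ((l + 1) * h (Y x) + 2 / l))); last first.
      rewrite RintegralZl//; last by apply: intbleD; [exact: intbleZ|exact: intble_cst].
      rewrite RintegralD//; [|exact: intbleZ|exact: intble_cst].
      by rewrite RintegralZl// Rintegral_cstP mulrC.
    apply: le_RintegralT.
    + by apply: intbleZ; apply: intbleB => //; exact: lip_comp hM.
    + by apply: intbleZ; apply: intbleD; [exact: intbleZ|exact: intble_cst].
    + by move=> x; apply: gauss_weight_increment.
have H2 : I <= expR (2 * A * l) + (l^-1 + \int[P]_x (- (Y x * h (Y x)))) / (2 * A).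
  have iN : intble P (fun x => - (Y x * h (Y x))).
    by under eq_fun do rewrite -mulN1r; apply: intbleZ; exact: lip_Y hM.
  rewrite [leRHS](_ : _ = \int[P]_x (expR (2 * A * l) +
      (2 * A)^-1 * (l^-1 + (- (Y x * h (Y x)))))); last first.
    rewrite RintegralD//; [|exact: intble_cst|by apply/intbleZ/intbleD => //; exact: intble_cst].
    rewrite RintegralZl//; last by apply: intbleD => //; exact: intble_cst.
    by rewrite RintegralD//; [rewrite !Rintegral_cstP [X in _ = _ + X]mulrC|exact: intble_cst].
  apply: le_RintegralT => //.
    by apply: intbleD; [exact: intble_cst|apply/intbleZ/intbleD => //; exact: intble_cst].
  move=> x; have := @gauss_weight_split R l e (Y x) A l0 (ltW e0) A0.
  by rewrite [X in _ + X]mulrC.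
have H3 : I <= expR (2 * A * l) + (l^-1 + (A * I + 2 * M2 / l)) / (2 * A).
  apply: (le_trans H2); rewrite lerD2l ler_pM2r ?invr_gt0 ?mulr_gt0// lerD2l.
  apply: (le_trans H1); rewrite /A.
  have : 0 <= I by []; lra.
have : (l^-1 + (A * I + 2 * M2 / l)) / (2 * A) = I / 2 + (2 * M2 + 1) / (l * A) / 2.
  by field; rewrite !gt_eqF.
lra.
Qed.

End gauss_bound.

(** By Fatou, letting e tend to 0 in the uniform bound on the tempered weights. *)
Lemma laplace_integrable l : 0 < l -> intble P (fun x => expR (- (l * Y x))).
Proof.
move=> l0.
have [|||||] // := @fatou_Rintegral _ _ _ P (fun n x => gauss_weight l (harmonic n) (Y x))
  (fun x => expR (- (l * Y x)))
  (fun=> 2 * expR (2 * (M2 * (l + 1) + 1) * l) + (2 * M2 + 1) / (l * (M2 * (l + 1) + 1)))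
  (2 * expR (2 * (M2 * (l + 1) + 1) * l) + (2 * M2 + 1) / (l * (M2 * (l + 1) + 1))).
- move=> n; have [M hM] := trig_closure_bounded_lipschitz (trig_closure_gauss l (andP (harmonic_le1 n)).1).
  by apply: lip_comp0 hM; exact: measurable_gauss.
- by move=> n x; exact: expR_ge0.
- by move=> x; exact: cvg_gauss_weight.
- by move=> n; apply: gauss_weight_expectation => //; exact: harmonic_le1.
- exact: cvg_cst.
Qed.

Let iYexp l : 0 <= l <= 2 -> intble P (fun x => Y x * expR (- (l * Y x))).
Proof.
move=> l02; apply: (@intble_le _ _ _ P _ (fun x => `|Y x| + expR (- (3 * Y x)))).
- exact: measurable_funM.
- by move=> x; exact: norm_mul_expR_le.
- by apply: intbleD; [exact: intble_norm|exact: laplace_integrable].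
Qed.

(** The identity for the tempered weights, as e tends to 0: E h(Y + z) tends to
    exp(- l z) E exp(- l Y), and the uniform Lipschitz bound dominates the right-hand side
    by a multiple of z^2. *)
Lemma stein_exp l : 0 < l <= 2 ->
  \int[P]_x (Y x * expR (- (l * Y x))) =
  \int[P]_x expR (- (l * Y x)) * \int[m]_s (z s * (expR (- (l * z s)) - 1)).
Proof.
move=> /andP[l0 l2].
have th n := trig_closure_gauss l (andP (@harmonic_le1 R n)).1.
pose h n y := gauss_weight l (harmonic n) y.
have mh n : measurable_fun setT (h n) by exact: measurable_gauss.
have h0 n y : 0 <= h n y by exact: expR_ge0.
have hle n y : `|h n y| <= expR (- (l * y)).
  by rewrite ger0_norm// gauss_weight_le// ltW//; case/andP: (@harmonic_le1 R n).
have iE := laplace_integrable l0.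
set L := \int[P]_x expR (- (l * Y x)).
have ihc n s : intble P (fun x => h n (Y x + z s)).
  have [M hM] : exists M, bounded_lipschitz rdist M (h n) := trig_closure_bounded_lipschitz (th n).
  exact: lip_comp hM.
have ih0 n : intble P (fun x => h n (Y x)).
  have [M hM] : exists M, bounded_lipschitz rdist M (h n) := trig_closure_bounded_lipschitz (th n).
  exact: lip_comp0 hM.
have cL : \int[P]_x (Y x * h n (Y x)) @[n --> \oo] --> \int[P]_x (Y x * expR (- (l * Y x))).
  apply: (@dominated_cvg_Rintegral _ _ _ P _ _ (fun x => `|Y x * expR (- (l * Y x))|)).
  - by move=> n; apply: measurable_funM => //; exact: measurableT_comp.
  - by move=> x; apply: cvgM; [exact: cvg_cst|exact: cvg_gauss_weight].
  - by apply: intble_norm; apply: iYexp; rewrite (ltW l0).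
  - by move=> n x; rewrite !normrM ler_wpM2l// (le_trans (hle n _))// ler_norm.
have cE s : \int[P]_x h n (Y x + z s) @[n --> \oo] --> expR (- (l * z s)) * L.
  rewrite -RintegralZl//.
  under eq_Rintegral do rewrite -expRD.
  apply: (@dominated_cvg_Rintegral _ _ _ P _ _ (fun x => expR (- (l * Y x)))).
  - by move=> n; exact: measurableT_comp.
  - move=> x; rewrite (_ : - (l * z s) - l * Y x = - (l * (Y x + z s))); last by ring.
    exact: cvg_gauss_weight.
  - exact: iE.
  - move=> n x; rewrite (le_trans (hle n _))// ler_expR lerN2 ler_wpM2l ?(ltW l0)//.
    by rewrite lerDl.
have cE0 : \int[P]_x h n (Y x) @[n --> \oo] --> L.
  apply: (@dominated_cvg_Rintegral _ _ _ P _ _ (fun x => expR (- (l * Y x)))).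
  - by move=> n; exact: measurableT_comp.
  - by move=> x; exact: cvg_gauss_weight.
  - exact: iE.
  - by move=> n x; exact: hle.
have L0 : 0 <= L by apply: Rintegral_ge0 => x _; exact: expR_ge0.
have mzexp : measurable_fun setT (fun s => z s * (expR (- (l * z s)) - 1)).
  apply: measurable_funM => //; apply: measurable_funB => //.
  by apply: measurableT_comp => //; apply: measurable_funN; exact: measurable_funM.
have izexp : intble m (fun s => z s * (expR (- (l * z s)) - 1)).
  apply: (@intble_le _ _ _ m _ (fun s => l * z s ^+ 2)) => //; last exact: intbleZ.
  move=> s; rewrite normrM (ger0_norm (z0 s)) expr2 mulrCA ler_wpM2l//.
  have := expR_ge1Dx (- (l * z s)).
  have : expR (- (l * z s)) <= 1 by rewrite -expR0 ler_expR oppr_le0 mulr_ge0// ltW.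
  have : 0 <= l * z s by rewrite mulr_ge0// ltW.
  by move=> h1 h2 h3; rewrite ler0_norm; lra.
have cR : \int[m]_s (z s * (\int[P]_x h n (Y x + z s) - \int[P]_x h n (Y x)))
    @[n --> \oo] --> \int[m]_s (L * (z s * (expR (- (l * z s)) - 1))).
  apply: (@dominated_cvg_Rintegral _ _ _ m _ _ (fun s => (l + 1) * L * z s ^+ 2)).
  - move=> n; apply: measurable_funM => //; apply: measurable_funB => //.
    exact: (trig_closure_stein (th n)).1.
  - move=> s; rewrite (_ : L * _ = z s * (expR (- (l * z s)) * L - L)); last by ring.
    by apply: cvgM; [exact: cvg_cst|apply: cvgB; [exact: cE|exact: cE0]].
  - exact: intbleZ.
  - move=> n s; rewrite normrM (ger0_norm (z0 s)) expr2 mulrCA ler_wpM2l//.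
    rewrite -RintegralB// (_ : (l + 1) * L * z s =
      \int[P]_x ((l + 1) * z s * expR (- (l * Y x)))); last by rewrite RintegralZl// /L; ring.
    apply: normr_Rintegral_le; last 2 first.
    + exact: intbleZ.
    + move=> x; rewrite (_ : (l + 1) * z s * expR (- (l * Y x)) =
        (l + 1) * expR (- (l * Y x)) * z s); last by ring.
      by apply: gauss_weight_lipschitz => //; exact: harmonic_le1.
    by apply: measurable_funB; exact: measurableT_comp.
rewrite -RintegralZl//.
rewrite (_ : (fun n => \int[P]_x (Y x * h n (Y x))) = (fun n =>
  \int[m]_s (z s * (\int[P]_x h n (Y x + z s) - \int[P]_x h n (Y x))))) in cL.
  by have := cvg_unique _ cL cR; apply.
by apply/funext => n; exact: (trig_closure_stein (th n)).2.
Qed.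

Let psi l := \int[m]_s (expR (- (l * z s)) - 1 + l * z s).

Let mpsi l : measurable_fun setT (fun s => expR (- (l * z s)) - 1 + l * z s).
Proof.
apply: measurable_funD; last exact: measurable_funM.
apply: measurable_funB => //.
by apply: measurableT_comp => //; apply: measurable_funN; exact: measurable_funM.
Qed.

Let le_psi l s : 0 <= l -> `|expR (- (l * z s)) - 1 + l * z s| <= l ^+ 2 * z s ^+ 2.
Proof.
move=> l0; have lz : 0 <= l * z s by rewrite mulr_ge0.
have /andP[h1 h2] := expRN_sub_sqr lz.
by rewrite ger0_norm// -exprMn.
Qed.

Let ipsi l : 0 <= l -> intble m (fun s => expR (- (l * z s)) - 1 + l * z s).
Proof.
move=> l0; apply: (@intble_le _ _ _ m _ (fun s => l ^+ 2 * z s ^+ 2)) => //; last exact: intbleZ.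
by move=> s; exact: le_psi.
Qed.

Let is_derive_laplace (l : R) : 0 < l < 2 -> is_derive l (1 : R)
  (fun l => \int[P]_x expR (- (l * Y x))) (- \int[P]_x (Y x * expR (- (l * Y x)))).
Proof.
move=> l02; have l02' : 0 <= l <= 2 by case/andP: l02 => ? ?; rewrite !ltW.
rewrite -mulN1r -RintegralZl//; last exact: iYexp.
apply: (@is_derive_Rintegral _ _ _ P (fun l x => expR (- (l * Y x)))
  (fun l x => -1 * (Y x * expR (- (l * Y x)))) (fun x => `|Y x| + expR (- (3 * Y x)))
  l 0 2) => //.
- by move=> x /andP[x0 _]; exact: laplace_integrable.
- move=> x y.
  have H : is_derive x (1 : R) (fun u : R => - (u * Y y)) (- Y y).
    by apply: is_derive_eq; rewrite /GRing.scale/=; ring.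
  have K : is_derive (- (x * Y y)) (1 : R) expR (expR (- (x * Y y))) by exact: is_derive_expR.
  have L := @is_derive1_comp _ expR (fun u : R => - (u * Y y)) _ _ _ K H.
  by apply: (is_derive_eq L); ring.
- by apply: intbleD; [exact: intble_norm|exact: laplace_integrable].
- move=> x y /andP[x0 x2]; rewrite mulN1r normrN; apply: norm_mul_expR_le.
  by rewrite !ltW.
Qed.

Let is_derive_psi (l : R) : 0 < l < 2 -> is_derive l (1 : R) psi
  (- \int[m]_s (z s * (expR (- (l * z s)) - 1))).
Proof.
move=> /andP[l0 l2].
have le_dpsi x s : 0 < x < 2 -> `|z s * (expR (- (x * z s)) - 1)| <= 2 * z s ^+ 2.
  move=> /andP[x0 x2]; rewrite normrM (ger0_norm (z0 s)) expr2 mulrCA ler_wpM2l//.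
  have := expR_ge1Dx (- (x * z s)).
  have : expR (- (x * z s)) <= 1 by rewrite -expR0 ler_expR oppr_le0 mulr_ge0// ltW.
  have : x * z s <= 2 * z s by rewrite ler_wpM2r// ltW.
  by move=> h1 h2 h3; rewrite ler0_norm; lra.
have mdpsi : measurable_fun setT (fun s => z s * (expR (- (l * z s)) - 1)).
  apply: measurable_funM => //; apply: measurable_funB => //.
  by apply: measurableT_comp => //; apply: measurable_funN; exact: measurable_funM.
have idpsi : intble m (fun s => z s * (expR (- (l * z s)) - 1)).
  apply: (@intble_le _ _ _ m _ (fun s => 2 * z s ^+ 2)) => //; last exact: intbleZ.
  by move=> s; apply: le_dpsi; rewrite l0.
rewrite (_ : - (\int[m]_s (z s * (expR (- (l * z s)) - 1))) =
    \int[m]_s (-1 * (z s * (expR (- (l * z s)) - 1)))); last first.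
  by rewrite RintegralZl// mulN1r.
apply: (@is_derive_Rintegral _ _ _ m (fun l s => expR (- (l * z s)) - 1 + l * z s)
  (fun l s => -1 * (z s * (expR (- (l * z s)) - 1))) (fun s => 2 * z s ^+ 2) l 0 2) => //.
- by rewrite l0.
- by move=> x /andP[x0 _]; apply: ipsi; exact: ltW.
- move=> x s.
  have H : is_derive x (1 : R) (fun u : R => - (u * z s)) (- z s).
    by apply: is_derive_eq; rewrite /GRing.scale/=; ring.
  have K : is_derive (- (x * z s)) (1 : R) expR (expR (- (x * z s))) by exact: is_derive_expR.
  have L := @is_derive1_comp _ expR (fun u : R => - (u * z s)) _ _ _ K H.
  have H2 : is_derive x (1 : R) (fun u : R => u * z s - 1) (z s).
    by apply: is_derive_eq; rewrite /GRing.scale/=; ring.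
  have E : (fun l => expR (- (l * z s)) - 1 + l * z s) =
      (expR \o (fun u : R => - (u * z s))) + (fun u : R => u * z s - 1).
    by apply/funext => u; rewrite fctE/=; ring.
  rewrite E; apply: (is_derive_eq (is_deriveD L H2)); ring.
- exact: intbleZ.
- by move=> x s x02; rewrite mulN1r normrN; exact: le_dpsi.
Qed.

(** L(l) = E exp(- l Y) satisfies L' = L psi' by the identity for exponentials, so that
    L exp(- psi) is constant for 0 < l <= 1; its value is read off as l tends to 0, where L tends
    to 1 by dominated convergence and psi(l) = O(l^2). *)
Theorem laplace_transform :
  \int[P]_x expR (- Y x) = expR (\int[m]_s (expR (- z s) - 1 + z s)).
Proof.
pose L l := \int[P]_x expR (- (l * Y x)).
pose G (l : R) : R := L l * expR (- psi l).
have dG (l : R) : 0 < l < 2 -> is_derive l (1 : R) G 0.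
  move=> l02; have dL := is_derive_laplace l02; have dpsi := is_derive_psi l02.
  have l02' : 0 < l <= 2 by case/andP: l02 => -> /ltW.
  have H : is_derive l (1 : R) (fun l => - psi l) (\int[m]_s (z s * (expR (- (l * z s)) - 1))).
    by apply: (is_derive_eq (is_deriveN dpsi)); rewrite opprK.
  have K : is_derive (- psi l) (1 : R) expR (expR (- psi l)) by exact: is_derive_expR.
  have E := @is_derive1_comp _ expR (fun l => - psi l) _ _ _ K H.
  apply: (is_derive_eq (is_deriveM dL E)).
  by rewrite /GRing.scale/= (stein_exp l02') /L; ring.
have Gcst n : G (harmonic n) = G 1.
  apply/esym/eqP; rewrite -subr_eq0.
  have /andP[hn0 hn1] := @harmonic_le1 R n.
  have [c _ ->] : exists2 c : R, c \in `[harmonic n, 1] & G 1 - G (harmonic n) = 0 * (1 - harmonic n).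
    apply: (@MVT_segment _ G (fun=> 0)) => //.
      move=> x; rewrite in_itv/= => /andP[x1 x2]; apply: dG.
      by rewrite (lt_trans hn0)//= (lt_trans x2)// ltr1n.
    apply: derivable_within_continuous => x; rewrite in_itv/= => /andP[x1 x2].
    have h : is_derive x (1:R) G 0.
      by apply: dG; rewrite (lt_le_trans hn0)//= (le_lt_trans x2)// ltr1n.
    exact: ex_derive.
  by rewrite mul0r.
have c1 : G (harmonic n) @[n --> \oo] --> (1 : R).
  rewrite -(mulr1 1); apply: cvgM.
    rewrite -[X in _ --> X](Rintegral_cstP P).
    apply: (@dominated_cvg_Rintegral _ _ _ P _ _ (fun x => 1 + expR (- (1 * Y x)))).
    - by move=> n; exact: mexp.
    - move=> x; rewrite -[X in _ --> X]expR0; apply: (@continuous_cvg _ _ _ _ _ _ expR).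
        exact: continuous_expR.
      rewrite -oppr0; apply: cvgN; rewrite -(mul0r (Y x)).
      by apply: cvgM; [exact: cvg_harmonic|exact: cvg_cst].
    - by apply: intbleD; [exact: intble_cst|exact: laplace_integrable].
    - move=> n x; have /andP[hn0 hn1] := @harmonic_le1 R n.
      rewrite ger0_norm ?expR_ge0//; have [Y0|/ltW Y0] := leP 0 (Y x).
        rewrite (@le_trans _ _ 1) ?lerDl ?expR_ge0// -expR0 ler_expR oppr_le0.
        by rewrite mulr_ge0// ltW.
      rewrite (@le_trans _ _ (expR (- (1 * Y x))))// ?lerDr// ler_expR lerN2.
      by rewrite ler_wnM2r.
  rewrite -[X in _ --> X]expR0; apply: (@continuous_cvg _ _ _ _ _ _ expR).
    exact: continuous_expR.
  rewrite -oppr0; apply: cvgN; apply: norm_cvg0.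
  apply: (@squeeze_cvgr _ _ _ _ (cst 0) (fun n => harmonic n ^+ 2 * M2)).
  - apply: nearW => n; rewrite normr_ge0/=.
    have hn0 : 0 <= @harmonic R n by rewrite ltW//; case/andP: (@harmonic_le1 R n).
    rewrite /M2 -RintegralZl//; apply: normr_Rintegral_le => //; first exact: intbleZ.
    by move=> s; exact: le_psi.
  - exact: cvg_cst.
  - rewrite -[X in _ --> X](mul0r M2); apply: cvgM; last exact: cvg_cst.
    by rewrite -(mulr0 0); apply: cvgM; exact: cvg_harmonic.
have G1 : G 1 = 1.
  rewrite (_ : (fun n => G (harmonic n)) = cst (G 1)) in c1; last by apply/funext => n.
  have c2 : cst (G 1) n @[n --> \oo] --> G 1 by exact: cvg_cst.
  by have := cvg_unique _ c2 c1; apply.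
have LE : L 1 = expR (psi 1).
  have := G1; rewrite /G expRN => /(canRL (mulfVK _)) ->; rewrite ?mul1r ?invrK//.
  by rewrite gt_eqF// expR_gt0.
transitivity (L 1); first by apply: eq_Rintegral => x _; rewrite mul1r.
by rewrite LE; congr expR; apply: eq_Rintegral => s _; rewrite mul1r.
Qed.

End laplace_transform.

(** * Square integrals and pairings with the noise *)

Section square_integrals.
Context d (T : measurableType d) (R : realType).
Implicit Types (mu : {measure set T -> \bar R}) (f g u v w : T -> R).

(** The square of the L^2-norm, as an extended real: approximation in L^2 is then handled by
    pointwise inequalities between squares, without roots or integrability conditions. *)
Definition sqint mu f := (\int[mu]_x ((f x) ^+ 2)%:E)%E.

Lemma measurable_sqr f : measurable_fun setT f ->
  measurable_fun setT (fun x => ((f x) ^+ 2)%:E).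
Proof. by move=> mf; apply/measurable_EFinP; exact: measurable_funX. Qed.

Lemma sqint_ge0 mu f : (0 <= sqint mu f)%E.
Proof. by apply: integral_ge0 => x _; rewrite lee_fin sqr_ge0. Qed.

Lemma sqint_le2 mu u v w (a b : R) : 0 <= a -> 0 <= b ->
  measurable_fun setT u -> measurable_fun setT v -> measurable_fun setT w ->
  (forall x, u x ^+ 2 <= a * v x ^+ 2 + b * w x ^+ 2) ->
  (sqint mu u <= a%:E * sqint mu v + b%:E * sqint mu w)%E.
Proof.
move=> a0 b0 mu_ mv mw uvw.
have nn (c : R) (g : T -> R) x : 0 <= c -> (0 <= c%:E * ((g x) ^+ 2)%:E)%E.
  by move=> c0; rewrite -EFinM lee_fin mulr_ge0// sqr_ge0.
rewrite /sqint -!ge0_integralZl_EFin//; last 4 first.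
- by move=> x _; rewrite lee_fin sqr_ge0.
- exact: measurable_sqr.
- by move=> x _; rewrite lee_fin sqr_ge0.
- exact: measurable_sqr.
rewrite -ge0_integralD//; last 4 first.
- by move=> x _; exact: nn.
- by apply: measurable_funeM; exact: measurable_sqr.
- by move=> x _; exact: nn.
- by apply: measurable_funeM; exact: measurable_sqr.
apply: ge0_le_integral => //.
- by move=> x _; rewrite lee_fin sqr_ge0.
- exact: measurable_sqr.
- by apply: emeasurable_funD; apply: measurable_funeM; exact: measurable_sqr.
- by move=> x _; rewrite -!EFinM -EFinD lee_fin.
Qed.

Lemma sqint_le mu u v (a : R) : 0 <= a ->
  measurable_fun setT u -> measurable_fun setT v ->
  (forall x, u x ^+ 2 <= a * v x ^+ 2) -> (sqint mu u <= a%:E * sqint mu v)%E.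
Proof.
move=> a0 mu_ mv uv.
have := @sqint_le2 mu u v v a 0 a0 (lexx 0) mu_ mv mv.
by rewrite mul0e adde0; apply => x; rewrite mul0r addr0.
Qed.

Lemma sqint_intble mu f : measurable_fun setT f -> (sqint mu f < +oo)%E ->
  intble mu (fun x => f x ^+ 2).
Proof.
move=> mf foo; apply/integrableP; split; first exact: measurable_sqr.
rewrite (eq_integral (fun x => ((f x) ^+ 2)%:E))// => x _.
by rewrite /= ger0_norm// sqr_ge0.
Qed.

Lemma sqint_ae_eq mu f g : measurable_fun setT f -> measurable_fun setT g ->
  f = g %[ae mu] -> sqint mu f = sqint mu g.
Proof.
move=> mf mg fg; apply: ae_eq_integral => //; [exact: measurable_sqr..|].
by apply: filterS fg => x /= fg _; rewrite fg.
Qed.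

Lemma Lnorm2_lt mu f (e : R) : 0 < e ->
  ('N[mu]_2%:E[EFin \o f] < e%:E)%E = (sqint mu f < (e ^+ 2)%:E)%E.
Proof.
move=> e0.
have H : ('N[mu]_2%:E[EFin \o f] `^ 2 = sqint mu f)%E.
  rewrite powR_Lnorm// /sqint; apply: eq_integral => x _ /=.
  by rewrite powR_mulrn// real_normK// num_real.
rewrite -H; have := Lnorm_ge0 mu 2%:E (EFin \o f).
case: ('N[mu]_2%:E[EFin \o f])%E => [r| |] //=; last first.
  by move=> _; rewrite pnatr_eq0.
rewrite lee_fin => r0; rewrite powR_mulrn// !lte_fin.
by rewrite ltr_pXn2r// nnegrE ltW.
Qed.

Lemma Lnorm2_cvg0 mu (f_ : nat -> T -> R) :
  (forall n, (sqint mu (f_ n) < (harmonic n ^+ 2)%:E)%E) ->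
  ('N[mu]_2%:E[EFin \o f_ n] @[n --> \oo] --> 0)%E.
Proof.
move=> H; apply: (@squeeze_cvge _ _ _ _ (cst 0%E) _ (fun n => (harmonic n)%:E)).
- apply: nearW => n; rewrite Lnorm_ge0/= ltW//.
  by rewrite Lnorm2_lt//; case/andP: (@harmonic_le1 R n).
- exact: cvg_cst.
- by apply/fine_cvgP; split; [exact: nearW|exact: cvg_harmonic].
Qed.

Lemma cvg0_Lnorm2 mu (f_ : nat -> T -> R) (e : R) : 0 < e ->
  ('N[mu]_2%:E[EFin \o f_ n] @[n --> \oo] --> 0)%E ->
  \forall n \near \oo, (sqint mu (f_ n) < e%:E)%E.
Proof.
move=> e0 /fine_cvgP[fin cv].
pose c := Num.min e 1.
have c0 : 0 < c by rewrite lt_min e0 ltr01.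
have ce : c ^+ 2 <= e.
  rewrite expr2 (@le_trans _ _ (c * 1))//.
    by rewrite ler_wpM2l ?(ltW c0)// /c ge_min lexx orbT.
  by rewrite mulr1 /c ge_min lexx.
have /cvgr0_norm_lt/(_ c c0) H := cv.
near=> n.
have nfin : ('N[mu]_2%:E[EFin \o f_ n])%E \is a fin_num by near: n.
have : `|fine ('N[mu]_2%:E[EFin \o f_ n])%E| < c by near: n.
rewrite ger0_norm ?fine_ge0 ?Lnorm_ge0// -lte_fin fineK// Lnorm2_lt// => h.
by rewrite (lt_le_trans h)// lee_fin.
Unshelve. all: by end_near. Qed.

End square_integrals.

Section plane.
Context {R : realType}.

Lemma continuous_measurable_plane (f : R * R -> R) :
  continuous f -> measurable_fun setT f.
Proof.
move=> cf mD; apply: (measurability _ (RGenInftyO.measurableE R)) => //.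
move=> _ [_ [a ->] <-]; rewrite setTI.
set U := f @^-1` _.
have oU : open U by apply: open_comp => // x _; exact: cf.
pose box (q q' : rat) (n : nat) : set (R * R) :=
  ball (ratr q : R) (n.+1%:R^-1) `*` ball (ratr q' : R) (n.+1%:R^-1).
pose G q q' n : set (R * R) := if `[< box q q' n `<=` U >] then box q q' n else set0.
have -> : U = \bigcup_q \bigcup_q' \bigcup_n G q q' n.
  apply/seteqP; split => [[x y] Uxy|[x y] [q _ [q' _ [n _]]]]; last first.
    by rewrite /G; case: ifPn => // /asboolP; apply.
  have /nbhs_ballP[e /= e0 eU] : nbhs (x, y) U by exact: open_nbhs_nbhs.
  have [n ne] : exists n, n.+1%:R^-1 < e / 2.
    have : \forall n \near \oo, @harmonic R n < e / 2.
      have := @cvg_harmonic R => /cvgr0_norm_lt /(_ (e / 2)).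
      rewrite divr_gt0// => /(_ isT); apply: filterS => n.
      by rewrite ger0_norm// harmonic_ge0.
    by case=> n _ /(_ n (leqnn n)) ?; exists n.
  have [q] : exists q : rat, ratr q \in `](x - n.+1%:R^-1), (x + n.+1%:R^-1)[.
    by apply: rat_in_itvoo; rewrite ltrBlDr -addrA ltrDl addr_gt0.
  have [q'] : exists q : rat, ratr q \in `](y - n.+1%:R^-1), (y + n.+1%:R^-1)[.
    by apply: rat_in_itvoo; rewrite ltrBlDr -addrA ltrDl addr_gt0.
  rewrite !in_itv/= => /andP[q'1 q'2] /andP[q1 q2].
  have bx : box q q' n (x, y).
    by split; rewrite /ball/= ltr_distl ?q1 ?q2 ?q'1 ?q'2.
  exists q => //; exists q' => //; exists n => //.
  rewrite /G; case: ifPn => // /asboolP; case => -[x' y'] [].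
  rewrite /ball/= !ltr_distl => /andP[h1 h2] /andP[h3 h4].
  move: ne q1 q2 q'1 q'2 h1 h2 h3 h4; move: (n.+1%:R^-1) => r ne q1 q2 q'1 q'2 h1 h2 h3 h4.
  by apply: eU; split; rewrite /ball/= ltr_distl; apply/andP; split; lra.
apply: bigcupT_measurable_rat => q; apply: bigcupT_measurable_rat => q'.
apply: bigcupT_measurable => n; rewrite /G; case: ifPn => // _.
by apply: measurableX; exact: measurable_ball.
Qed.

Lemma testfun_measurable (phi : testfun R) : measurable_fun setT phi.
Proof.
apply: continuous_measurable_plane.
have := valP phi; rewrite unfold_in => /asboolP[sphi _] p.
exact: differentiable_continuous (sphi [::] p).
Qed.

Lemma pairing_lin (om : gen_function R) (a : R) (phi psi : testfun R) :
  pairing om (a *: phi + psi) = a * pairing om phi + pairing om psi.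
Proof. by rewrite /pairing linearP. Qed.

Lemma pairing_measurable (phi : testfun R) :
  measurable_fun setT (fun om : Dprime R => pairing om phi).
Proof.
move=> _ B mB; rewrite setTI; apply: sub_sigma_algebra.
by exists phi, B.
Qed.

End plane.

Section pairings.
Context {R : realType} (nu : probability (Dprime R) R).
Implicit Types (f g : R * R -> R) (Y Z : Dprime R -> R).

Lemma is_pairingP f Y : is_pairing nu f Y <->
  measurable_fun setT Y /\ forall e : R, 0 < e -> exists phi : testfun R,
    (sqint (@plane_measure R) (fun p => phi p - f p)%R < e%:E)%E /\
    (sqint nu (fun om => pairing om phi - Y om)%R < e%:E)%E.
Proof.
split=> [[mY [phi [phif phiY]]]|[mY H]]; split => //.
  move=> e e0.
  have h1 := cvg0_Lnorm2 e0 phif; have h2 := cvg0_Lnorm2 e0 phiY.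
  have [n _ /(_ n (leqnn n)) [k1 k2]] := filterI h1 h2.
  by exists (phi n).
have h n : exists phi : testfun R,
    (sqint (@plane_measure R) (fun p => phi p - f p)%R < (harmonic n ^+ 2)%:E)%E /\
    (sqint nu (fun om => pairing om phi - Y om)%R < (harmonic n ^+ 2)%:E)%E.
  by apply: H; rewrite exprn_gt0//; case/andP: (@harmonic_le1 R n).
have [phi Hphi] := choice h.
exists phi; split.
  by apply: (@Lnorm2_cvg0 _ _ _ (@plane_measure R) (fun n p => phi n p - f p)) => n; have [] := Hphi n.
by apply: (@Lnorm2_cvg0 _ _ _ nu (fun n om => pairing om (phi n) - Y om)) => n; have [] := Hphi n.
Qed.

(** Combine the approximating test functions, using (a x + y)^2 <= 2 a^2 x^2 + 2 y^2 both on the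
    plane and on the noise. *)
Lemma is_pairing_lin (a : R) f g Y Z : measurable_fun setT f -> measurable_fun setT g ->
  is_pairing nu f Y -> is_pairing nu g Z ->
  is_pairing nu (fun p => a * f p + g p) (fun om => a * Y om + Z om).
Proof.
move=> mf mg /is_pairingP[mY fY] /is_pairingP[mZ gZ]; apply/is_pairingP; split.
  by apply: measurable_funD => //; exact: measurable_funM.
move=> e e0; pose c := e / (2 * (a ^+ 2 + 1) + 2).
have d0 : 0 < 2 * (a ^+ 2 + 1) + 2 by have := sqr_ge0 a; lra.
have c0 : 0 < c by rewrite divr_gt0.
have [phi [phi1 phi2]] := fY c c0; have [psi [psi1 psi2]] := gZ c c0.
exists (a *: phi + psi).
have key d (T : measurableType d) (mu : {measure set T -> \bar R}) (u v u' v' : T -> R) :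
    measurable_fun setT u -> measurable_fun setT v ->
    measurable_fun setT u' -> measurable_fun setT v' ->
    (sqint mu (fun x => u x - u' x)%R < c%:E)%E ->
    (sqint mu (fun x => v x - v' x)%R < c%:E)%E ->
    (sqint mu (fun x => (a * u x + v x) - (a * u' x + v' x))%R < e%:E)%E.
  move=> mu_ mv mu' mv' h1 h2.
  apply: (@le_lt_trans _ _ ((2 * (a ^+ 2 + 1))%:E * sqint mu (fun x => u x - u' x)%R +
    2%:E * sqint mu (fun x => v x - v' x)%R)%E).
    apply: sqint_le2 => //.
    - by rewrite mulr_ge0// addr_ge0// sqr_ge0.
    - by apply: measurable_funB; apply: measurable_funD => //; exact: measurable_funM.
    - exact: measurable_funB.
    - exact: measurable_funB.
    - move=> x; set p := u x - u' x; set q := v x - v' x.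
      have -> : a * u x + v x - (a * u' x + v' x) = a * p + q by rewrite /p /q; ring.
      by have := sqr_ge0 (a * p - q); have := sqr_ge0 p; nra.
  have -> : e%:E = ((2 * (a ^+ 2 + 1))%:E * c%:E + 2%:E * c%:E)%E.
    by rewrite -!EFinM -EFinD; congr EFin; rewrite /c; field; rewrite gt_eqF.
  apply: lteD; rewrite lte_pmul2l// lte_fin mulr_gt0// ltr_wpDl ?sqr_ge0//.
split.
  apply: (key _ _ (@plane_measure R) phi psi f g) => //; exact: testfun_measurable.
under [X in sqint _ X]eq_fun do rewrite pairing_lin.
apply: (key _ _ nu (fun om => pairing om phi) (fun om => pairing om psi) Y Z) => //;
  exact: pairing_measurable.
Qed.

(** A diagonal argument: a test function that approximates the approximation. *)
Lemma is_pairing_closed f Y : measurable_fun setT f -> measurable_fun setT Y ->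
  (forall e : R, 0 < e -> exists g Z, [/\ is_pairing nu g Z, measurable_fun setT g,
    (sqint (@plane_measure R) (fun p => g p - f p)%R < e%:E)%E &
    (sqint nu (fun om => Z om - Y om)%R < e%:E)%E]) ->
  is_pairing nu f Y.
Proof.
move=> mf mY H; apply/is_pairingP; split=> // e e0.
have c0 : 0 < e / 4 by rewrite divr_gt0.
have [g [Z [/is_pairingP[mZ gZ] mg gf ZY]]] := H _ c0.
have [phi [phi1 phi2]] := gZ _ c0; exists phi.
have key d (T : measurableType d) (mu : {measure set T -> \bar R}) (u v w : T -> R) :
    measurable_fun setT u -> measurable_fun setT v -> measurable_fun setT w ->
    (sqint mu (fun x => u x - v x)%R < (e / 4)%:E)%E ->
    (sqint mu (fun x => v x - w x)%R < (e / 4)%:E)%E ->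
    (sqint mu (fun x => u x - w x)%R < e%:E)%E.
  move=> mu_ mv mw h1 h2.
  apply: (@le_lt_trans _ _ (2%:E * sqint mu (fun x => u x - v x)%R +
    2%:E * sqint mu (fun x => v x - w x)%R)%E).
    apply: sqint_le2 => //; [exact: measurable_funB..|move=> x].
    have := sqr_ge0 ((u x - v x) - (v x - w x)); nra.
  have -> : e%:E = (2%:E * (e / 4)%:E + 2%:E * (e / 4)%:E)%E.
    by rewrite -!EFinM -EFinD; congr EFin; field.
  by apply: lteD; rewrite lte_pmul2l.
split.
  apply: (key _ _ (@plane_measure R) phi g f) => //; exact: testfun_measurable.
apply: (key _ _ nu (fun om => pairing om phi) Z Y) => //; exact: pairing_measurable.
Qed.

Lemma is_pairing_ae f Y Z : measurable_fun setT Z -> Y = Z %[ae nu] ->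
  is_pairing nu f Y -> is_pairing nu f Z.
Proof.
move=> mZ YZ /is_pairingP[mY fY]; apply/is_pairingP; split => // e e0.
have [phi [phi1 phi2]] := fY e e0; exists phi; split => //.
rewrite (_ : sqint nu _ = sqint nu (fun om => pairing om phi - Y om))//.
apply: sqint_ae_eq.
- by apply: measurable_funB => //; exact: pairing_measurable.
- by apply: measurable_funB => //; exact: pairing_measurable.
- by apply: filterS YZ => om /= YZ omT; rewrite YZ.
Qed.

End pairings.

Section levy_measure.
Context {R : realType} (sigma : {measure set R -> \bar R}).

Definition finite_second_moment :=
  (\int[sigma]_(tau in `]0%R, +oo[) (tau ^+ 2)%:E < +oo)%E.

Implicit Types fin : finite_second_moment.

(** The restriction to the half-line of the measure sigma, which carries an arbitrary mass
    elsewhere. The proof of finiteness of the second moment is an argument, so that the instances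
    below can use it to make the restriction sigma-finite. *)
Definition levy_part (fin : finite_second_moment) : set R -> \bar R :=
  mrestr sigma (measurable_itv `]0%R, +oo[).

HB.instance Definition _ fin := Measure.on (levy_part fin).

(** By Chebyshev, the heights above 1/n have mass at most n^2 times the second moment. *)
Lemma levy_part_sigma_finite fin : sigma_finite setT (levy_part fin).
Proof.
exists (fun n => [set tau : R | tau <= 0] `|` `[n.+1%:R^-1, +oo[%classic).
  apply/seteqP; split => // tau _; have [t0|t0] := leP tau 0; first by exists 0%N => //; left.
  have [n nt] : exists n, n.+1%:R^-1 < tau.
    have : \forall n \near \oo, @harmonic R n < tau.
      have := @cvg_harmonic R => /cvgr0_norm_lt /(_ tau t0); apply: filterS => n.
      by rewrite ger0_norm// harmonic_ge0.
    by case=> n _ /(_ n (leqnn n)) ?; exists n.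
  by exists n => //; right; rewrite /= in_itv/= andbT ltW.
move=> n; have mle0 : measurable [set tau : R | tau <= 0].
  by rewrite (_ : [set _ | _] = `]-oo, 0]%classic)//; apply/seteqP; split => x /=; rewrite in_itv.
split; first by apply: measurableU.
set N : R := n.+1%:R; have N0 : 0 < N by rewrite ltr0n.
set D : set R := `]0, +oo[%classic; set E := `[N^-1, +oo[%classic.
have mD : measurable D by exact: measurable_itv.
have -> : levy_part fin ([set tau | tau <= 0] `|` E) = sigma E.
  rewrite /levy_part /mrestr; congr (sigma _); apply/seteqP; split => x /=.
    by rewrite /E /= !in_itv/= !andbT => -[[x0|//] x1]; move: (le_lt_trans x0 x1); rewrite ltxx.
  rewrite /E/= !in_itv/= !andbT => h; split; [by right|].
  by rewrite (lt_le_trans _ h)// invr_gt0.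
have ED : E `<=` D.
  by move=> x; rewrite /E /D /= !in_itv/= !andbT; apply: lt_le_trans; rewrite invr_gt0.
have H : ((N ^- 2)%:E * sigma E <= \int[sigma]_(tau in D) (tau ^+ 2)%:E)%E.
  have -> : sigma E = (\int[sigma]_(x in D) (\1_E x)%:E)%E.
    by rewrite integral_indic ?setIidl//; exact: measurable_itv.
  rewrite -ge0_integralZl_EFin//; last 2 first.
    by apply/measurable_EFinP; apply: measurable_indic; exact: measurable_itv.
    by rewrite invr_ge0 exprn_ge0// ltW.
  apply: ge0_le_integral => //.
  - by move=> x _; rewrite -EFinM lee_fin mulr_ge0// ?invr_ge0 exprn_ge0// ltW.
  - apply: measurable_funeM.
    by apply/measurable_EFinP; apply: measurable_indic; exact: measurable_itv.
  - by apply/measurable_EFinP; apply: measurable_funX.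
  - move=> x Dx; rewrite -EFinM lee_fin indicE; have [|] := boolP (x \in _).
      rewrite inE /E/= in_itv/= andbT mulr1 => h; rewrite -exprVn lerXn2r// nnegrE.
        by rewrite invr_ge0 ltW.
      by rewrite (le_trans _ h)// invr_ge0 ltW.
    by rewrite mulr0 sqr_ge0.
have H2 := le_lt_trans H fin.
have N20 : (0 < (N ^- 2)%:E)%E by rewrite lte_fin invr_gt0 exprn_gt0.
by rewrite ltey; apply: contraTneq H2 => ->; rewrite gt0_muley.
Qed.

HB.instance Definition _ fin :=
  @Measure_isSigmaFinite.Build _ _ _ (levy_part fin) (levy_part_sigma_finite fin).

Lemma integral_levy_part fin (f : R -> \bar R) : measurable_fun setT f ->
  (\int[levy_part fin]_tau f tau = \int[sigma]_(tau in `]0%R, +oo[) f tau)%E.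
Proof.
move=> mf; set D : set R := `]0, +oo[%classic.
rewrite -(@eq_measure_integral _ _ _ D sigma (levy_part fin)); last first.
  by move=> A mA AD; rewrite -[in RHS](setIidl AD).
rewrite [RHS]integral_mkcond; apply: ae_eq_integral => //.
  have mD : measurable D by exact: measurable_itv.
  by apply: (iffLR (measurable_restrictT _ mD)); exact: (measurable_funTS mf).
exists (~` D); split.
- by apply: measurableC; exact: measurable_itv.
- by transitivity (sigma (~` D `&` D)) => //; rewrite setICl measure0.
- by move=> x /= h Dx; apply: h => _; rewrite patchE mem_set.
Qed.

End levy_measure.


Lemma product_sigma_finite d1 d2 (T1 : measurableType d1) (T2 : measurableType d2)
    (R : realType) (m1 : {sigma_finite_measure set T1 -> \bar R})
    (m2 : {sigma_finite_measure set T2 -> \bar R}) :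
  sigma_finite setT (m1 \x m2)%E.
Proof.
have [F FT Ffin] := sigma_finiteT m1; have [G GT Gfin] := sigma_finiteT m2.
pose H n : set (T1 * T2) :=
  if @unpickle (nat * nat)%type n is Some ij then F ij.1 `*` G ij.2 else set0.
exists H => [|n].
  apply/seteqP; split => // -[x y] _.
  have [i _ Fx] : (\bigcup_i F i) x by rewrite -FT.
  have [j _ Gy] : (\bigcup_i G i) y by rewrite -GT.
  by exists (pickle (i, j)) => //; rewrite /H pickleK.
rewrite /H; case: unpickle => [[i j]/=|]; last by rewrite measure0; split => //; exact: measurable0.
have [[mF F1] [mG G1]] := (Ffin i, Gfin j).
split; first exact: measurableX.
by rewrite product_measure1E// lte_mul_pinfty// ge0_fin_numE.
Qed.

Lemma plane_measure_sigma_finite (R : realType) : sigma_finite setT (@plane_measure R).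
Proof. exact: product_sigma_finite. Qed.

HB.instance Definition _ (R : realType) :=
  @Measure_isSigmaFinite.Build _ _ _ (@plane_measure R) (@plane_measure_sigma_finite R).

Section levy_intensity.
Context {R : realType} (sigma : {measure set R -> \bar R}).

(** The intensity of the jumps of the noise, in position and height. *)
Definition levy_intensity (fin : finite_second_moment sigma) :=
  (@plane_measure R \x levy_part fin)%E.

HB.instance Definition _ fin := Measure.on (levy_intensity fin).

Lemma levy_intensity_sigma_finite fin : sigma_finite setT (levy_intensity fin).
Proof. exact: product_sigma_finite. Qed.

HB.instance Definition _ fin :=
  @Measure_isSigmaFinite.Build _ _ _ (levy_intensity fin) (levy_intensity_sigma_finite fin).

End levy_intensity.

(** * The characteristic functional *)

Section jumps.
Context {R : realType} (sigma : {measure set R -> \bar R}).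
Variable fin : finite_second_moment sigma.
Implicit Types (f g : R * R -> R).

Local Notation plane := (@plane_measure R).
Local Notation m := (levy_intensity fin).

(** The absolute value makes jumps nonnegative on the whole product space; it is invisible to
    the intensity, which is carried by positive heights. *)
Definition jump f (q : R * R * R) : R := `|q.2| * f q.1.

Definition second_moment : \bar R := (\int[sigma]_(tau in `]0%R, +oo[) (tau ^+ 2)%:E)%E.

Lemma second_moment_ge0 : (0 <= second_moment)%E.
Proof. by apply: integral_ge0 => x _; rewrite lee_fin sqr_ge0. Qed.

Lemma second_moment_fin : second_moment \is a fin_num.
Proof. by rewrite ge0_fin_numE ?second_moment_ge0. Qed.

Lemma measurable_jump f : measurable_fun setT f -> measurable_fun setT (jump f).
Proof.
move=> mf; apply: measurable_funM.
  by apply: measurableT_comp => //; exact: measurable_snd.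
by apply: (measurableT_comp mf); exact: measurable_fst.
Qed.

Lemma sqint_jump f : measurable_fun setT f ->
  sqint m (jump f) = (second_moment * sqint plane f)%E.
Proof.
move=> mf; rewrite /sqint /levy_intensity fubini_tonelli1; last 2 first.
- by apply: measurable_sqr; exact: measurable_jump.
- by move=> x; rewrite lee_fin sqr_ge0.
rewrite -[X in (X * _)%E](fineK second_moment_fin) -ge0_integralZl_EFin//; last 3 first.
- by move=> x _; rewrite lee_fin sqr_ge0.
- exact: measurable_sqr.
- by rewrite fine_ge0// second_moment_ge0.
apply: eq_integral => p _; rewrite /fubini_F /jump/= fineK ?second_moment_fin//.
under eq_integral do rewrite exprMn real_normK ?num_real// mulrC EFinM.
rewrite ge0_integralZl_EFin//; last 3 first.
- by move=> x _; rewrite lee_fin sqr_ge0.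
- by apply/measurable_EFinP; exact: measurable_funX.
- exact: sqr_ge0.
rewrite muleC; congr (_ * _)%E; rewrite (integral_levy_part fin)//.
by apply/measurable_EFinP; exact: measurable_funX.
Qed.

Lemma intble_jump_sqr f : measurable_fun setT f -> (sqint plane f < +oo)%E ->
  intble m (fun q => jump f q ^+ 2).
Proof.
move=> mf foo; apply: sqint_intble; first exact: measurable_jump.
by rewrite sqint_jump// lte_mul_pinfty ?second_moment_ge0 ?second_moment_fin.
Qed.

Lemma Rintegral_jump_sqr f : measurable_fun setT f -> (sqint plane f < +oo)%E ->
  \int[m]_q (jump f q ^+ 2) = fine second_moment * fine (sqint plane f).
Proof.
move=> mf foo; have := sqint_jump mf; rewrite /Rintegral -[X in fine X]/(sqint m (jump f)) => ->.
by rewrite fineM ?second_moment_fin// ge0_fin_numE// sqint_ge0.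
Qed.

(** The exponent of the characteristic functional is given by iterated integrals; as one
    integral against the intensity it becomes accessible to the general theory of the preceding
    part. *)
Lemma iterated_jump_integral (g : R -> R) f : measurable_fun setT f ->
  (sqint plane f < +oo)%E -> measurable_fun setT g -> (forall x, `|g x| <= x ^+ 2) ->
  \int[plane]_p (\int[sigma]_(tau in `]0, +oo[) g (tau * f p)) =
  \int[m]_q g (jump f q).
Proof.
move=> mf foo mg gx.
have ig : intble m (fun q => g (jump f q)).
  apply: intble_le (intble_jump_sqr mf foo) => [|x]; last exact: gx.
  by apply: measurableT_comp => //; exact: measurable_jump.
rewrite /Rintegral; congr fine.
rewrite -[RHS](@integral12_prod_meas1 _ _ _ _ _ plane (levy_part fin) _ ig).
apply: eq_integral => p _; rewrite /fubini_F.
have E : (\int[sigma]_(tau in `]0%R, +oo[) (g (tau * f p))%:E =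
    \int[levy_part fin]_tau (g (jump f (p, tau)))%:E)%E.
  rewrite integral_levy_part; last first.
    apply/measurable_EFinP; apply: (measurableT_comp mg).
    by apply: measurable_funM => //; exact: measurableT_comp.
  apply: eq_integral => tau; rewrite inE/= in_itv/= andbT => t0.
  by rewrite /jump/= gtr0_norm.
suff ii : sigma.-integrable `]0%R, +oo[ (fun tau => (g (tau * f p))%:E).
  by rewrite E fineK// -E; exact: integrable_fin_num ii.
have mD : measurable (`]0, +oo[ : set R) by [].
apply: (le_integrable mD (g := fun tau => ((f p ^+ 2)%:E * (tau ^+ 2)%:E)%E)).
- apply/measurable_EFinP; apply: measurable_funTS; apply: (measurableT_comp mg).
  exact: measurable_funM.
- move=> tau _; rewrite /= lee_fin (le_trans (gx _))// exprMn mulrC ger0_norm//.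
  by rewrite mulr_ge0// sqr_ge0.
- apply: integrableZl => //; apply/integrableP; split.
    by apply/measurable_EFinP; apply: measurable_funTS; exact: measurable_funX.
  under eq_integral do rewrite gee0_abs ?lee_fin ?sqr_ge0//.
  exact: fin.
Qed.

Definition levy_cos f := \int[m]_q (cos (jump f q) - 1).
Definition levy_sin f := \int[m]_q (sin (jump f q) - jump f q).

Lemma jump_cos_measurable f : measurable_fun setT f ->
  measurable_fun setT (fun q => cos (jump f q) - 1).
Proof. by move=> mf; apply: measurable_funB => //; apply: measurable_cos_comp; exact: measurable_jump. Qed.

Lemma jump_sin_measurable f : measurable_fun setT f ->
  measurable_fun setT (fun q => sin (jump f q) - jump f q).
Proof.
move=> mf; have mj := measurable_jump mf.
by apply: measurable_funB => //; exact: measurable_sin_comp.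
Qed.

Lemma intble_jump_cos f : measurable_fun setT f -> (sqint plane f < +oo)%E ->
  intble m (fun q => cos (jump f q) - 1).
Proof.
move=> mf foo; apply: intble_le (intble_jump_sqr mf foo) => [|q]; first exact: jump_cos_measurable.
exact: cosB1_sqr.
Qed.

Lemma intble_jump_sin f : measurable_fun setT f -> (sqint plane f < +oo)%E ->
  intble m (fun q => sin (jump f q) - jump f q).
Proof.
move=> mf foo; apply: intble_le (intble_jump_sqr mf foo) => [|q]; first exact: jump_sin_measurable.
exact: sinB_sqr.
Qed.

Lemma levy_cosN f : levy_cos (fun p => - f p) = levy_cos f.
Proof.
by apply: eq_Rintegral => q _; rewrite (_ : jump _ q = - jump f q) ?cosN// /jump mulrN.
Qed.

Lemma levy_sinN f : measurable_fun setT f -> (sqint plane f < +oo)%E ->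
  levy_sin (fun p => - f p) = - levy_sin f.
Proof.
move=> mf foo; rewrite -mulN1r -RintegralZl//; last exact: intble_jump_sin.
apply: eq_Rintegral => q _; rewrite (_ : jump _ q = - jump f q) ?sinN; first by ring.
by rewrite /jump mulrN.
Qed.

Lemma levy_cosD f g : measurable_fun setT f -> (sqint plane f < +oo)%E ->
  measurable_fun setT g -> (sqint plane g < +oo)%E -> (forall p, f p * g p = 0) ->
  levy_cos (fun p => f p + g p) = levy_cos f + levy_cos g.
Proof.
move=> mf foo mg goo fg; rewrite /levy_cos -RintegralD//; [|exact: intble_jump_cos..].
apply: eq_Rintegral => q _; rewrite /jump mulrDr.
by have /eqP := fg q.1; rewrite mulf_eq0 => /orP[] /eqP ->; rewrite mulr0 ?add0r ?addr0 cos0; ring.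
Qed.

Lemma levy_sinD f g : measurable_fun setT f -> (sqint plane f < +oo)%E ->
  measurable_fun setT g -> (sqint plane g < +oo)%E -> (forall p, f p * g p = 0) ->
  levy_sin (fun p => f p + g p) = levy_sin f + levy_sin g.
Proof.
move=> mf foo mg goo fg; rewrite /levy_sin -RintegralD//; [|exact: intble_jump_sin..].
apply: eq_Rintegral => q _; rewrite /jump mulrDr.
by have /eqP := fg q.1; rewrite mulf_eq0 => /orP[] /eqP ->; rewrite mulr0 ?add0r ?addr0 sin0; ring.
Qed.

(** Both parts of the exponent are continuous in L^2: the quadratic Lipschitz bound gives
    products |u| (|u| + 2 |w|), with u the jump of f' - f and w that of f, and
    2 |u w| <= u^2 / h + h w^2 balances them when |f' - f|^2 has integral h^2. *)
Lemma jump_integral_lipschitz (g : R -> R) f f' (h : R) :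
  measurable_fun setT f -> measurable_fun setT f' -> measurable_fun setT g ->
  (forall x, `|g x| <= x ^+ 2) ->
  (forall x y, `|g x - g y| <= `|x - y| * (`|x| + `|y|)) ->
  0 < h -> (sqint plane f < +oo)%E -> (sqint plane (fun p => f' p - f p)%R < (h ^+ 2)%:E)%E ->
  (sqint plane f' < +oo)%E ->
  `|\int[m]_q g (jump f' q) - \int[m]_q g (jump f q)| <=
    (h ^+ 2 + h) * fine second_moment + h * (fine second_moment * fine (sqint plane f)).
Proof.
move=> mf mf' mg gx gl h0 foo ff' f'oo.
have md : measurable_fun setT (fun p => f' p - f p) by exact: measurable_funB.
have doo : (sqint plane (fun p => f' p - f p)%R < +oo)%E by rewrite (lt_trans ff')// ltry.
have ig f0 : measurable_fun setT f0 -> (sqint plane f0 < +oo)%E ->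
    intble m (fun q => g (jump f0 q)).
  move=> mf0 f0oo; apply: intble_le (intble_jump_sqr mf0 f0oo) => [|x]; last exact: gx.
  by apply: measurableT_comp => //; exact: measurable_jump.
rewrite -RintegralB//; [|exact: ig..].
set d := fun p => f' p - f p.
have id2 := intble_jump_sqr md doo; have if2 := intble_jump_sqr mf foo.
apply: (@le_trans _ _ (\int[m]_q ((1 + h^-1) * jump d q ^+ 2 + h * jump f q ^+ 2))).
  apply: normr_Rintegral_le.
  - by apply: measurable_funB; exact: intble_measurable (ig _ _ _).
  - by apply: intbleD; exact: intbleZ.
  - move=> q; rewrite (le_trans (gl _ _))//.
    have -> : jump f' q - jump f q = jump d q by rewrite /jump/d; ring.
    have : `|jump f' q| <= `|jump d q| + `|jump f q|.
      by rewrite (_ : jump f' q = jump d q + jump f q) ?ler_normD// /jump/d; ring.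
    rewrite -(real_normK (num_real (jump d q))) -(real_normK (num_real (jump f q))).
    have := normr_ge0 (jump d q); have := normr_ge0 (jump f q).
    move: (`|jump d q|) (`|jump f q|) (`|jump f' q|) => u w v w0 u0 vuw.
    have : 0 <= h^-1 * (u - h * w) ^+ 2 by rewrite mulr_ge0 ?invr_ge0 ?(ltW h0)// sqr_ge0.
    have -> : h^-1 * (u - h * w) ^+ 2 = h^-1 * u ^+ 2 - 2 * u * w + h * w ^+ 2.
      by field; rewrite gt_eqF.
    have : u * v <= u * (u + w) by rewrite ler_wpM2l.
    move: (h^-1) => k; nra.
rewrite RintegralD//; [|exact: intbleZ..].
rewrite !RintegralZl// !Rintegral_jump_sqr// lerD2r mulrCA [leRHS]mulrC ler_wpM2l//.
  by rewrite fine_ge0// second_moment_ge0.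
have : fine (sqint plane d) <= h ^+ 2.
  by rewrite -lee_fin fineK ?ltW// ge0_fin_numE ?sqint_ge0.
move=> H; apply: (@le_trans _ _ ((1 + h^-1) * h ^+ 2)).
  by rewrite ler_wpM2l// addr_ge0// invr_ge0 ltW.
by rewrite le_eqVlt; apply/orP; left; apply/eqP; field; rewrite gt_eqF.
Qed.

End jumps.

(** * Laws of the pairings *)

Section characteristic_functional.
Context {R : realType} (sigma : {measure set R -> \bar R}).
Variable fin : finite_second_moment sigma.
Context (nu : probability (Dprime R) R).
Hypothesis nuL : is_levy_noise sigma nu.
Implicit Types (f g : R * R -> R) (Y Z : Dprime R -> R).

Local Notation plane := (@plane_measure R).
Local Notation m := (levy_intensity fin).

(** The defining identity of the noise, of which the phase v selects a real combination of
    the real and imaginary parts. *)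
Lemma char_testfun (phi : testfun R) v : (sqint plane phi < +oo)%E ->
  \int[nu]_om cos (pairing om phi + v) =
  expR (levy_cos fin phi) * cos (levy_sin fin phi + v).
Proof.
move=> poo; have mphi := testfun_measurable phi; have mp := @pairing_measurable R phi.
have ecos : \int[plane]_p (\int[sigma]_(tau in `]0, +oo[) (cos (tau * phi p) - 1)) =
    levy_cos fin phi.
  apply: (iterated_jump_integral fin (g := fun x => cos x - 1)) => //; last exact: cosB1_sqr.
  by apply: measurable_funB => //; exact: measurable_cos_comp.
have esin : \int[plane]_p (\int[sigma]_(tau in `]0, +oo[) (sin (tau * phi p) - tau * phi p)) =
    levy_sin fin phi.
  apply: (iterated_jump_integral fin (g := fun x => sin x - x)) => //; last exact: sinB_sqr.
  by apply: measurable_funB => //; exact: measurable_sin_comp.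
(* the form in which the real and imaginary parts of the complex integrand unfold *)
have ecos1 : \int[plane]_p (\int[sigma]_(tau in `]0, +oo[) (1 * cos (tau * phi p) - 1 - 0)) =
    \int[plane]_p (\int[sigma]_(tau in `]0, +oo[) (cos (tau * phi p) - 1)).
  by apply: eq_Rintegral => p _; apply: eq_Rintegral => tau _; rewrite mul1r subr0.
have esin1 : \int[plane]_p (\int[sigma]_(tau in `]0, +oo[)
      (1 * sin (tau * phi p) - 0 - tau * phi p)) =
    \int[plane]_p (\int[sigma]_(tau in `]0, +oo[) (sin (tau * phi p) - tau * phi p)).
  by apply: eq_Rintegral => p _; apply: eq_Rintegral => tau _; rewrite mul1r subr0.
have H := nuL phi.
have Hc : \int[nu]_om cos (pairing om phi) = expR (levy_cos fin phi) * cos (levy_sin fin phi).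
  have := congr1 (@complex.Re R) H.
  rewrite /cintegral/= expR0.
  under eq_Rintegral do rewrite mul1r.
  by move=> ->; rewrite -ecos -esin -ecos1 -esin1.
have Hs : \int[nu]_om sin (pairing om phi) = expR (levy_cos fin phi) * sin (levy_sin fin phi).
  have := congr1 (@complex.Im R) H.
  rewrite /cintegral/= expR0.
  under eq_Rintegral do rewrite mul1r.
  by move=> ->; rewrite -ecos -esin -ecos1 -esin1.
have ic : intble nu (fun om => cos (pairing om phi)).
  by apply: (@bounded_integrable _ _ _ nu _ 1) => [|x]; [exact: measurable_cos_comp|exact: cos_max].
have is_ : intble nu (fun om => sin (pairing om phi)).
  by apply: (@bounded_integrable _ _ _ nu _ 1) => [|x]; [exact: measurable_sin_comp|exact: sin_max].
under eq_Rintegral do rewrite cosD mulrC [sin _ * _]mulrC.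
rewrite (RintegralB measurableT (intbleZ _ ic) (intbleZ _ is_)).
rewrite (RintegralZl _ measurableT ic) (RintegralZl _ measurableT is_).
by rewrite Hc Hs cosD; ring.
Qed.

(** Both sides are continuous along the approximation of f by test functions: the left one
    because the cosine is 1-Lipschitz, the right one by [jump_integral_lipschitz]. *)
Lemma char_pairing f Y v : measurable_fun setT f -> (sqint plane f < +oo)%E ->
  is_pairing nu f Y ->
  \int[nu]_om cos (Y om + v) = expR (levy_cos fin f) * cos (levy_sin fin f + v).
Proof.
move=> mf foo /is_pairingP[mY H].
have h n : exists phi : testfun R,
    (sqint plane (fun p => phi p - f p)%R < (harmonic n ^+ 2)%:E)%E /\
    (sqint nu (fun om => pairing om phi - Y om)%R < (harmonic n ^+ 2)%:E)%E.
  by apply: H; rewrite exprn_gt0//; case/andP: (@harmonic_le1 R n).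
have [phi Hphi] := choice h.
have mphi n := testfun_measurable (phi n).
have phioo n : (sqint plane (phi n) < +oo)%E.
  apply: (@le_lt_trans _ _ (2%:E * sqint plane (fun p => phi n p - f p)%R + 2%:E * sqint plane f)%E).
    have md : measurable_fun setT (fun p => phi n p - f p) by exact: measurable_funB.
    have t0 : 0 <= 2 :> R by [].
    have S := sqint_le2 plane t0 t0 (mphi n) md mf.
    apply: S => p.
    by have := sqr_ge0 ((phi n p - f p) - f p); nra.
  rewrite lte_add_pinfty// lte_mul_pinfty// ?lee_fin//.
  by rewrite (lt_trans (Hphi n).1)// ltry.
have h0 n : 0 < @harmonic R n by case/andP: (@harmonic_le1 R n).
have cvg_h (k1 k2 k3 : R) : (k1 * harmonic n ^+ 2 + k2 * harmonic n) * k3 @[n --> \oo] --> (0 : R).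
  rewrite -(mul0r k3); apply: cvgM; last exact: cvg_cst.
  rewrite -[X in _ --> X](addr0 0); apply: cvgD.
    rewrite -(mulr0 k1); apply: cvgM; first exact: cvg_cst.
    by rewrite -(mulr0 0); apply: cvgM; exact: cvg_harmonic.
  by rewrite -(mulr0 k2); apply: cvgM; [exact: cvg_cst|exact: cvg_harmonic].
have sq_cvg (u : nat -> R) (l k1 k2 k3 : R) :
    (forall n, `|u n - l| <= (k1 * harmonic n ^+ 2 + k2 * harmonic n) * k3) ->
    u n @[n --> \oo] --> l.
  move=> ul; apply/subr_cvg0; apply: norm_cvg0.
  apply: (@squeeze_cvgr _ _ _ _ (cst 0) (fun n => (k1 * harmonic n ^+ 2 + k2 * harmonic n) * k3)).
  - by apply: nearW => n; rewrite normr_ge0/=.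
  - exact: cvg_cst.
  - exact: cvg_h.
have ca : levy_cos fin (phi n) @[n --> \oo] --> levy_cos fin f.
  apply: (sq_cvg _ _ (fine (second_moment sigma)) (fine (second_moment sigma) + fine (second_moment sigma) * fine (sqint plane f)) 1) => n.
  have := @jump_integral_lipschitz _ _ fin (fun x => cos x - 1) f (phi n) (harmonic n) mf (mphi n).
  move=> /(_ _ cosB1_sqr _ (h0 n) foo (Hphi n).1 (phioo n)) J.
  rewrite (le_trans (J _ _))//; last by rewrite le_eqVlt; apply/orP; left; apply/eqP; ring.
    by apply: measurable_funB => //; exact: measurable_cos_comp.
  move=> x y; rewrite (_ : cos x - 1 - (cos y - 1) = cos x - cos y); first exact: cos_sqr_lipschitz.
  by ring.
have cb : levy_sin fin (phi n) @[n --> \oo] --> levy_sin fin f.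
  apply: (sq_cvg _ _ (fine (second_moment sigma)) (fine (second_moment sigma) + fine (second_moment sigma) * fine (sqint plane f)) 1) => n.
  have := @jump_integral_lipschitz _ _ fin (fun x => sin x - x) f (phi n) (harmonic n) mf (mphi n).
  move=> /(_ _ sinB_sqr sinB_sqr_lipschitz (h0 n) foo (Hphi n).1 (phioo n)) J.
  rewrite (le_trans (J _))//; last by rewrite le_eqVlt; apply/orP; left; apply/eqP; ring.
  by apply: measurable_funB => //; exact: measurable_sin_comp.
have cE : \int[nu]_om cos (pairing om (phi n) + v) @[n --> \oo] --> \int[nu]_om cos (Y om + v).
  apply: (sq_cvg _ _ 0 2 1) => n; rewrite mul0r add0r mulr1.
  have mpn := @pairing_measurable R (phi n).
  have icos (Z : Dprime R -> R) : measurable_fun setT Z -> intble nu (fun om => cos (Z om + v)).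
    move=> mZ; apply: (@bounded_integrable _ _ _ nu _ 1) => [|x]; last exact: cos_max.
    by apply: measurable_cos_comp; exact: measurable_funD.
  rewrite -RintegralB//; [|exact: icos..].
  have md : measurable_fun setT (fun om : Dprime R => pairing om (phi n) - Y om) by exact: measurable_funB.
  have doo : (sqint nu (fun om => pairing om (phi n) - Y om)%R < +oo)%E.
    by rewrite (lt_trans (Hphi n).2)// ltry.
  have id2 := sqint_intble md doo.
  apply: (@le_trans _ _ (\int[nu]_om (harmonic n + (harmonic n)^-1 * (pairing om (phi n) - Y om) ^+ 2))).
    apply: normr_Rintegral_le.
    - apply: measurable_funB; apply: measurable_cos_comp; exact: measurable_funD.
    - by apply: intbleD; [exact: intble_cst|exact: intbleZ].
    - move=> om; rewrite (le_trans (cos_lipschitz _ _))//.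
      rewrite (_ : pairing om (phi n) + v - (Y om + v) = pairing om (phi n) - Y om); last by ring.
      rewrite -(real_normK (num_real (pairing om (phi n) - Y om))).
      have := normr_ge0 (pairing om (phi n) - Y om).
      move: (`|pairing om (phi n) - Y om|) (harmonic n) (h0 n) => u k k0 u0.
      have : 0 <= k^-1 * (u - k) ^+ 2 by rewrite mulr_ge0 ?invr_ge0 ?(ltW k0)// sqr_ge0.
      have -> : k^-1 * (u - k) ^+ 2 = k^-1 * u ^+ 2 - 2 * u + k by field; rewrite gt_eqF.
      lra.
  rewrite RintegralD//; [|exact: intble_cst|exact: intbleZ].
  rewrite Rintegral_cstP RintegralZl// (_ : 2 * harmonic n = harmonic n + harmonic n); last by ring.
  rewrite lerD2l ler_pdivrMl// -expr2 -lee_fin intble_fineK//.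
  exact: ltW (Hphi n).2.
have cR : expR (levy_cos fin (phi n)) * cos (levy_sin fin (phi n) + v) @[n --> \oo] -->
    expR (levy_cos fin f) * cos (levy_sin fin f + v).
  apply: cvgM.
    by apply: (@continuous_cvg _ _ _ _ _ _ expR); [exact: continuous_expR|exact: ca].
  apply: (@continuous_cvg _ _ _ _ _ _ cos); first exact: continuous_cos.
  by apply: cvgD; [exact: cb|exact: cvg_cst].
rewrite (_ : (fun n => \int[nu]_om cos (pairing om (phi n) + v)) =
  (fun n => expR (levy_cos fin (phi n)) * cos (levy_sin fin (phi n) + v))) in cE.
  by have := cvg_unique _ cE cR; apply.
by apply/funext => n; exact: char_testfun.
Qed.

Lemma is_pairing0 : is_pairing nu (fun _ => 0) (fun _ => 0).
Proof.
apply/is_pairingP; split => // e e0; exists 0.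
have E d (T : measurableType d) (mu : {measure set T -> \bar R}) (u : T -> R) :
    (forall x, u x = 0) -> (sqint mu u < e%:E)%E.
  move=> u0; rewrite /sqint (eq_integral (fun _ => 0%E)) ?integral0 ?lte_fin// => x _.
  by rewrite u0 expr0n.
split; apply: E => x; rewrite subr0//.
by rewrite /pairing linear0.
Qed.

Lemma is_pairingZ a f Y : measurable_fun setT f -> is_pairing nu f Y ->
  is_pairing nu (fun p => a * f p) (fun om => a * Y om).
Proof.
move=> mf fY; have m0 : measurable_fun setT (fun _ : R * R => 0 : R) by exact: measurable_cst.
have := is_pairing_lin a mf m0 fY is_pairing0.
by congr (is_pairing nu _ _); apply/funext => x; rewrite addr0.
Qed.

Lemma sqintZ (a : R) f : measurable_fun setT f -> (sqint plane f < +oo)%E ->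
  (sqint plane (fun p => a * f p)%R < +oo)%E.
Proof.
move=> mf foo; apply: (@le_lt_trans _ _ ((a ^+ 2)%:E * sqint plane f)%E).
  apply: sqint_le => //; [exact: sqr_ge0|exact: measurable_funM|by move=> x; rewrite exprMn].
by rewrite lte_mul_pinfty// lee_fin sqr_ge0.
Qed.

Lemma char_pairing_scaled f Y u v : measurable_fun setT f -> (sqint plane f < +oo)%E ->
  is_pairing nu f Y ->
  \int[nu]_om cos (u * Y om + v) =
  expR (\int[m]_q (cos (u * jump f q) - 1)) *
  cos (\int[m]_q (sin (u * jump f q) - u * jump f q) + v).
Proof.
move=> mf foo fY.
rewrite (char_pairing v _ _ (is_pairingZ u mf fY))//; [|exact: measurable_funM|exact: sqintZ].
have E q : jump (fun p => u * f p) q = u * jump f q by rewrite /jump mulrCA.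
rewrite /levy_cos /levy_sin; under eq_Rintegral do rewrite E.
by under [in X in cos X]eq_Rintegral do rewrite E.
Qed.

Section nonnegative.
Variables (f : R * R -> R) (Y : Dprime R -> R).
Hypotheses (mf : measurable_fun setT f) (foo : (sqint plane f < +oo)%E).
Hypotheses (f0 : forall p, 0 <= f p) (fY : is_pairing nu f Y).

Let mY : measurable_fun setT Y. Proof. by case: fY. Qed.
Let j0 q : 0 <= jump f q. Proof. by rewrite mulr_ge0. Qed.

Lemma pairing_sqr_le : intble nu (fun om => Y om ^+ 2) /\
  (sqint nu Y <= (2 * fine (second_moment sigma))%:E * sqint plane f)%E.
Proof.
have [iY2 H] := @laplace_sqr_integrable _ _ _ nu Y _ _ m (jump f) mY
  (measurable_jump mf) (intble_jump_sqr fin mf foo)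
  (fun u v => char_pairing_scaled u v mf foo fY).
split=> //; rewrite /sqint -intble_fineK//.
rewrite -[X in (_ * X)%E]fineK ?ge0_fin_numE ?sqint_ge0// -EFinM lee_fin -mulrA.
by rewrite -(Rintegral_jump_sqr fin mf foo).
Qed.

Lemma pairing_exp_integrable : intble nu (fun om => expR (- Y om)).
Proof.
have := @laplace_integrable _ _ _ nu Y _ _ m (jump f) mY
  (measurable_jump mf) j0 (intble_jump_sqr fin mf foo)
  (fun u v => char_pairing_scaled u v mf foo fY) 1 ltr01.
by under eq_fun do rewrite mul1r.
Qed.

Definition levy_laplace (g : R * R -> R) := \int[m]_q (expR (- jump g q) - 1 + jump g q).

Lemma pairing_laplace : \int[nu]_om expR (- Y om) = expR (levy_laplace f).
Proof.
exact: (@laplace_transform _ _ _ nu Y _ _ m (jump f) mY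
  (measurable_jump mf) j0 (intble_jump_sqr fin mf foo)
  (fun u v => char_pairing_scaled u v mf foo fY)).
Qed.

End nonnegative.

End characteristic_functional.

(** * Independence of the noise on disjoint regions *)

Section sqint_lin.
Context d (T : measurableType d) (R : realType) (mu : {measure set T -> \bar R}).

Lemma sqint_lin_fin (a : R) (u v : T -> R) : measurable_fun setT u -> measurable_fun setT v ->
  (sqint mu u < +oo)%E -> (sqint mu v < +oo)%E ->
  (sqint mu (fun x => a * u x + v x)%R < +oo)%E.
Proof.
move=> mu_ mv uoo voo.
have c0 : 0 <= 2 * a ^+ 2 by rewrite mulr_ge0// sqr_ge0.
have t0 : 0 <= 2 :> R by [].
have m1 : measurable_fun setT (fun x => a * u x + v x).
  by apply: measurable_funD => //; exact: measurable_funM.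
have S := sqint_le2 mu c0 t0 m1 mu_ mv.
apply: (le_lt_trans (S _)).
  by move=> x; have := sqr_ge0 (a * u x - v x); nra.
by rewrite lte_add_pinfty// lte_mul_pinfty.
Qed.

Lemma Rintegral_indic A (W : T -> R) : measurable A ->
  \int[mu]_(x in A) W x = \int[mu]_x (\1_A x * W x).
Proof.
move=> mA; rewrite Rintegral_mkcond; apply: eq_Rintegral => x _.
by rewrite /patch indicE; case: (x \in A); rewrite ?mul1r// mul0r.
Qed.

End sqint_lin.

Section independence.
Context {R : realType} (sigma : {measure set R -> \bar R}).
Variable fin : finite_second_moment sigma.
Context (nu : probability (Dprime R) R).
Hypothesis nuL : is_levy_noise sigma nu.
Implicit Types (f g : R * R -> R) (Y Z : Dprime R -> R) (D : set (R * R)).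

Local Notation plane := (@plane_measure R).
Local Notation m := (levy_intensity fin).

Definition square_integrable f := measurable_fun setT f /\ (sqint plane f < +oo)%E.

Lemma square_integrable_lin a f g : square_integrable f -> square_integrable g ->
  square_integrable (fun p => a * f p + g p).
Proof.
move=> [mf foo] [mg goo]; split; last exact: sqint_lin_fin.
by apply: measurable_funD => //; exact: measurable_funM.
Qed.

Lemma square_integrable0 : square_integrable (fun _ => 0).
Proof.
split; first exact: measurable_cst.
by rewrite /sqint (eq_integral (fun _ => 0%E)) ?integral0// => x _; rewrite expr0n.
Qed.

Definition noise_on D : set (Dprime R -> R) := [set Z | exists g,
  [/\ square_integrable g, forall p, ~ D p -> g p = 0 & is_pairing nu g Z]].

Lemma noise_on_measurable D Z : noise_on D Z -> measurable_fun setT Z.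
Proof. by move=> [g [_ _ []]]. Qed.

Lemma noise_on_linear D : linear_set (noise_on D).
Proof.
split; first by exists (fun _ => 0); split => //; [exact: square_integrable0|exact: is_pairing0].
move=> a Y Z [f [sf f0 fY]] [g [sg g0 gZ]].
exists (fun p => a * f p + g p); split; first exact: square_integrable_lin.
  by move=> p Dp; rewrite f0// g0// mulr0 addr0.
by apply: is_pairing_lin => //; [exact: sf.1|exact: sg.1].
Qed.

(** For kernels with disjoint supports the exponents add, both for f + g and for f - g; the
    product formula for cosines then splits the expectation. *)
Lemma noise_on_independent D D' : (forall p, D p -> D' p -> False) ->
  forall f g : Dprime R -> R, trig_limit (noise_on D) f -> trig_limit (noise_on D') g ->
    \int[nu]_om (f om * g om) = (\int[nu]_om f om) * (\int[nu]_om g om).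
Proof.
move=> DD'; apply: trig_closure_independent.
- exact: noise_on_measurable.
- exact: noise_on_measurable.
move=> Y Z u v [f [sf f0 fY]] [g [sg g0 gZ]].
have fg p : f p * g p = 0.
  have [Dp|Dp] := pselect (D p); last by rewrite f0 ?mul0r.
  by rewrite g0 ?mulr0// => D'p; exact: DD' D'p.
have [mf foo] := sf; have [mg goo] := sg.
have mN : measurable_fun setT (fun p => - g p) by exact: measurableT_comp.
have Noo : (sqint plane (fun p => - g p)%R < +oo)%E.
  by rewrite /sqint; under eq_integral do rewrite sqrrN.
have sp : square_integrable (fun p => f p + g p).
  have := square_integrable_lin 1 sf sg.
  by under eq_fun do rewrite mul1r.
have sm : square_integrable (fun p => f p + - g p).
  have := square_integrable_lin (-1) sg sf.
  by under eq_fun do rewrite mulN1r addrC.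
have pp : is_pairing nu (fun p => f p + g p) (fun om => Y om + Z om).
  have := is_pairing_lin 1 mf mg fY gZ.
  by under eq_fun do rewrite mul1r; under [X in is_pairing _ _ X]eq_fun do rewrite mul1r.
have pm : is_pairing nu (fun p => f p + - g p) (fun om => Y om - Z om).
  have := is_pairing_lin (-1) mg mf gZ fY.
  by under eq_fun do rewrite mulN1r addrC; under [X in is_pairing _ _ X]eq_fun do rewrite mulN1r addrC.
have icos (U : Dprime R -> R) w : measurable_fun setT U -> intble nu (fun om => cos (U om + w)).
  move=> mU; apply: (@bounded_integrable _ _ _ nu _ 1) => [|x]; last exact: cos_max.
  by apply: measurable_cos_comp; exact: measurable_funD.
have E om : cos (Y om + u) * cos (Z om + v) =
    2^-1 * (cos (Y om + Z om + (u + v)) + cos (Y om - Z om + (u - v))).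
  by rewrite cosMcos; congr (_ * (cos _ + cos _)); ring.
under eq_Rintegral do rewrite E.
rewrite (RintegralZl _ measurableT); last by apply: intbleD; apply: icos; [exact: pp.1|exact: pm.1].
rewrite (RintegralD measurableT); [|by apply: icos; exact: pp.1|by apply: icos; exact: pm.1].
rewrite (char_pairing fin nuL _ sp.1 sp.2 pp) (char_pairing fin nuL _ sm.1 sm.2 pm).
rewrite (char_pairing fin nuL u mf foo fY) (char_pairing fin nuL v mg goo gZ).
have fNg p : f p * - g p = 0 by rewrite mulrN fg oppr0.
rewrite !levy_cosD// !levy_sinD// levy_cosN levy_sinN// !expRD.
rewrite [RHS](_ : _ = expR (levy_cos fin f) * expR (levy_cos fin g) *
  (cos (levy_sin fin f + u) * cos (levy_sin fin g + v))); last by ring.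
rewrite cosMcos.
have -> : levy_sin fin f + levy_sin fin g + (u + v) = levy_sin fin f + u + (levy_sin fin g + v) by ring.
have -> : levy_sin fin f - levy_sin fin g + (u - v) = levy_sin fin f + u - (levy_sin fin g + v) by ring.
ring.
Qed.

Lemma tempered_expR_cvg (y : R) :
  expR (- (1 * y) - harmonic n * y ^+ 2) @[n --> \oo] --> expR (- y).
Proof. by rewrite -[X in _ --> expR (- X)]mul1r; exact: cvg_gauss_weight. Qed.

Lemma tempered_expR_le (y : R) n : expR (- (1 * y) - harmonic n * y ^+ 2) <= expR (- y).
Proof. by rewrite -[X in _ <= expR (- X)]mul1r; exact/gauss_weight_le/harmonic_ge0. Qed.

(** The tempered exponential of Y, cut off outside A, and that of Y' are in the closures of
    the cosines of D and of D', so that the expectation of their product factors; the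
    tempering is removed by dominated convergence. *)
Theorem conditional_laplace D D' (A : set (Dprime R)) f f' Y Y' :
  (forall p, D p -> D' p -> False) ->
  measurable A -> trig_sets (noise_on D) A ->
  square_integrable f -> (forall p, 0 <= f p) -> (forall p, ~ D p -> f p = 0) -> is_pairing nu f Y ->
  square_integrable f' -> (forall p, 0 <= f' p) -> (forall p, ~ D' p -> f' p = 0) -> is_pairing nu f' Y' ->
  \int[nu]_(om in A) expR (- (Y om + Y' om)) =
  expR (levy_laplace fin f') * \int[nu]_(om in A) expR (- Y om).
Proof.
move=> DD' mA tA sf f0 fD fY sf' f'0 f'D fY'.
have [mf foo] := sf; have [mf' f'oo] := sf'; have mY := fY.1; have mY' := fY'.1.
have VY : noise_on D Y by exists f.
have VY' : noise_on D' Y' by exists f'.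
have L := pairing_laplace fin nuL mf' f'oo f'0 fY'; rewrite -{}L.
rewrite (Rintegral_indic nu (fun om => expR (- (Y om + Y' om))) mA).
rewrite (Rintegral_indic nu (fun om => expR (- Y om)) mA).
pose w n (y : R) := expR (- (1 * y) - harmonic n * y ^+ 2).
have h0 n : 0 < @harmonic R n by case/andP: (@harmonic_le1 R n).
have lV := noise_on_linear.
have tw n : trig_limit (noise_on D) (fun om => \1_A om * w n (Y om)).
  by apply: trig_closureM => //; [exact: trig_space2|exact: trig_closure_gauss_comp].
have tw' n : trig_limit (noise_on D') (fun om => w n (Y' om)).
  exact: trig_closure_gauss_comp.
have mw n (U : Dprime R -> R) : measurable_fun setT U -> measurable_fun setT (fun om => w n (U om)).
  move=> mU; have mq : measurable_fun setT (fun om => - (1 * U om) - harmonic n * U om ^+ 2).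
    apply: measurable_funB; first by apply: measurableT_comp => //; exact: measurable_funM.
    by apply: measurable_funM => //; exact: measurable_funX.
  exact: (measurableT_comp (@measurable_expR R) mq).
have m1 : measurable_fun setT (\1_A : Dprime R -> R) by exact: measurable_indic.
have i01 om : (0 <= \1_A om :> R) && (\1_A om <= 1 :> R) by rewrite indicE; case: (om \in A); rewrite /= ?lexx ?ler01.
have w0 n y : 0 <= w n y by exact: expR_ge0.
have iY := pairing_exp_integrable fin nuL mf foo f0 fY.
have iY' := pairing_exp_integrable fin nuL mf' f'oo f'0 fY'.
have iYY' : intble nu (fun om => expR (- Y om) * expR (- Y' om)).
  have pp : is_pairing nu (fun p => f p + f' p) (fun om => Y om + Y' om).
    have := is_pairing_lin 1 mf mf' fY fY'.
    by under eq_fun do rewrite mul1r; under [X in is_pairing _ _ X]eq_fun do rewrite mul1r.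
  have sp : square_integrable (fun p => f p + f' p).
    have := square_integrable_lin 1 sf sf'.
    by under eq_fun do rewrite mul1r.
  have := pairing_exp_integrable fin nuL sp.1 sp.2 (fun p => addr_ge0 (f0 p) (f'0 p)) pp.
  by under eq_fun do rewrite opprD expRD.
have c1 : \int[nu]_om ((\1_A om * w n (Y om)) * w n (Y' om)) @[n --> \oo] -->
    \int[nu]_om (\1_A om * expR (- (Y om + Y' om))).
  apply: (@dominated_cvg_Rintegral _ _ _ nu
    (fun n om => \1_A om * w n (Y om) * w n (Y' om)) _ (fun om => expR (- Y om) * expR (- Y' om))) => //.
  - by move=> n; apply: measurable_funM; [apply: measurable_funM => //|]; exact: mw.
  - move=> om; under eq_fun do rewrite -mulrA; rewrite opprD expRD.
    by apply: cvgM; [exact: cvg_cst|apply: cvgM; exact: tempered_expR_cvg].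
  - move=> n om; have /andP[a0 a1] := i01 om; rewrite !normrM !ger0_norm// ler_pM ?mulr_ge0//; last exact: tempered_expR_le.
    by rewrite (le_trans _ (tempered_expR_le _ n))// ler_piMl.
have c2 : \int[nu]_om (\1_A om * w n (Y om)) @[n --> \oo] -->
    \int[nu]_om (\1_A om * expR (- Y om)).
  apply: (@dominated_cvg_Rintegral _ _ _ nu
    (fun n om => \1_A om * w n (Y om)) _ (fun om => expR (- Y om))) => //.
  - by move=> n; apply: measurable_funM => //; exact: mw.
  - by move=> om; apply: cvgM; [exact: cvg_cst|exact: tempered_expR_cvg].
  - move=> n om; have /andP[a0 a1] := i01 om; rewrite !normrM !ger0_norm//.
    by rewrite (le_trans _ (tempered_expR_le _ n))// ler_piMl.
have c3 : \int[nu]_om (w n (Y' om)) @[n --> \oo] --> \int[nu]_om (expR (- Y' om)).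
  apply: (@dominated_cvg_Rintegral _ _ _ nu
    (fun n om => w n (Y' om)) _ (fun om => expR (- Y' om))) => //.
  - by move=> n; exact: mw.
  - by move=> om; exact: tempered_expR_cvg.
  - by move=> n om; rewrite ger0_norm// tempered_expR_le.
have c4 := cvgM c2 c3.
rewrite (_ : (fun n => \int[nu]_om ((\1_A om * w n (Y om)) * w n (Y' om))) =
  (fun n => (\int[nu]_om (\1_A om * w n (Y om))) * (\int[nu]_om (w n (Y' om))))) in c1; last first.
  by apply/funext => n; exact: noise_on_independent DD' _ _ (tw n) (tw' n).
by rewrite mulrC; have := cvg_unique _ c1 (c4 _); apply.
Qed.

(** Kernels with disjoint supports have their jumps at different points, so that the
    integrands add. *)
Lemma levy_laplaceD f g : square_integrable f -> square_integrable g ->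
  (forall p, 0 <= f p) -> (forall p, 0 <= g p) -> (forall p, f p * g p = 0) ->
  levy_laplace fin (fun p => f p + g p) = levy_laplace fin f + levy_laplace fin g.
Proof.
move=> [mf foo] [mg goo] f0 g0 fg.
have ii h : measurable_fun setT h -> (sqint plane h < +oo)%E -> (forall p, 0 <= h p) ->
    intble m (fun q => expR (- jump h q) - 1 + jump h q).
  move=> mh hoo h0; have mj := measurable_jump mh.
  apply: intble_le (intble_jump_sqr fin mh hoo) => [|q].
    apply: measurable_funD => //; apply: measurable_funB => //.
    by apply: measurableT_comp => //; exact: measurableT_comp.
  have j0 : 0 <= jump h q by rewrite mulr_ge0.
  by have /andP[e0 e1] := expRN_sub_sqr j0; rewrite ger0_norm.
rewrite /levy_laplace -RintegralD//; [|exact: ii..].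
apply: eq_Rintegral => q _; rewrite /jump mulrDr.
by have /eqP := fg q.1; rewrite mulf_eq0 => /orP[] /eqP ->;
  rewrite mulr0 ?add0r ?addr0 oppr0 expR0; ring.
Qed.

End independence.

(** * Path integrals and their dyadic sums *)

Section integrable_on.
Context d (T : measurableType d) (R : realType) (mu : {measure set T -> \bar R}).
Context (D : set T) (mD : measurable D).

Lemma integrable_onD (f g : T -> R) : mu.-integrable D (EFin \o f) ->
  mu.-integrable D (EFin \o g) -> mu.-integrable D (EFin \o (fun x => f x + g x)).
Proof. by move=> intf intg; apply: (integrableD mD intf intg). Qed.

Lemma integrable_onZ k (f : T -> R) : mu.-integrable D (EFin \o f) ->
  mu.-integrable D (EFin \o (fun x => k * f x)).
Proof. by move=> intf; apply: (integrableZl mD k intf). Qed.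

Lemma integrable_on_le (f g : T -> R) : measurable_fun D f ->
  (forall x, D x -> `|f x| <= g x) -> mu.-integrable D (EFin \o g) ->
  mu.-integrable D (EFin \o f).
Proof.
move=> mf fg; apply: le_integrable => //; first exact/measurable_EFinP.
by move=> x Dx; rewrite /= lee_fin (le_trans (fg _ Dx))// ler_norm.
Qed.

End integrable_on.

Section path_averages.
Context {R : realType}.
Implicit Types (y z : R -> R) (a b : R).

Local Notation leb := (@lebesgue_measure R).
Notation pathint y a b := (leb.-integrable `[a, b]%classic (EFin \o y)).


Lemma lebesgue_cc a b : a <= b -> leb `[a, b]%classic = (b - a)%:E.
Proof.
move=> ab; rewrite lebesgue_measure_itv/= lte_fin.
by case: ltgtP ab => // -> _; rewrite subrr.
Qed.

Lemma pathint_cst a b (k : R) : pathint (fun _ => k) a b.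
Proof.
apply: measurable_bounded_integrable => //.
  have [ab|ba] := leP a b; first by rewrite [X in (X < _)%E](lebesgue_cc ab) ltry.
  by rewrite set_itv_ge ?measure0// bnd_simp -ltNge.
exists `|k|; split; first exact: num_real.
by move=> z kz x _ /=; exact: ltW.
Qed.

Lemma Rintegral_cc_cst a b (k : R) : a <= b -> \int[leb]_(u in `[a, b]) k = k * (b - a).
Proof. by move=> ab; rewrite Rintegral_cst// [X in fine X](lebesgue_cc ab). Qed.

Lemma pathintD a b y z : pathint y a b -> pathint z a b -> pathint (fun u => y u + z u) a b.
Proof. by move=> iy iz; apply: integrable_onD iy iz. Qed.

Lemma pathintZ a b k y : pathint y a b -> pathint (fun u => k * y u) a b.
Proof. by move=> iy; apply: integrable_onZ iy. Qed.

Lemma pathint_sub a b c e y : a <= c -> e <= b -> pathint y a b -> pathint y c e.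
Proof.
move=> ac eb; apply: integrableS => // u /=; rewrite !in_itv/= => /andP[cu ue].
by rewrite (le_trans ac)// (le_trans ue).
Qed.

Lemma cc_setU a c b : a <= c -> c <= b -> `[a, b]%classic = `[a, c]%classic `|` `]c, b]%classic.
Proof.
move=> ac cb; apply/seteqP; split=> u /=; rewrite !in_itv/=.
  by move=> /andP[au ub]; have [uc|cu] := leP u c; [left|right]; rewrite ?au ?ub.
by move=> [|] /andP[h1 h2]; rewrite ?h1 ?h2 ?andbT /=; [exact: le_trans cb|apply/ltW/(le_lt_trans ac)].
Qed.

Lemma pathint_glue a c b y : a <= c -> c <= b -> pathint y a c -> pathint y c b -> pathint y a b.
Proof.
move=> ac cb i1 i2; rewrite (cc_setU ac cb).
have i3 : leb.-integrable `]c, b]%classic (EFin \o y).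
  apply: integrableS i2 => // u /=; rewrite !in_itv/= => /andP[cu ->].
  by rewrite ltW.
move/integrableP: i1 => [m1 f1]; move/integrableP: i3 => [m3 f3].
have mU : measurable_fun (`[a, c]%classic `|` `]c, b]%classic) (EFin \o y).
  by rewrite measurable_funU.
apply/integrableP; split=> //; rewrite ge0_integral_setU//.
- exact: lte_add_pinfty.
- exact: measurableT_comp.
rewrite disj_set2E; apply/eqP/seteqP; split=> // u /=; rewrite !in_itv/= => -[/andP[_ uc] /andP[cu _]].
by move: (lt_le_trans cu uc); rewrite ltxx.
Qed.

Lemma Rintegral_glue a c b y : a <= c -> c <= b -> pathint y a b ->
  \int[leb]_(u in `[a, b]) y u = \int[leb]_(u in `[a, c]) y u + \int[leb]_(u in `[c, b]) y u.
Proof.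
move=> ac cb iy; rewrite [in LHS](cc_setU ac cb) Rintegral_setU//.
- rewrite [X in _ + X]Rintegral_itv_obnd_cbnd//.
  apply: integrableS (pathint_sub ac (lexx b) iy) => // u /=.
  by rewrite !in_itv/= => /andP[cu ->]; rewrite ltW.
- by rewrite -(cc_setU ac cb).
- rewrite disj_set2E; apply/eqP/seteqP; split=> // u /=; rewrite !in_itv/= => -[/andP[_ uc] /andP[cu _]].
  by move: (lt_le_trans cu uc); rewrite ltxx.
Qed.

(** The left-endpoint rule, defined by bisection of the interval; the error below follows the
    same recursion. *)
Fixpoint dyadic_sum n a b y : R :=
  if n is n'.+1 then dyadic_sum n' a ((a + b) / 2) y + dyadic_sum n' ((a + b) / 2) b y
  else (b - a) * y a.

(** The pathwise square error, as an extended real: it is measurable and has a finite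
    expectation without any prior knowledge on the integrability of the paths, which follows from
    its finiteness. *)
Fixpoint dyadic_err n a b y : \bar R :=
  if n is n'.+1 then (2%:E * (dyadic_err n' a ((a + b) / 2) y + dyadic_err n' ((a + b) / 2) b y))%E
  else ((b - a)%:E * \int[leb]_(u in `[a, b]) ((y u - y a) ^+ 2)%:E)%E.

Lemma dyadic_err_ge0 n a b y : a < b -> (0 <= dyadic_err n a b y)%E.
Proof.
elim: n a b => [|n IH] a b ab /=.
  rewrite mule_ge0// ?lee_fin ?subr_ge0 ?(ltW ab)//.
  by apply: integral_ge0 => u _; rewrite lee_fin sqr_ge0.
by rewrite mule_ge0// adde_ge0// IH//; lra.
Qed.

Lemma dyadic_errP n a b y : measurable_fun setT y -> a < b -> (dyadic_err n a b y < +oo)%E ->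
  pathint y a b /\
  (((\int[leb]_(u in `[a, b]) y u - dyadic_sum n a b y) ^+ 2)%:E <= dyadic_err n a b y)%E.
Proof.
move=> my; elim: n a b => [|n IH] a b ab /= eoo.
  have d0 : 0 < b - a by rewrite subr_gt0.
  pose z u := y u - y a.
  have mz : measurable_fun setT z by exact: measurable_funB.
  have I0 : (0 <= \int[leb]_(u in `[a, b]) (z u ^+ 2)%:E)%E.
    by apply: integral_ge0 => u _; rewrite lee_fin sqr_ge0.
  have zoo : (\int[leb]_(u in `[a, b]) (z u ^+ 2)%:E < +oo)%E.
    move: eoo; rewrite -/z; move: (\int[leb]_(u in _) _)%E I0 => [r||] //.
      by move=> _ _; rewrite ltry.
    by rewrite gt0_muley// lte_fin.
  have iz2 : pathint (fun u => z u ^+ 2) a b.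
    apply/integrableP; split.
      by apply/measurable_EFinP; apply: measurable_funTS; exact: measurable_funX.
    by under eq_integral do rewrite /= ger0_norm ?sqr_ge0//.
  have iz : pathint z a b.
    have i1 := pathintD (pathint_cst a b 1) iz2.
    apply: integrable_on_le i1 => //; first exact: measurable_funTS.
    move=> u _; rewrite -(real_normK (num_real (z u))).
    by have := sqr_ge0 (`|z u| - 1); have := normr_ge0 (z u); nra.
  have yE u : y u = z u + y a by rewrite /z subrK.
  have iy : pathint y a b.
    have := pathintD iz (pathint_cst a b (y a)).
    by under [X in integrable _ _ (_ \o X) -> _]eq_fun do rewrite -yE.
  split=> //.
  have -> : \int[leb]_(u in `[a, b]) y u - (b - a) * y a = \int[leb]_(u in `[a, b]) z u.
    under eq_Rintegral do rewrite yE.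
    rewrite RintegralD//; last exact: pathint_cst.
    by rewrite Rintegral_cc_cst ?ltW//; ring.
  set I := \int[leb]_(u in `[a, b]) z u.
  have E2 : (\int[leb]_(u in `[a, b]) (z u ^+ 2)%:E)%E = (\int[leb]_(u in `[a, b]) (z u ^+ 2))%:E.
    by rewrite fineK// ge0_fin_numE.
  rewrite -/z E2 -EFinM lee_fin.
  (* Cauchy-Schwarz on one cell, from the integral of (z - c)^2 with c the mean of z *)
  pose c := I / (b - a).
  have H : 0 <= \int[leb]_(u in `[a, b]) ((z u ^+ 2 + (- (2 * c)) * z u) + c ^+ 2).
    apply: Rintegral_ge0 => u _; have := sqr_ge0 (z u - c); nra.
  rewrite RintegralD// in H; [|apply: pathintD => //; exact: pathintZ|exact: pathint_cst].
  rewrite RintegralD// in H; [|exact: pathintZ].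
  rewrite RintegralZl// Rintegral_cc_cst ?(ltW ab)// -/I in H.
  have cE : I = c * (b - a) by rewrite /c divfK// gt_eqF.
  have := mulr_ge0 (ltW d0) H; rewrite -subr_ge0; congr (0 <= _).
  by move: (\int[leb]_(x in _) (z x ^+ 2)) => Q; rewrite cE; ring.
set c := (a + b) / 2 in eoo *.
have ac : a < c by rewrite /c; lra.
have cb : c < b by rewrite /c; lra.
have e1 := dyadic_err_ge0 n y ac; have e2 := dyadic_err_ge0 n y cb.
have [f1 f2] : (dyadic_err n a c y < +oo)%E /\ (dyadic_err n c b y < +oo)%E.
  move: eoo e1 e2; move: (dyadic_err n a c y) (dyadic_err n c b y) => [r||] [s||] //.
  - by rewrite !ltry.
  - by rewrite addey// gt0_muley// lte_fin.
  - by rewrite addye// gt0_muley// lte_fin.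
  - by rewrite addye// gt0_muley// lte_fin.
have [i1 b1] := IH _ _ ac f1; have [i2 b2] := IH _ _ cb f2.
have iy : pathint y a b by exact: pathint_glue (ltW ac) (ltW cb) i1 i2.
split=> //; rewrite (Rintegral_glue (ltW ac) (ltW cb) iy).
move: f1 f2 b1 b2 e1 e2; move: (dyadic_err n a c y) (dyadic_err n c b y) => [r||] [s||] // _ _.
rewrite (_ : 2 * (r%:E + s%:E) = (2 * (r + s))%:E)%E// !lee_fin.
move: (Rintegral _ _ _) (Rintegral _ _ _) (dyadic_sum n a c y) (dyadic_sum n c b y) => p q p' q'.
(* the square of the total error is at most twice the sum of the squared errors on the halves *)
by have := sqr_ge0 ((p - q') - (q - p')); nra.
Qed.

Lemma pathint_dyadic_err n a b y : measurable_fun setT y -> a < b ->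
  (dyadic_err n a b y < +oo)%E -> pathint y a b.
Proof. by move=> my ab /(dyadic_errP my ab)[]. Qed.

End path_averages.

Section averages_in_L2.
Context {R : realType} d (T : measurableType d) (mu : {sigma_finite_measure set T -> \bar R}).
Variable Y : T -> R -> R.
Hypothesis mY : measurable_fun setT (fun q : T * R => Y q.1 q.2).
Implicit Types a b : R.

Local Notation leb := (@lebesgue_measure R).

Lemma measurable_path x : measurable_fun setT (Y x).
Proof. exact: (measurableT_comp mY (measurable_pair1 x)). Qed.

Lemma measurable_section u : measurable_fun setT (Y ^~ u).
Proof. exact: (measurableT_comp mY (measurable_pair2 u)). Qed.

Lemma measurable_path_integral (g : T * R -> \bar R) : measurable_fun setT g ->
  (forall q, (0 <= g q)%E) -> measurable_fun setT (fun x => \int[leb]_u g (x, u))%E.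
Proof.
by move=> mg g0; apply: measurable_fun_fubini_tonelli_F; [exact: mg|exact: g0].
Qed.

Lemma measurable_Rintegral_path a b :
  measurable_fun setT (fun x => \int[leb]_(u in `[a, b]) Y x u).
Proof.
pose g (q : T * R) : \bar R := (\1_`[a, b]%classic q.2 * Y q.1 q.2)%:E.
have mg : measurable_fun setT g.
  apply/measurable_EFinP; apply: measurable_funM => //.
  by apply: (measurableT_comp (measurable_indic _)) => //; exact: measurable_snd.
have mp : measurable_fun setT (g^\+)%E by exact: measurable_funepos.
have mn : measurable_fun setT (g^\-)%E by exact: measurable_funeneg.
have Fp := measurable_path_integral mp (funepos_ge0 g).
have Fn := measurable_path_integral mn (funeneg_ge0 g).
rewrite (_ : (fun x => _) = (fun x => fine (\int[leb]_u (g^\+ (x, u)) - \int[leb]_u (g^\- (x, u)))%E)).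
  by apply: measurableT_comp => //; exact: emeasurable_funB.
apply/funext => x; rewrite /Rintegral; congr fine.
rewrite integral_mkcond integralE; congr (_ - _)%E; apply: eq_integral => u _.
  by rewrite !funeposE /g /patch indicE; case: (u \in _); rewrite ?mul1r ?mul0r.
by rewrite !funenegE /g /patch indicE; case: (u \in _); rewrite ?mul1r ?mul0r.
Qed.

Let cell a b (q : T * R) : \bar R := (\1_`[a, b]%classic q.2 * (Y q.1 q.2 - Y q.1 a) ^+ 2)%:E.

Let cell_ge0 a b q : (0 <= cell a b q)%E.
Proof. by rewrite lee_fin mulr_ge0// sqr_ge0. Qed.

Let measurable_cell a b : measurable_fun setT (cell a b).
Proof.
apply/measurable_EFinP; apply: measurable_funM.
  by apply: (measurableT_comp (measurable_indic _)) => //; exact: measurable_snd.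
apply: measurable_funX; apply: measurable_funB => //.
by apply: (measurableT_comp (measurable_section a)); exact: measurable_fst.
Qed.

Let cellE a b x :
  (\int[leb]_(u in `[a, b]) ((Y x u - Y x a) ^+ 2)%:E = \int[leb]_u cell a b (x, u))%E.
Proof.
rewrite integral_mkcond; apply: eq_integral => u _.
by rewrite /cell /patch indicE; case: (u \in _); rewrite ?mul1r ?mul0r.
Qed.

Lemma measurable_dyadic_err n a b : measurable_fun setT (fun x => dyadic_err n a b (Y x)).
Proof.
elim: n a b => [|n IH] a b /=.
  apply: measurable_funeM; under eq_fun do rewrite cellE.
  exact: measurable_path_integral (measurable_cell a b) (cell_ge0 a b).
by apply: measurable_funeM; apply: emeasurable_funD.
Qed.

Lemma measurable_dyadic_sum n a b : measurable_fun setT (fun x => dyadic_sum n a b (Y x)).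
Proof.
elim: n a b => [|n IH] a b /=; last exact: measurable_funD.
by apply: measurable_funM => //; exact: measurable_section.
Qed.

Variables (a0 b0 C : R).
Hypothesis C0 : 0 <= C.
Hypothesis Ylip : forall u v, a0 <= u -> u <= v -> v <= b0 ->
  (sqint mu (fun x => Y x v - Y x u)%R <= (C * (v - u))%:E)%E.

(** On one cell the error has expectation at most C (b - a)^3; each bisection divides it by 8,
    doubles it twice, by (x + y)^2 <= 2 x^2 + 2 y^2 and by the number of halves, and so gains a
    factor 2. *)
Lemma integral_dyadic_err n a b : a0 <= a -> a < b -> b <= b0 ->
  (\int[mu]_x dyadic_err n a b (Y x) <= (C * (b - a) ^+ 3 / 2 ^+ n)%:E)%E.
Proof.
elim: n a b => [|n IH] a b aa ab bb /=.
  have d0 : 0 <= b - a by rewrite subr_ge0 ltW.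
  under eq_integral do rewrite cellE.
  rewrite ge0_integralZl_EFin//; last 2 first.
  - by move=> x _; apply: integral_ge0 => u _; exact: cell_ge0.
  - exact: measurable_path_integral (measurable_cell a b) (cell_ge0 a b).
  rewrite fubini_tonelli; [|exact: measurable_cell|exact: cell_ge0].
  apply: (@le_trans _ _ ((b - a)%:E * \int[leb]_(u in `[a, b]) (C * (b - a))%:E)%E).
    apply: lee_wpmul2l; first by rewrite lee_fin.
    rewrite [leRHS]integral_mkcond; apply: ge0_le_integral => //.
    + by move=> u _; apply: integral_ge0 => x _; exact: cell_ge0.
    + by apply: (measurable_fun_fubini_tonelli_G (cell a b)) => // q; exact: cell_ge0.
    + by apply: (iffLR (measurable_restrictT _ _)) => //; exact: measurable_itv.
    + move=> u _; rewrite /patch /cell/= indicE; case: ifPn => ui; last first.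
        by rewrite integral0_eq// => x _; rewrite mul0r.
      under eq_integral do rewrite mul1r.
      move: ui; rewrite inE/= in_itv/= => /andP[au ub].
      apply: (le_trans (Ylip aa au (le_trans ub bb))).
      by rewrite lee_fin ler_wpM2l// lerD2r.
  rewrite integral_cst// [X in (_ * (_ * X))%E](lebesgue_cc (ltW ab)) -!EFinM lee_fin.
  by rewrite expr0 divr1 le_eqVlt; apply/orP; left; apply/eqP; ring.
set c := (a + b) / 2.
have ac : a < c by rewrite /c; lra.
have cb : c < b by rewrite /c; lra.
have e0 x u v : u < v -> (0 <= dyadic_err n u v (Y x))%E by exact: dyadic_err_ge0.
rewrite ge0_integralZl_EFin//; last 2 first.
- by move=> x _; rewrite adde_ge0// e0.
- by apply: emeasurable_funD; exact: measurable_dyadic_err.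
rewrite ge0_integralD//; last 4 first.
- by move=> x _; exact: e0.
- exact: measurable_dyadic_err.
- by move=> x _; exact: e0.
- exact: measurable_dyadic_err.
apply: (@le_trans _ _ (2%:E * ((C * (c - a) ^+ 3 / 2 ^+ n)%:E + (C * (b - c) ^+ 3 / 2 ^+ n)%:E))%E).
  apply: lee_wpmul2l; first by rewrite lee_fin.
  apply: leeD; apply: IH => //; first exact: (le_trans (ltW cb)).
  exact: (le_trans _ (ltW ac)).
rewrite -EFinD -EFinM lee_fin le_eqVlt; apply/orP; left; apply/eqP.
by rewrite /c [2 ^+ n.+1]exprS; field; rewrite expf_neq0.
Qed.

Lemma dyadic_sum_cvg n a b : a0 <= a -> a < b -> b <= b0 ->
  (sqint mu (fun x => \int[leb]_(u in `[a, b]) Y x u - dyadic_sum n a b (Y x))%R <=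
   (C * (b - a) ^+ 3 / 2 ^+ n)%:E)%E.
Proof.
move=> aa ab bb; apply: (le_trans _ (integral_dyadic_err n aa ab bb)).
apply: ge0_le_integral => //.
- by move=> x _; rewrite lee_fin sqr_ge0.
- apply: measurable_sqr; apply: measurable_funB; last exact: measurable_dyadic_sum.
  exact: measurable_Rintegral_path.
- exact: measurable_dyadic_err.
- move=> x _; have [eoo|] := ltP (dyadic_err n a b (Y x)) (+oo%E).
    by have [] := dyadic_errP (measurable_path x) ab eoo.
  by rewrite leye_eq => /eqP ->; rewrite leey.
Qed.

(** Almost every path has a finite one-cell error, hence a square integrable
    increment. *)
Lemma pathint_ae a b : a0 <= a -> a <= b -> b <= b0 ->
  {ae mu, forall x, leb.-integrable `[a, b]%classic (EFin \o Y x)}.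
Proof.
rewrite [a <= b]le_eqVlt => aa /orP[/eqP <-|ab] bb.
  apply: aeW => x; apply/integrableP; split.
    by apply/measurable_EFinP; apply: measurable_funTS; exact: measurable_path.
  by rewrite set_itv1 integral_set1 ltry.
have ie : mu.-integrable setT (fun x => dyadic_err 0 a b (Y x)).
  apply/integrableP; split; first exact: measurable_dyadic_err.
  under eq_integral do rewrite gee0_abs ?dyadic_err_ge0//.
  by apply: le_lt_trans (integral_dyadic_err 0 aa ab bb) _; rewrite ltry.
have := integrable_ae measurableT ie; apply: filterS => x /(_ I) ef.
apply: (@pathint_dyadic_err _ 0%N) => //; first exact: measurable_path.
by rewrite -ge0_fin_numE ?dyadic_err_ge0.
Qed.

End averages_in_L2.

(** * Averages of adapted variables and of pairings *)

Section fast_convergence.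
Context d (T : measurableType d) (R : realType) (mu : {measure set T -> \bar R}).

Lemma nneseries_dyadic_le (C : R) : 0 <= C ->
  (\sum_(0 <= n <oo) (C / 2 ^+ n)%:E <= (2 * C)%:E)%E.
Proof.
move=> C0; have c0 n : 0 <= C / 2 ^+ n by rewrite divr_ge0// exprn_ge0.
apply: lime_le; first by apply: is_cvg_nneseries => n _ _; rewrite lee_fin.
apply: nearW => n; rewrite (_ : (\sum_(0 <= i < n) (C / 2 ^+ i)%:E)%E = (2 * C - 2 * C / 2 ^+ n)%:E).
  by rewrite lee_fin gerBl divr_ge0 ?exprn_ge0// mulr_ge0.
elim: n => [|n IH]; first by rewrite big_geq// expr0 divr1 subrr.
rewrite big_nat_recr//= IH -EFinD; congr EFin; rewrite [2 ^+ n.+1]exprS.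
by field; rewrite expf_neq0.
Qed.

(** The series of the squares has a finite integral, so that it converges almost everywhere
    and its terms tend to 0. *)
Lemma fast_cvg_ae (C : R) (u : nat -> T -> R) : 0 <= C ->
  (forall n, measurable_fun setT (u n)) ->
  (forall n, (sqint mu (u n) <= (C / 2 ^+ n)%:E)%E) ->
  {ae mu, forall x, u n x @[n --> \oo] --> (0 : R)}.
Proof.
move=> C0 um uC.
have s0 n x : (0 <= (u n x ^+ 2)%:E)%E by rewrite lee_fin sqr_ge0.
pose S x := (\sum_(0 <= n <oo) (u n x ^+ 2)%:E)%E.
have S0 x : (0 <= S x)%E by exact: nneseries_ge0.
have mS : measurable_fun setT S.
  by apply: ge0_emeasurable_sum => // n _; exact: measurable_sqr.
have iS : mu.-integrable setT S.
  apply/integrableP; split=> //; under eq_integral do rewrite gee0_abs//.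
  rewrite integral_nneseries//; last by move=> n; exact: measurable_sqr.
  apply: (@le_lt_trans _ _ (2 * C)%:E); last by rewrite ltry.
  apply: le_trans (nneseries_dyadic_le C0); apply: lee_nneseries => [n _ _|n _]; last exact: uC.
  exact: sqint_ge0.
have := integrable_ae measurableT iS; apply: filterS => x /(_ I) Sf.
have Soo : (S x < +oo)%E by rewrite -ge0_fin_numE.
have H := nneseries_tail_cvg Soo (fun k _ => s0 k x).
have sq : u n x ^+ 2 @[n --> \oo] --> (0 : R).
  have : (u n x ^+ 2)%:E @[n --> \oo] --> (0%E : \bar R).
    apply: (squeeze_cvge _ (cvg_cst _) H); apply: nearW => n; rewrite s0/=.
    have := @nneseries_lim_ge R (fun k => (u k x ^+ 2)%:E) xpredT n n.+1 (fun k _ _ => s0 k x).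
    by rewrite big_nat1.
  by move=> /fine_cvgP[].
apply/cvgr0Pnorm_lt => e e0; have /cvgr0_norm_lt /(_ _ (exprn_gt0 2 e0)) := sq.
by apply: filterS => n; rewrite normrX ltr_pXn2r// nnegrE ltW.
Qed.

End fast_convergence.

Section adapted.
Context d (T : measurableType d) (R : realType) (P : probability T R).
Implicit Types (H : set (set T)) (Y Z : T -> R).

(** Measurability with respect to a collection of events which need not be the sigma-algebra
    of the ambient space. *)
Definition adapted H Y := forall B, measurable B -> H (Y @^-1` B).

Variable gens : set (set T).
Local Notation G := (<<s gens >>).

Lemma adaptedP Y :
  adapted G Y <-> measurable_fun setT (Y : g_sigma_algebraType gens -> R).
Proof.
split=> [aY _ B mB|mY B mB]; first by rewrite setTI; exact: aY.
by have := mY measurableT B mB; rewrite setTI.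
Qed.

Lemma adapted_lin a Y Z : adapted G Y -> adapted G Z -> adapted G (fun x => a * Y x + Z x).
Proof.
move=> /adaptedP mY /adaptedP mZ; apply/adaptedP.
by apply: measurable_funD => //; exact: measurable_funM.
Qed.

Lemma adapted_cst (k : R) : adapted G (fun _ => k).
Proof. by apply/adaptedP; exact: measurable_cst. Qed.

Lemma adapted_comp (h : R -> R) Y : measurable_fun setT h -> adapted G Y ->
  adapted G (fun x => h (Y x)).
Proof. by move=> mh /adaptedP mY; apply/adaptedP; exact: measurableT_comp. Qed.

Definition complete := forall N, measurable N -> P N = 0%E -> G N.

Lemma adapted_ae Y Z : complete -> adapted G Y -> measurable_fun setT Z ->
  Y = Z %[ae P] -> adapted G Z.
Proof.
move=> Gc aY mZ [N [mN N0 YN]] B mB.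
have GN : G N by exact: Gc.
have [g0 gC gU] := smallest_sigma_algebra (setT : set T) gens.
have GB : G (Y @^-1` B) by exact: aY.
have mZB : measurable (Z @^-1` B) by rewrite -[X in measurable X]setTI; exact: mZ.
have GZ : G (Z @^-1` B `&` N).
  apply: Gc; first exact: measurableI.
  by apply/eqP; rewrite eq_le measure_ge0 andbT -N0 le_measure ?inE//; exact: measurableI.
have -> : Z @^-1` B = (Y @^-1` B `\` N) `|` (Z @^-1` B `&` N).
  apply/seteqP; split=> x /=.
    have [Nx|Nx] := pselect (N x); first by right.
    move=> BZ; left; split=> //; suff -> : Y x = Z x by [].
    by apply: contrapT => h; apply/Nx/YN => /(_ I).
  move=> [[BY Nx]|[]//]; suff <- : Y x = Z x by [].
  by apply: contrapT => h; apply/Nx/YN => /(_ I).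
have mG A : G A <-> measurable (A : set (g_sigma_algebraType gens)) by [].
apply/mG; apply: measurableU; last exact/mG.
by apply: measurableD; exact/mG.
Qed.

(** Outside a null event, which belongs to the complete sigma-algebra, Y is a pointwise limit
    of the Z n. *)
Lemma adapted_fast_limit (C : R) (Z : nat -> T -> R) Y : complete -> 0 <= C ->
  (forall n, adapted G (Z n)) -> (forall n, measurable_fun setT (Z n)) ->
  measurable_fun setT Y ->
  (forall n, (sqint P (fun x => Y x - Z n x)%R <= (C / 2 ^+ n)%:E)%E) ->
  adapted G Y.
Proof.
move=> Gc C0 aZ mZ mY ZY.
have [N [mN N0 cN]] := fast_cvg_ae C0 (fun n => measurable_funB mY (mZ n)) ZY.
have GN : G N by exact: Gc.
have mG A : G A <-> measurable (A : set (g_sigma_algebraType gens)) by [].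
pose U x := \1_(~` N) x * Y x.
have aU : adapted G U.
  apply/adaptedP; apply: (@measurable_fun_cvg _ (g_sigma_algebraType gens) R setT (fun n x => \1_(~` N) x * Z n x) U).
    move=> n; apply: measurable_funM; last exact/adaptedP.
    by apply: measurable_indic; apply: measurableC; exact/mG.
  move=> x _; rewrite /U indicE; have [xN|xN] := pselect (N x).
    by rewrite memNset ?mul0r//; under eq_fun do rewrite mul0r; exact: cvg_cst.
  rewrite mem_set// mul1r; under eq_fun do rewrite mul1r.
  have h : Y x - Z n x @[n --> \oo] --> (0 : R) by apply: contrapT => h; exact/xN/cN.
  have E n : Z n x = Y x - (Y x - Z n x) by rewrite opprB addrC subrK.
  have hZ : Y x - (Y x - Z n x) @[n --> \oo] --> Y x.
    by rewrite -[X in _ --> X]subr0; apply: cvgB => //; exact: cvg_cst.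
  by rewrite -(funext E) in hZ.
apply: adapted_ae Gc aU mY _; exists N; split => // x /= h.
by apply: contrapT => xN; apply: h => _; rewrite /U indicE mem_set ?mul1r.
Qed.

End adapted.

Section averages_of_pairings.
Context {R : realType} (nu : probability (Dprime R) R).
Local Notation plane := (@plane_measure R).
Local Notation leb := (@lebesgue_measure R).
Variables (f : R * R -> R -> R) (Y : Dprime R -> R -> R) (a b C : R).
Hypothesis mf : measurable_fun setT (fun q : (R * R) * R => f q.1 q.2).
Hypothesis mY : measurable_fun setT (fun q : Dprime R * R => Y q.1 q.2).
Hypothesis C0 : 0 <= C.
Hypothesis flip : forall u v, a <= u -> u <= v -> v <= b ->
  (sqint plane (fun p => f p v - f p u)%R <= (C * (v - u))%:E)%E.
Hypothesis Ylip : forall u v, a <= u -> u <= v -> v <= b ->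
  (sqint nu (fun om => Y om v - Y om u)%R <= (C * (v - u))%:E)%E.
Hypothesis ab : a <= b.

Let B n := C * (b - a) ^+ 3 / 2 ^+ n.

(** Dyadic sums of pairings are pairings of dyadic sums, and they converge in L^2 both on the
    plane and on the noise; so the integral in the parameter commutes with the pairing. *)
Lemma average_pairing : (forall u, a <= u <= b -> is_pairing nu (f ^~ u) (Y ^~ u)) ->
  is_pairing nu (fun p => \int[leb]_(u in `[a, b]) f p u)
    (fun om => \int[leb]_(u in `[a, b]) Y om u).
Proof.
move=> fY; have [a_b|ab'] := ltP a b; last first.
  have <- : a = b by apply/eqP; rewrite eq_le ab ab'.
  rewrite set_itv1; under eq_fun do rewrite Rintegral_set1.
  by under [X in is_pairing _ _ X]eq_fun do rewrite Rintegral_set1; exact: is_pairing0.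
have dP n u v : a <= u -> u < v -> v <= b ->
    is_pairing nu (fun p => dyadic_sum n u v (f p)) (fun om => dyadic_sum n u v (Y om)).
  elim: n u v => [|n IH] u v au uv vb /=.
    have := is_pairingZ (v - u) (measurable_section mf u) (fY u _).
    by apply; rewrite au (le_trans (ltW uv)).
  have h1 : u < (u + v) / 2 by lra.
  have h2 : (u + v) / 2 < v by lra.
  have := is_pairing_lin 1 (measurable_dyadic_sum mf n _ _) (measurable_dyadic_sum mf n _ _)
    (IH _ _ au h1 (ltW (lt_le_trans h2 vb))) (IH _ _ (ltW (le_lt_trans au h1)) h2 vb).
  by under eq_fun do rewrite mul1r; under [X in is_pairing _ _ X]eq_fun do rewrite mul1r.
apply: is_pairing_closed; [exact: measurable_Rintegral_path|exact: measurable_Rintegral_path|].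
move=> e e0.
have [n Bn] : exists n, B n < e.
  have : B n @[n --> \oo] --> (0 : R).
    rewrite /B -(mulr0 (C * (b - a) ^+ 3)); apply: cvgM; first exact: cvg_cst.
    under eq_fun do rewrite -exprVn; apply: cvg_expr.
    by rewrite ger0_norm ?invr_ge0// invf_lt1// ltr1n.
  by move=> /cvgr_lt /(_ e e0) [n _ /(_ n (leqnn n))]; exists n.
exists (fun p => dyadic_sum n a b (f p)), (fun om => dyadic_sum n a b (Y om)).
have sqC d (T : measurableType d) (mu : {measure set T -> \bar R}) (u v : T -> R) :
    sqint mu (fun x => u x - v x)%R = sqint mu (fun x => v x - u x)%R.
  by apply: eq_integral => x _; rewrite -sqrrN opprB.
split; [exact: dP|exact: measurable_dyadic_sum| |].
- have S := @dyadic_sum_cvg R _ _ (@plane_measure R) f mf a b C C0 flip n _ _ (lexx a) a_b (lexx b).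
  by rewrite sqC; apply: le_lt_trans S _; rewrite lte_fin.
- have S := dyadic_sum_cvg mY C0 Ylip n (lexx a) a_b (lexx b).
  by rewrite sqC; apply: le_lt_trans S _; rewrite lte_fin.
Qed.

(** The dyadic sums are adapted, and converge fast enough for an almost sure limit. *)
Lemma average_adapted gens : complete nu gens ->
  (forall u, a <= u <= b -> adapted <<s gens >> (Y ^~ u)) ->
  adapted <<s gens >> (fun om => \int[leb]_(u in `[a, b]) Y om u).
Proof.
move=> Gc aY; have [a_b|ab'] := ltP a b; last first.
  have <- : a = b by apply/eqP; rewrite eq_le ab ab'.
  rewrite set_itv1; under eq_fun do rewrite Rintegral_set1; exact: adapted_cst.
have dA n u v : a <= u -> u < v -> v <= b ->
    adapted <<s gens >> (fun om => dyadic_sum n u v (Y om)).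
  elim: n u v => [|n IH] u v au uv vb /=.
    have := adapted_lin (v - u) (aY u _) (adapted_cst (gens := gens) 0).
    by under eq_fun do rewrite addr0; apply; rewrite au (le_trans (ltW uv)).
  have h1 : u < (u + v) / 2 by lra.
  have h2 : (u + v) / 2 < v by lra.
  have := adapted_lin 1 (IH _ _ au h1 (ltW (lt_le_trans h2 vb))) (IH _ _ (ltW (le_lt_trans au h1)) h2 vb).
  by under eq_fun do rewrite mul1r.
apply: (adapted_fast_limit (C := C * (b - a) ^+ 3) (Z := fun n om => dyadic_sum n a b (Y om)) Gc).
- by rewrite mulr_ge0// exprn_ge0// subr_ge0.
- by move=> n; exact: dA.
- by move=> n; exact: measurable_dyadic_sum.
- exact: measurable_Rintegral_path.
- by move=> n; exact: (dyadic_sum_cvg mY C0 Ylip n _ a_b _).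
Qed.

End averages_of_pairings.

(** * Kernels of the field and of the discount factor *)

Section rect_kernel.
Context {R : realType} (kap : R * R -> R).
Hypothesis mkap : measurable_fun setT kap.
Hypothesis kap0 : forall p, 0 <= kap p.
Hypothesis kapM : forall T : R, exists2 M : R, 0 <= M &
  forall p : R * R, 0 <= p.1 <= T -> 0 <= p.2 <= T -> kap p <= M.
Implicit Types (s t r u a b T : R) (p : R * R).
Local Notation plane := (@plane_measure R).
Local Notation leb := (@lebesgue_measure R).

Definition rect_kernel s t p := \1_`[0, s]%classic p.1 * \1_`[0, t]%classic p.2 * kap p.

Definition weighted_kernel s t p := rect_kernel s t p * (t - Num.max p.1 p.2).

Lemma indic_cc a b u : \1_`[a, b]%classic u = (a <= u <= b)%R%:R :> R.
Proof.
rewrite indicE; congr (_%:R); congr nat_of_bool.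
by apply/idP/idP; rewrite inE/= in_itv.
Qed.

Lemma rect_kernelE s t p : rect_kernel s t p = ((0 <= p.1 <= s) && (0 <= p.2 <= t))%:R * kap p.
Proof. by rewrite /rect_kernel !indic_cc -natrM mulnb. Qed.

Lemma rect_kernel_ge0 s t p : 0 <= rect_kernel s t p.
Proof. by rewrite rect_kernelE mulr_ge0. Qed.

Lemma rect_kernel_le s s' t t' p : s <= s' -> t <= t' -> rect_kernel s t p <= rect_kernel s' t' p.
Proof.
move=> ss tt; rewrite !rect_kernelE ler_wpM2r// ler_nat.
case: (boolP (_ && _)) => // /andP[/andP[-> xs] /andP[-> yt]].
by rewrite (le_trans xs) ?(le_trans yt).
Qed.

Lemma measurable_rect_kernel_comp d (S : measurableType d) (a b : S -> R) (h : S -> R * R) :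
  measurable_fun setT a -> measurable_fun setT b -> measurable_fun setT h ->
  measurable_fun setT (fun q => rect_kernel (a q) (b q) (h q)).
Proof.
move=> ma mb mh.
have m1 : measurable_fun setT (fun q => (h q).1) by exact: measurableT_comp.
have m2 : measurable_fun setT (fun q => (h q).2) by exact: measurableT_comp.
have H (c x : S -> R) : measurable_fun setT c -> measurable_fun setT x ->
    measurable_fun setT (fun q => \1_`[0, c q]%classic (x q) : R).
  move=> mc mx; pose A := [set q | 0 <= x q] `&` [set q | x q <= c q].
  have mA : measurable A.
    by apply: measurableI; rewrite -[X in measurable X]setTI; apply: measurable_fun_le.
  rewrite (_ : (fun q => _) = \1_A); first exact: measurable_indic.
  apply/funext => q; rewrite indic_cc indicE; congr (_%:R); congr nat_of_bool.
  by apply/idP/idP; rewrite inE /A/= => /andP.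
apply: measurable_funM; last exact: measurableT_comp.
by apply: measurable_funM; exact: H.
Qed.

Lemma measurable_rect_kernel s t : measurable_fun setT (rect_kernel s t).
Proof. by apply: measurable_rect_kernel_comp. Qed.

Lemma integral_box (A B : set R) : measurable A -> measurable B ->
  (\int[plane]_p (\1_A p.1 * \1_B p.2)%:E = leb A * leb B)%E.
Proof.
move=> mA mB; rewrite -(product_measure1E leb leb mA mB).
rewrite -(setIT (A `*` B)) -integral_indic//; last exact: measurableX.
apply: eq_integral => p _; rewrite !indicE -natrM mulnb; congr ((_%:R)%:E); congr nat_of_bool.
by apply/andP/idP; rewrite !inE.
Qed.

Lemma lebesgue_oc a b : a <= b -> leb `]a, b]%classic = (b - a)%:E.
Proof.
move=> ab; rewrite lebesgue_measure_itv/= lte_fin.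
by case: ltgtP ab => // -> _; rewrite subrr.
Qed.

(** Two kernels differ only on the two strips between their rectangles, of areas at most
    T (s' - s) and T (t' - t). *)
Lemma rect_kernel_lipschitz T : 0 <= T -> exists2 C, 0 <= C & forall s s' t t',
  0 <= s -> s <= s' -> s' <= T -> 0 <= t -> t <= t' -> t' <= T ->
  (sqint plane (fun p => rect_kernel s' t' p - rect_kernel s t p)%R <= (C * ((s' - s) + (t' - t)))%:E)%E.
Proof.
move=> T0; have [M M0 kM] := kapM T; exists (M ^+ 2 * T) => [|s s' t t' s0 ss s'T t0 tt t'T].
  by rewrite mulr_ge0// exprn_ge0.
have mI a b : measurable (`]a, b]%classic : set R) by exact: measurable_itv.
have mJ a b : measurable (`[a, b]%classic : set R) by exact: measurable_itv.
have ioc a b u : \1_`]a, b]%classic u = (a < u <= b)%R%:R :> R.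
  rewrite indicE; congr (_%:R); congr nat_of_bool.
  by apply/idP/idP; rewrite inE/= in_itv.
have n0 (A B : set R) p : (0 <= (\1_A p.1 * \1_B p.2 : R)%:E)%E.
  by rewrite lee_fin mulr_ge0 // !indicE.
have mb (A B : set R) : measurable A -> measurable B ->
    measurable_fun setT (fun p : R * R => (\1_A p.1 * \1_B p.2 : R)%:E).
  move=> mA mB; apply/measurable_EFinP; apply: measurable_funM.
    by apply: (measurableT_comp (measurable_indic mA)).
  by apply: (measurableT_comp (measurable_indic mB)).
pose b1 p : \bar R := (\1_`]s, s']%classic p.1 * \1_`[0, T]%classic p.2)%:E.
pose b2 p : \bar R := (\1_`[0, T]%classic p.1 * \1_`]t, t']%classic p.2)%:E.
apply: (@le_trans _ _ (\int[plane]_p ((M ^+ 2)%:E * (b1 p + b2 p)))%E).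
  apply: ge0_le_integral => //.
  - by move=> p _; rewrite lee_fin sqr_ge0.
  - by apply: measurable_sqr; apply: measurable_funB; exact: measurable_rect_kernel.
  - by apply: measurable_funeM; apply: emeasurable_funD; exact: mb.
  move=> p _; rewrite /b1 /b2 -EFinD -EFinM lee_fin !rect_kernelE !ioc !indic_cc -!natrM !mulnb -natrD.
  rewrite -mulrBl exprMn mulrC.
  case: (boolP ((0 <= p.1 <= s') && (0 <= p.2 <= t'))) => h'; last first.
    rewrite (_ : (_ && _) = false).
      by rewrite subrr expr0n mulr0 mulr_ge0// sqr_ge0.
    apply/negP => /andP[/andP[h1 h2] /andP[h3 h4]].
    by move: h'; rewrite h1 h3 (le_trans h2 ss) (le_trans h4 tt).
  have /andP[/andP[h1 h2] /andP[h3 h4]] := h'.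
  have kp : kap p <= M by apply: kM; [rewrite h1 (le_trans h2)|rewrite h3 (le_trans h4)].
  have kp2 : kap p ^+ 2 <= M ^+ 2 by rewrite ler_pXn2r// nnegrE.
  rewrite h1 h2 h3 h4 (le_trans h2 s'T) (le_trans h4 t'T) /= !andbT !ltNge.
  by case: (p.1 <= s); case: (p.2 <= t); rewrite /= ?subrr ?subr0 ?expr0n ?expr1n ?mulr0 ?mulr1 ?mulr_ge0 ?sqr_ge0//
    mulr_natr mulr2n ler_wpDl ?sqr_ge0.
rewrite ge0_integralZl_EFin//; last 3 first.
- by move=> p _; rewrite adde_ge0// n0.
- by apply: emeasurable_funD; exact: mb.
- exact: sqr_ge0.
rewrite ge0_integralD//; [|by move=> p _; exact: n0|exact: mb|by move=> p _; exact: n0|exact: mb].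
have B1 : (\int[plane]_p b1 p = ((s' - s) * T)%:E)%E.
  by rewrite integral_box// lebesgue_oc// lebesgue_cc// subr0.
have B2 : (\int[plane]_p b2 p = (T * (t' - t))%:E)%E.
  by rewrite integral_box// lebesgue_oc// lebesgue_cc// subr0.
rewrite [X in (_ * (X + _))%E]B1 [X in (_ * (_ + X))%E]B2 -EFinD -EFinM lee_fin.
by rewrite le_eqVlt; apply/orP; left; apply/eqP; ring.
Qed.

Lemma rect_kernel_square_integrable s t : square_integrable (rect_kernel s t).
Proof.
split; first exact: measurable_rect_kernel.
pose T := Num.max 0 (Num.max s t).
have T0 : 0 <= T by rewrite le_max lexx.
have [C _ H] := rect_kernel_lipschitz T0.
have m0 : measurable_fun setT (fun _ : R * R => 0 : R) by [].
have E0 p : rect_kernel 0 0 p <= rect_kernel T T p by exact: rect_kernel_le.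
have z1 p : (rect_kernel s t p) ^+ 2 <= 1 * (rect_kernel T T p) ^+ 2.
  rewrite mul1r ler_pXn2r// ?nnegrE ?rect_kernel_ge0// rect_kernel_le// /T !le_max lexx ?orbT//.
apply: (le_lt_trans (sqint_le plane ler01 (measurable_rect_kernel s t) (measurable_rect_kernel T T) z1)).
rewrite mul1e; have [M M0 kM] := kapM T.
apply: (@le_lt_trans _ _ ((M ^+ 2)%:E * \int[plane]_p (\1_`[0, T]%classic p.1 * \1_`[0, T]%classic p.2)%:E)%E).
  have mJ a b : measurable (`[a, b]%classic : set R) by exact: measurable_itv.
  have mb : measurable_fun setT (fun p : R * R => (\1_`[0, T]%classic p.1 * \1_`[0, T]%classic p.2 : R)%:E).
    apply/measurable_EFinP; apply: measurable_funM.
      by apply: (measurableT_comp (measurable_indic (mJ 0 T))).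
    by apply: (measurableT_comp (measurable_indic (mJ 0 T))).
  rewrite -ge0_integralZl_EFin//; last exact: sqr_ge0.
  apply: ge0_le_integral => //.
  - by move=> p _; rewrite lee_fin sqr_ge0.
  - by apply: measurable_sqr; exact: measurable_rect_kernel.
  - exact: measurable_funeM.
  move=> p _; rewrite -EFinM lee_fin rect_kernelE !indic_cc -!natrM !mulnb.
  case: (boolP (_ && _)) => h; last by rewrite mul0r expr0n mulr0.
  have /andP[h1 h2] := h; rewrite mul1r mulr1 ler_pXn2r ?nnegrE//; exact: kM.
by rewrite integral_box// !lebesgue_cc// -!EFinM ltry.
Qed.

Lemma Rintegral_step a b u0 : a <= b ->
  \int[leb]_(u in `[a, b]) ((u0 <= u)%R%:R : R) = Num.max 0 (b - Num.max a u0).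
Proof.
move=> ab; have mI : measurable (`[u0, +oo[%classic : set R) by exact: measurable_itv.
have -> : \int[leb]_(u in `[a, b]) ((u0 <= u)%R%:R : R) =
    \int[leb]_(u in `[a, b]) \1_`[u0, +oo[%classic u.
  apply: eq_Rintegral => u _; rewrite indicE; congr (_%:R); congr nat_of_bool.
  by apply/idP/idP; rewrite inE/= in_itv/= andbT.
rewrite /Rintegral integral_indic//.
rewrite (_ : _ `&` _ = `[Num.max a u0, b]%classic); last first.
  apply/seteqP; split=> u /=; rewrite !in_itv/= andbT ge_max.
    by move=> [-> /andP[-> ->]].
  by move=> /andP[/andP[-> ->] ->].
have [h|h] := leP (Num.max a u0) b.
  by rewrite [X in fine X](lebesgue_cc h)/=; apply/esym/max_idPr; rewrite subr_ge0.
rewrite set_itv_ge ?measure0/=; last by rewrite bnd_simp -ltNge.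
by apply/esym/max_idPl; rewrite subr_le0 ltW.
Qed.

(** At the point (x, y) the first integral counts the dates u in [max(s, y), t], the second the
    dates in [max(x, y), s]: together, the length of [max(x, y), t]. The clamping by 0 makes the
    integrands measurable functions of all real u. *)
Lemma Rintegral_rect_kernel s t p : 0 <= s -> s <= t ->
  \int[leb]_(u in `[s, t]) rect_kernel s (Num.max 0 u) p +
  \int[leb]_(u in `[0, s]) rect_kernel (Num.max 0 u) (Num.max 0 u) p = weighted_kernel s t p.
Proof.
move=> s0 st; have t0 := le_trans s0 st.
pose c1 : R := ((0 <= p.1 <= s) && (0 <= p.2))%:R * kap p.
pose c2 : R := ((0 <= p.1) && (0 <= p.2))%:R * kap p.
have E1 : \int[leb]_(u in `[s, t]) rect_kernel s (Num.max 0 u) p =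
    \int[leb]_(u in `[s, t]) (c1 * (p.2 <= u)%R%:R).
  apply: eq_Rintegral => u; rewrite inE/= in_itv/= => /andP[su _].
  rewrite (max_idPr (le_trans s0 su)) rect_kernelE /c1 mulrAC -natrM mulnb.
  by rewrite andbA.
have E2 : \int[leb]_(u in `[0, s]) rect_kernel (Num.max 0 u) (Num.max 0 u) p =
    \int[leb]_(u in `[0, s]) (c2 * (Num.max p.1 p.2 <= u)%R%:R).
  apply: eq_Rintegral => u; rewrite inE/= in_itv/= => /andP[u0 _].
  rewrite (max_idPr u0) rect_kernelE /c2 mulrAC -natrM mulnb ge_max.
  by congr (_%:R * _); congr nat_of_bool; rewrite andbACA.
have istep a b u0 : a <= b ->
    leb.-integrable `[a, b]%classic (EFin \o (fun u => (u0 <= u)%R%:R : R)).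
  move=> ab; apply: (integrable_on_le _ _ _ (pathint_cst a b 1)) => //.
    have mI : measurable (`[u0, +oo[%classic : set R) by exact: measurable_itv.
    rewrite (_ : (fun u => _) = \1_`[u0, +oo[%classic); first exact: measurable_indic.
    apply/funext => u; rewrite indicE; congr (_%:R); congr nat_of_bool.
    by apply/idP/idP; rewrite inE/= in_itv/= andbT.
  by move=> u _; rewrite ger0_norm// lern1 leq_b1.
rewrite E1 E2 !RintegralZl//; [|exact: istep..].
rewrite !Rintegral_step// /weighted_kernel rect_kernelE /c1 /c2 {E1 E2 c1 c2}.
move: p => [x y] /=; rewrite -!mulrA.
have [x0|x0] := leP 0 x; last by rewrite !mul0r addr0.
have [y0|y0] := leP 0 y; last by rewrite !andbF !mul0r addr0.
rewrite /= !andbT mul1r.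
have -> : Num.max 0 (Num.max x y) = Num.max x y by apply/max_idPr; rewrite le_max x0.
have [xs|sx] := leP x s => /=; last first.
  rewrite !mul0r add0r (max_idPl _) ?mulr0// subr_le0 le_max (ltW sx)//.
rewrite mul1r -mulrDr.
have [yt|ty] := leP y t; last first.
  rewrite mul0r (max_idPl _); last by rewrite subr_le0 le_max (ltW ty) orbT.
  rewrite (max_idPl _); first by rewrite addr0 mulr0.
  by rewrite subr_le0 le_max (le_trans st (ltW ty)) orbT.
rewrite mul1r; congr (_ * _).
have -> : Num.max 0 (t - Num.max s y) = t - Num.max s y.
  by apply/max_idPr; rewrite subr_ge0 ge_max st.
have [ys|sy] := leP y s.
  have -> : Num.max 0 (s - Num.max x y) = s - Num.max x y.
    by apply/max_idPr; rewrite subr_ge0 ge_max xs.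
  by rewrite addrA subrK.
rewrite (max_idPl _); last by rewrite subr_le0 le_max (ltW sy) orbT.
by rewrite addr0 (max_idPr (le_trans xs (ltW sy))).
Qed.

Lemma weighted_kernelE s t p : weighted_kernel s t p =
  ((0 <= p.1 <= s) && (0 <= p.2 <= t))%:R * (kap p * (t - Num.max p.1 p.2)).
Proof. by rewrite /weighted_kernel rect_kernelE mulrA. Qed.

Lemma measurable_weighted_kernel s t : measurable_fun setT (weighted_kernel s t).
Proof.
apply: measurable_funM; first exact: measurable_rect_kernel.
by apply: measurable_funB => //; exact: measurable_maxr.
Qed.

Lemma weighted_kernel_ge0 s t p : s <= t -> 0 <= weighted_kernel s t p.
Proof.
move=> st; rewrite weighted_kernelE; case: (boolP (_ && _)); last by rewrite mul0r.
move=> /andP[/andP[_ xs] /andP[_ yt]].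
by rewrite mul1r mulr_ge0// subr_ge0 ge_max yt (le_trans xs).
Qed.

Lemma weighted_kernel_square_integrable s t : s <= t -> square_integrable (weighted_kernel s t).
Proof.
move=> st; have [mk koo] := rect_kernel_square_integrable s t.
split; first exact: measurable_weighted_kernel.
have z p : weighted_kernel s t p ^+ 2 <= t ^+ 2 * rect_kernel s t p ^+ 2.
  rewrite /weighted_kernel rect_kernelE.
  case: (boolP (_ && _)); last by rewrite !mul0r expr0n mulr0.
  move=> /andP[/andP[x0 xs] /andP[y0 yt]].
  rewrite exprMn mulrC ler_wpM2r ?sqr_ge0// ler_pXn2r// ?nnegrE.
  - by rewrite gerBl le_max x0.
  - by rewrite subr_ge0 ge_max yt (le_trans xs).
  - exact: le_trans y0 yt.
apply: (le_lt_trans (sqint_le plane (sqr_ge0 t) (measurable_weighted_kernel s t) mk z)).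
by rewrite lte_mul_pinfty// lee_fin sqr_ge0.
Qed.

Lemma weighted_kernel_off s t p : ~ p.1 <= s -> weighted_kernel s t p = 0.
Proof. by move=> /negP h; rewrite weighted_kernelE (negPf h) andbF mul0r. Qed.

(** Raising the observation date from r to s adds to the kernel of the discount factor the
    noise on the strip r < x <= s only. *)
Lemma weighted_kernel_strip r s t p : r <= s -> s <= t ->
  0 <= weighted_kernel s t p - weighted_kernel r t p /\
  (p.1 <= r -> weighted_kernel s t p - weighted_kernel r t p = 0).
Proof.
move=> rs st; have w0 := weighted_kernel_ge0 p st.
have [xr|rx] := leP p.1 r; last first.
  by rewrite (@weighted_kernel_off r) ?subr0//; apply/negP; rewrite -ltNge.
have -> : weighted_kernel r t p = weighted_kernel s t p.
  by rewrite !weighted_kernelE xr (le_trans xr rs).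
by rewrite subrr.
Qed.

Lemma weighted_kernel_leS s t p : s <= t ->
  0 <= weighted_kernel s t p - weighted_kernel s s p.
Proof.
move=> st; rewrite subr_ge0 weighted_kernelE.
case: (boolP (_ && _)); last by rewrite mul0r weighted_kernel_ge0.
move=> /andP[/andP[x0 xs] /andP[y0 ys]].
by rewrite weighted_kernelE x0 xs y0 (le_trans ys st) !mul1r ler_wpM2l// lerD2r.
Qed.

End rect_kernel.

(** * The deterministic rates along paths *)

Section clamped_continuity.
Context {R : realType} (mu : R -> R -> R).
Hypothesis mu_cont : {within [set p : R * R | 0 <= p.1 <= p.2],
                  continuous (fun p => mu p.1 p.2)}.
Implicit Types s t a b u : R.
Local Notation leb := (@lebesgue_measure R).

(** Precomposing with a continuous map into the triangle turns continuity within the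
    triangle into continuity on the line; the maps used are the clamped ones u |-> (s, max(s, u))
    and u |-> (max(0, u), max(0, u)). *)
Lemma continuous_comp_within (g : R -> R * R) : continuous g ->
  (forall u, 0 <= (g u).1 <= (g u).2) -> continuous (fun u => mu (g u).1 (g u).2).
Proof.
move=> cg gA u; have H := iffLR (subspace_continuousP _ _) mu_cont (g u) (gA u).
have W : g v @[v --> u] --> within [set p : R * R | 0 <= p.1 <= p.2] (nbhs (g u)).
  move=> Q nQ; have nQ' : nbhs (g u) [set p | 0 <= p.1 <= p.2 -> Q p] := nQ.
  have N : nbhs u (g @^-1` [set p | 0 <= p.1 <= p.2 -> Q p]) := cg u _ nQ'.
  have N' : nbhs u (g @^-1` Q) by apply: filterS N => v h; exact: (h (gA v)).
  exact: N'.
exact: (cvg_comp g (fun p => mu p.1 p.2) W H).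
Qed.

Lemma max_continuous (k : R) : continuous (fun u : R => Num.max k u).
Proof. by move=> u; apply: (@continuous_max _ _ (cst k) id); [exact: cst_continuous|exact: cvg_id]. Qed.

Lemma mu_clamped_continuous s : 0 <= s -> continuous (fun u => mu s (Num.max s u)).
Proof.
move=> s0; apply: (@continuous_comp_within (fun u => (s, Num.max s u))).
  by move=> u; exact: (cvg_pair (cvg_cst s) (@max_continuous s u)).
by move=> u /=; rewrite s0 le_max lexx.
Qed.

Lemma mu_diag_continuous : continuous (fun u => mu (Num.max 0 u) (Num.max 0 u)).
Proof.
apply: (@continuous_comp_within (fun u => (Num.max 0 u, Num.max 0 u))).
  by move=> u; exact: (cvg_pair (@max_continuous 0 u) (@max_continuous 0 u)).
by move=> u /=; rewrite le_max !lexx.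
Qed.

Lemma continuous_pathint a b (f g : R -> R) : continuous g ->
  (forall u, a <= u <= b -> f u = g u) -> leb.-integrable `[a, b]%classic (EFin \o f).
Proof.
move=> cg fg; have ig : leb.-integrable `[a, b]%classic (EFin \o g).
  apply: continuous_compact_integrable; first exact: segment_compact.
  exact: continuous_subspaceT.
apply: eq_integrable ig => // u; rewrite inE/= in_itv/= => h.
by rewrite /= fg.
Qed.

Lemma pathint_mu s t : 0 <= s -> leb.-integrable `[s, t]%classic (EFin \o mu s).
Proof.
move=> s0; apply: (continuous_pathint (mu_clamped_continuous s0)) => u /andP[su _].
by rewrite (max_idPr su).
Qed.

Lemma pathint_mu_diag s t : 0 <= s ->
  leb.-integrable `[s, t]%classic (EFin \o (fun u => mu u u)).
Proof.
move=> s0; apply: (continuous_pathint mu_diag_continuous) => u /andP[su _].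
by rewrite (max_idPr (le_trans s0 su)).
Qed.

End clamped_continuity.

(** * The random part of the discount factor *)

Section levy_field.
Context {R : realType} (sigma : {measure set R -> \bar R}).
Variable fin : finite_second_moment sigma.
Context (nu : probability (Dprime R) R).
Hypothesis nuL : is_levy_noise sigma nu.
Variable kap : R * R -> R.
Hypothesis mkap : measurable_fun setT kap.
Hypothesis kap0 : forall p, 0 <= kap p.
Hypothesis kapM : forall T : R, exists2 M : R, 0 <= M &
  forall p : R * R, 0 <= p.1 <= T -> 0 <= p.2 <= T -> kap p <= M.
Variable X : R -> R -> Dprime R -> R.
Hypothesis mX : measurable_fun setT
  (fun q : (R * R) * Dprime R => X (Num.max 0 q.1.1) (Num.max 0 q.1.2) q.2).
Hypothesis pX : forall s t : R, 0 <= s -> 0 <= t -> is_pairing nu (rect_kernel kap s t) (X s t).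
Implicit Types (s t r u a b T : R) (p : R * R) (om : Dprime R).
Local Notation plane := (@plane_measure R).
Local Notation leb := (@lebesgue_measure R).
Local Notation wk := (weighted_kernel kap).

(** The increment of X is the pairing with the increment of the kernel, and a pairing is bounded
    in L^2 by its kernel. *)
Lemma field_lipschitz T : 0 <= T -> exists2 C : R, 0 <= C & forall s s' t t' : R,
  0 <= s -> s <= s' -> s' <= T -> 0 <= t -> t <= t' -> t' <= T ->
  (sqint plane (fun p => rect_kernel kap s' t' p - rect_kernel kap s t p)%R <=
     (C * ((s' - s) + (t' - t)))%:E)%E /\
  (sqint nu (fun om => X s' t' om - X s t om)%R <= (C * ((s' - s) + (t' - t)))%:E)%E.
Proof.
move=> T0; have [C C0 H] := rect_kernel_lipschitz mkap kap0 kapM T0.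
pose k := 2 * fine (second_moment sigma).
have k0 : 0 <= k by rewrite mulr_ge0// fine_ge0// second_moment_ge0.
exists ((1 + k) * C) => [|s s' t t' s0 ss s'T t0 tt t'T]; first by rewrite mulr_ge0// addr_ge0.
have Hs := H _ _ _ _ s0 ss s'T t0 tt t'T.
have d0 : 0 <= (s' - s) + (t' - t) by rewrite addr_ge0// subr_ge0.
have L : ((C * (s' - s + (t' - t)))%:E <= ((1 + k) * C * (s' - s + (t' - t)))%:E)%E.
  by rewrite lee_fin -mulrA ler_peMl ?mulr_ge0// lerDl.
split; first exact: le_trans L.
have [s'0 t'0] := (le_trans s0 ss, le_trans t0 tt).
have mk := measurable_rect_kernel mkap.
have pd : is_pairing nu (fun p => rect_kernel kap s' t' p - rect_kernel kap s t p)
    (fun om => X s' t' om - X s t om).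
  have := is_pairing_lin (-1) (mk s t) (mk s' t') (pX s0 t0) (pX s'0 t'0).
  by under eq_fun do rewrite mulN1r addrC; under [X in is_pairing _ _ X]eq_fun do rewrite mulN1r addrC.
have md : measurable_fun setT (fun p => rect_kernel kap s' t' p - rect_kernel kap s t p).
  by apply: measurable_funB; exact: mk.
have doo := le_lt_trans Hs (ltry _).
have [_ B] := pairing_sqr_le fin nuL md doo pd.
apply: (le_trans B); rewrite -/k.
apply: (@le_trans _ _ (k%:E * (C * (s' - s + (t' - t)))%:E)%E).
  by apply: lee_wpmul2l => //; rewrite lee_fin.
by rewrite -EFinM lee_fin mulrDl mul1r mulrDl -mulrA lerDr mulr_ge0.
Qed.

Let mX_comp d (S : measurableType d) (a b : S -> R) (h : S -> Dprime R) :
  measurable_fun setT a -> measurable_fun setT b -> measurable_fun setT h ->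
  measurable_fun setT (fun q => X (Num.max 0 (a q)) (Num.max 0 (b q)) (h q)).
Proof.
move=> ma mb mh.
have mab : measurable_fun setT (fun q => ((a q, b q), h q)).
  apply: measurable_fun_pair => //; exact: measurable_fun_pair.
exact: (measurableT_comp mX mab).
Qed.

Let row s om u := X s (Num.max 0 u) om.
Let diag om u := X (Num.max 0 u) (Num.max 0 u) om.
Let row_kernel s p u := rect_kernel kap s (Num.max 0 u) p.
Let diag_kernel p u := rect_kernel kap (Num.max 0 u) (Num.max 0 u) p.

Let mrow s : 0 <= s -> measurable_fun setT (fun q : Dprime R * R => row s q.1 q.2).
Proof.
move=> s0; rewrite /row -(max_idPr s0).
by apply: (@mX_comp _ _ (fun=> s) snd fst).
Qed.

Let mdiag : measurable_fun setT (fun q : Dprime R * R => diag q.1 q.2).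
Proof. by apply: (@mX_comp _ _ snd snd fst). Qed.

Let mrow_kernel s : measurable_fun setT (fun q : (R * R) * R => row_kernel s q.1 q.2).
Proof. by apply: (measurable_rect_kernel_comp mkap) => //; apply: measurable_maxr. Qed.

Let mdiag_kernel : measurable_fun setT (fun q : (R * R) * R => diag_kernel q.1 q.2).
Proof. by apply: (measurable_rect_kernel_comp mkap) => //; apply: measurable_maxr. Qed.

Let row_lipschitz s t : 0 <= s -> s <= t -> exists2 C : R, 0 <= C & forall u v : R,
  s <= u -> u <= v -> v <= t ->
  (sqint plane (fun p => row_kernel s p v - row_kernel s p u)%R <= (C * (v - u))%:E)%E /\
  (sqint nu (fun om => row s om v - row s om u)%R <= (C * (v - u))%:E)%E.
Proof.
move=> s0 st; have t0 := le_trans s0 st; have [C C0 H] := field_lipschitz t0.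
exists C => // u v su uv vt; have u0 := le_trans s0 su; have v0 := le_trans u0 uv.
have := H s s u v s0 (lexx s) st u0 uv vt.
by rewrite subrr add0r /row_kernel /row (max_idPr u0) (max_idPr v0).
Qed.

Let diag_lipschitz t : 0 <= t -> exists2 C : R, 0 <= C & forall u v : R,
  0 <= u -> u <= v -> v <= t ->
  (sqint plane (fun p => diag_kernel p v - diag_kernel p u)%R <= (C * (v - u))%:E)%E /\
  (sqint nu (fun om => diag om v - diag om u)%R <= (C * (v - u))%:E)%E.
Proof.
move=> t0; have [C C0 H] := field_lipschitz t0.
exists (2 * C) => [|u v u0 uv vt]; first by rewrite mulr_ge0.
have v0 := le_trans u0 uv; have := H u v u v u0 uv vt u0 uv vt.
rewrite (_ : C * (v - u + (v - u)) = 2 * C * (v - u)); last by ring.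
by rewrite /diag_kernel /diag (max_idPr u0) (max_idPr v0).
Qed.

Let rowE s t om : 0 <= s -> s <= t ->
  \int[leb]_(u in `[s, t]) X s u om = \int[leb]_(u in `[s, t]) row s om u.
Proof.
move=> s0 st; apply: eq_Rintegral => u; rewrite inE/= in_itv/= => /andP[su _].
by rewrite /row (max_idPr (le_trans s0 su)).
Qed.

Let diagE s t om : 0 <= s ->
  \int[leb]_(u in `[s, t]) X u u om = \int[leb]_(u in `[s, t]) diag om u.
Proof.
move=> s0; apply: eq_Rintegral => u; rewrite inE/= in_itv/= => /andP[su _].
by rewrite /diag (max_idPr (le_trans s0 su)).
Qed.

(** Minus the logarithm of the discounted bond price, without its deterministic part. *)
Definition discounting s t om :=
  \int[leb]_(u in `[s, t]) X s u om + \int[leb]_(u in `[0, s]) X u u om.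

(** Averaging commutes with the pairing along u |-> (s, u) and along the diagonal; the
    averaged kernels add up to the weighted one. *)
Lemma discounting_pairing s t : 0 <= s -> s <= t -> is_pairing nu (wk s t) (discounting s t).
Proof.
move=> s0 st; have t0 := le_trans s0 st.
have [C1 C10 H1] := row_lipschitz s0 st; have [C2 C20 H2] := diag_lipschitz s0.
have P1 := average_pairing (@mrow_kernel s) (mrow s0) C10
  (fun u v h1 h2 h3 => (H1 u v h1 h2 h3).1) (fun u v h1 h2 h3 => (H1 u v h1 h2 h3).2) st.
have P2 := average_pairing mdiag_kernel mdiag C20
  (fun u v h1 h2 h3 => (H2 u v h1 h2 h3).1) (fun u v h1 h2 h3 => (H2 u v h1 h2 h3).2) s0.
have Q1 : forall u, s <= u <= t -> is_pairing nu (row_kernel s ^~ u) (row s ^~ u).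
  by move=> u _; apply: pX => //; rewrite le_max lexx.
have Q2 : forall u, 0 <= u <= s -> is_pairing nu (diag_kernel ^~ u) (diag ^~ u).
  by move=> u _; apply: pX; rewrite le_max lexx.
have := is_pairing_lin 1 (measurable_Rintegral_path (@mrow_kernel s) s t)
  (measurable_Rintegral_path mdiag_kernel 0 s) (P1 Q1) (P2 Q2).
congr (is_pairing nu _ _); apply/funext => x; rewrite mul1r.
  exact: Rintegral_rect_kernel.
by rewrite /discounting rowE// diagE.
Qed.

Lemma discounting_adapted gens s t : 0 <= s -> s <= t -> complete nu gens ->
  (forall u v, 0 <= u <= s -> u <= v -> adapted <<s gens >> (X u v)) ->
  adapted <<s gens >> (discounting s t).
Proof.
move=> s0 st Gc aX; have t0 := le_trans s0 st.
have [C1 C10 H1] := row_lipschitz s0 st; have [C2 C20 H2] := diag_lipschitz s0.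
have P1 := average_adapted (mrow s0) C10 (fun u v h1 h2 h3 => (H1 u v h1 h2 h3).2) st Gc.
have P2 := average_adapted mdiag C20 (fun u v h1 h2 h3 => (H2 u v h1 h2 h3).2) s0 Gc.
have Q1 : forall u, s <= u <= t -> adapted <<s gens >> (row s ^~ u).
  by move=> u /andP[su _]; apply: aX; [rewrite s0 lexx|rewrite le_max su orbT].
have Q2 : forall u, 0 <= u <= s -> adapted <<s gens >> (diag ^~ u).
  by move=> u /andP[u0 us]; apply: aX; rewrite ?lexx// le_max lexx/= ge_max s0.
have := adapted_lin 1 (P1 Q1) (P2 Q2).
congr (adapted _ _); apply/funext => x; rewrite mul1r.
by rewrite /discounting rowE// diagE.
Qed.

Lemma row_pathint s t : 0 <= s -> s <= t ->
  {ae nu, forall om, leb.-integrable `[s, t]%classic (EFin \o (fun u => X s u om))}.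
Proof.
move=> s0 st; have [C1 C10 H1] := row_lipschitz s0 st.
have := pathint_ae (mrow s0) C10 (fun u v h1 h2 h3 => (H1 u v h1 h2 h3).2) (lexx s) st (lexx t).
apply: filterS => om; apply: eq_integrable => // u; rewrite inE/= in_itv/= => /andP[su _].
by rewrite /row/= (max_idPr (le_trans s0 su)).
Qed.

Lemma diag_pathint t : 0 <= t ->
  {ae nu, forall om, leb.-integrable `[0, t]%classic (EFin \o (fun u => X u u om))}.
Proof.
move=> t0; have [C1 C10 H1] := diag_lipschitz t0.
have := pathint_ae mdiag C10 (fun u v h1 h2 h3 => (H1 u v h1 h2 h3).2) (lexx 0) t0 (lexx t).
apply: filterS => om; apply: eq_integrable => // u; rewrite inE/= in_itv/= => /andP[u0 _].
by rewrite /diag/= (max_idPr u0).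
Qed.

Lemma measurable_row_shift (g : R -> R) s t : 0 <= s -> s <= t -> measurable_fun setT g ->
  measurable_fun setT (fun om => \int[leb]_(u in `[s, t]) (g u + X s u om)).
Proof.
move=> s0 st mg.
rewrite (_ : (fun om => _) = (fun om => \int[leb]_(u in `[s, t]) (g u + row s om u))).
  apply: (@measurable_Rintegral_path _ _ _ (fun om u => g u + row s om u)).
  apply: measurable_funD; last exact: mrow.
  exact: (measurableT_comp mg (@measurable_snd _ _ (Dprime R) R)).
apply/funext => om; apply: eq_Rintegral => u; rewrite inE/= in_itv/= => /andP[su _].
by rewrite /row (max_idPr (le_trans s0 su)).
Qed.

Lemma measurable_diag_shift (g : R -> R) s t : 0 <= s -> measurable_fun setT g ->
  measurable_fun setT (fun om => \int[leb]_(u in `[s, t]) (g u + X u u om)).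
Proof.
move=> s0 mg.
rewrite (_ : (fun om => _) = (fun om => \int[leb]_(u in `[s, t]) (g u + diag om u))).
  apply: (@measurable_Rintegral_path _ _ _ (fun om u => g u + diag om u)).
  apply: measurable_funD; last exact: mdiag.
  exact: (measurableT_comp mg (@measurable_snd _ _ (Dprime R) R)).
apply/funext => om; apply: eq_Rintegral => u; rewrite inE/= in_itv/= => /andP[su _].
by rewrite /diag (max_idPr (le_trans s0 su)).
Qed.

End levy_field.

(** * Forward rates and conditional expectations *)

Section almost_everywhere.
Context d (T : measurableType d) (R : realType) (P : probability T R).
Implicit Types (U V : T -> R) (A : set T).

Lemma Rintegral_ae U V A : measurable A -> measurable_fun setT U -> measurable_fun setT V ->
  U = V %[ae P] -> \int[P]_(x in A) U x = \int[P]_(x in A) V x.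
Proof.
move=> mA mU mV UV; rewrite /Rintegral; congr fine; apply: ae_eq_integral => //.
- by apply/measurable_EFinP; exact: measurable_funTS.
- by apply/measurable_EFinP; exact: measurable_funTS.
- by apply: filterS UV => x h _; rewrite /= h.
Qed.

Lemma intble_ae U V : measurable_fun setT V -> U = V %[ae P] -> intble P U -> intble P V.
Proof.
move=> mV UV iU; have mU := intble_measurable iU.
apply/integrableP; split; first exact/measurable_EFinP.
have /integrableP[_ h] := iU; apply: le_lt_trans h.
rewrite le_eqVlt; apply/orP; left; apply/eqP; apply: ae_eq_integral => //.
- by apply: measurableT_comp => //; exact/measurable_EFinP.
- by apply: measurableT_comp => //; exact/measurable_EFinP.
- by apply: filterS UV => x h _; rewrite /= h.
Qed.

End almost_everywhere.

Section forward_rates.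
Context {R : realType} (sigma : {measure set R -> \bar R}).
Variable fin : finite_second_moment sigma.
Context (nu : probability (Dprime R) R).
Hypothesis nuL : is_levy_noise sigma nu.
Variable kap : R * R -> R.
Hypothesis mkap : measurable_fun setT kap.
Hypothesis kap0 : forall p, 0 <= kap p.
Hypothesis kapM : forall T : R, exists2 M : R, 0 <= M &
  forall p : R * R, 0 <= p.1 <= T -> 0 <= p.2 <= T -> kap p <= M.
Variable X : R -> R -> Dprime R -> R.
Hypothesis mX : measurable_fun setT
  (fun q : (R * R) * Dprime R => X (Num.max 0 q.1.1) (Num.max 0 q.1.2) q.2).
Hypothesis pX : forall s t : R, 0 <= s -> 0 <= t -> is_pairing nu (rect_kernel kap s t) (X s t).
Variable mu : R -> R -> R.
Hypothesis mu_cont : {within [set p : R * R | 0 <= p.1 <= p.2],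
                  continuous (fun p => mu p.1 p.2)}.
Implicit Types (s t r u v : R) (p : R * R) (om : Dprime R).
Local Notation leb := (@lebesgue_measure R).
Local Notation wk := (weighted_kernel kap).
Local Notation W := (discounting X).
Local Notation F := (forward_rate mu X).

Definition information_events s : set (set (Dprime R)) :=
  [set A | exists (u v : R) (Y : Dprime R -> R) (B : set R),
         [/\ 0 <= u <= s, u <= v, measurable_fun setT Y, Y = F u v %[ae nu]
           & measurable B /\ A = Y @^-1` B]].

Lemma information_measurable s A : information nu F s A -> measurable A.
Proof.
move: A; apply: smallest_sub; first exact: sigma_algebra_measurable.
move=> _ [u [v [Y [B [_ _ mY _ [mB ->]]]]]].
by rewrite -[X in measurable X]setTI; exact: mY.
Qed.

Lemma measurable_field s t : 0 <= s -> 0 <= t -> measurable_fun setT (X s t).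
Proof. by move=> s0 t0; have [] := pX s0 t0. Qed.

Lemma measurable_forward_rate s t : 0 <= s -> 0 <= t -> measurable_fun setT (F s t).
Proof. by move=> s0 t0; apply: measurable_funD => //; exact: measurable_field. Qed.

(** The region whose noise is known at time r. *)
Definition past r : set (R * R) := [set p | p.1 <= r].

(** Every version of F u v with u <= s is, up to the constant mu u v, a pairing with a kernel
    carried by x <= s. *)
Lemma information_trig s : 0 <= s -> information nu F s `<=` trig_sets (noise_on nu (past s)).
Proof.
move=> s0; apply: trig_sets_smallest; first exact: noise_on_linear.
move=> _ [u [v [Y [B [/andP[u0 us] uv mY YF [mB ->]]]]]].
have v0 := le_trans u0 uv.
pose Z om := Y om - mu u v.
have mZ : measurable_fun setT Z by exact: measurable_funB.
have -> : Y @^-1` B = Z @^-1` ((fun y => y + mu u v) @^-1` B).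
  by apply/seteqP; split=> om; rewrite /= /Z subrK.
apply: trig_sets_preimage; first exact: noise_on_linear.
- exists (rect_kernel kap u v); split.
  + exact: (rect_kernel_square_integrable mkap kap0 kapM).
  + move=> p /negP; rewrite -ltNge => sp; rewrite rect_kernelE.
    by rewrite (leNgt p.1 u) (le_lt_trans us sp) andbF mul0r.
  + apply: is_pairing_ae mZ _ (pX u0 v0); apply: filterS YF => om /(_ I) h _.
    by rewrite /Z h /forward_rate addrC addKr.
- rewrite -[X in measurable X]setTI.
  have : measurable_fun setT (fun y : R => y + mu u v) by exact: measurable_funD.
  by move=> /(_ measurableT); apply.
Qed.

(** The information contains all versions of the rate F 0 0, in particular those modified on
    a null event N; two of these tell N apart. *)
Lemma information_complete s : 0 <= s -> complete nu (information_events s).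
Proof.
move=> s0 N mN N0.
have mF : measurable_fun setT (F 0 0) by exact: measurable_forward_rate.
(* the version of F 0 0 that takes the value k on N *)
pose Y (k : R) om := \1_N om * k + \1_(~` N) om * F 0 0 om.
have mY k : measurable_fun setT (Y k).
  apply: measurable_funD; apply: measurable_funM => //.
  by apply: measurable_indic; exact: measurableC.
have GY k B : measurable B -> <<s information_events s >> (Y k @^-1` B).
  move=> mB; apply: sub_sigma_algebra; exists 0, 0, (Y k), B; split=> //.
    by rewrite lexx.
  exists N; split=> // om /= h; apply: contrapT => Nom; apply: h => _.
  by rewrite /Y !indicE memNset// mem_set// mul0r add0r mul1r.
have -> : N = (Y 0 @^-1` [set 0]) `&` (Y 1 @^-1` [set 1]).
  apply/seteqP; split=> om /=.
    by move=> Nom; rewrite /Y !indicE mem_set// memNset/= ?mul0r ?mul1r ?addr0//; apply.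
  move=> [h0 h1]; apply: contrapT => Nom; move: h0 h1.
  rewrite /Y !indicE memNset// mem_set// !mul0r !add0r !mul1r => -> /eqP.
  by rewrite eq_sym oner_eq0.
have mG A : <<s information_events s >> A <->
  measurable (A : set (g_sigma_algebraType (information_events s))) by [].
by apply/mG; apply: measurableI; apply/mG; apply: GY; exact: measurable_set1.
Qed.

Lemma field_adapted s u v : 0 <= s -> 0 <= u <= s -> u <= v ->
  adapted <<s information_events s >> (X u v).
Proof.
move=> s0 us uv; have /andP[u0 _] := us; have v0 := le_trans u0 uv.
have aF : adapted <<s information_events s >> (F u v).
  move=> B mB; apply: sub_sigma_algebra; exists u, v, (F u v), B; split=> //.
    exact: measurable_forward_rate.
  exact: aeW.
have := adapted_lin 1 aF (adapted_cst (gens := information_events s) (- mu u v)).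
by under [X in adapted _ X]eq_fun do rewrite mul1r /forward_rate addrC addKr.
Qed.

Lemma discounting_information s t : 0 <= s -> s <= t ->
  adapted <<s information_events s >> (W s t).
Proof.
move=> s0 st; apply: (discounting_adapted fin nuL mkap kap0 kapM mX pX s0 st).
  exact: information_complete.
by move=> u v; exact: field_adapted.
Qed.

(** Over an event known at time r, the factor exp(- Y') integrates to its expectation; so U
    and V have the same integrals exactly when the constants agree. The whole space already
    decides, because E exp(- Y) > 0. *)
Lemma conditional_expectation_criterion r f f' Y Y' (U V : Dprime R -> R) (c e : R) :
  0 <= r ->
  square_integrable f -> (forall p, 0 <= f p) -> (forall p, ~ past r p -> f p = 0) ->
  is_pairing nu f Y -> adapted <<s information_events r >> Y ->
  square_integrable f' -> (forall p, 0 <= f' p) -> (forall p, past r p -> f' p = 0) ->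
  is_pairing nu f' Y' ->
  measurable_fun setT U -> (fun om => c * expR (- (Y om + Y' om))) = U %[ae nu] ->
  measurable_fun setT V -> (fun om => e * expR (- Y om)) = V %[ae nu] ->
  is_cond_exp nu (information nu F r) U V <-> c * expR (levy_laplace fin f') = e.
Proof.
move=> r0 sf f0 fD fY aY sf' f'0 f'D fY' mU UE mV VE.
have mY := fY.1; have mY' := fY'.1.
have sp : square_integrable (fun p => f p + f' p).
  have := square_integrable_lin 1 sf sf'.
  by under eq_fun do rewrite mul1r.
have pp : is_pairing nu (fun p => f p + f' p) (fun om => Y om + Y' om).
  have := is_pairing_lin 1 sf.1 sf'.1 fY fY'.
  by under eq_fun do rewrite mul1r; under [X in is_pairing _ _ X]eq_fun do rewrite mul1r.
have iYY := pairing_exp_integrable fin nuL sp.1 sp.2 (fun p => addr_ge0 (f0 p) (f'0 p)) pp.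
have iY := pairing_exp_integrable fin nuL sf.1 sf.2 f0 fY.
have iU0 := intbleZ c iYY; have iV0 := intbleZ e iY.
have iU := intble_ae mU UE iU0; have iV := intble_ae mV VE iV0.
have IU A : information nu F r A -> \int[nu]_(om in A) U om =
    c * expR (levy_laplace fin f') * \int[nu]_(om in A) expR (- Y om).
  move=> GA; have mA := information_measurable GA.
  rewrite -(Rintegral_ae mA (intble_measurable iU0) mU UE).
  rewrite RintegralZl//; last exact: integrableS iYY.
  rewrite (conditional_laplace fin nuL (D := past r) (D' := ~` past r) (f := f) (f' := f'))//.
  - by rewrite mulrA.
  - exact: information_trig.
  - by move=> p /contrapT; exact: f'D.
have IV A : information nu F r A -> \int[nu]_(om in A) V om =
    e * \int[nu]_(om in A) expR (- Y om).
  move=> GA; have mA := information_measurable GA.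
  rewrite -(Rintegral_ae mA (intble_measurable iV0) mV VE).
  by rewrite RintegralZl//; exact: integrableS iY.
have GT : information nu F r setT.
  have mG A : information nu F r A <->
    measurable (A : set (g_sigma_algebraType (information_events r))) by [].
  exact/mG.
split=> [[_ _ _ /(_ _ GT)]|ce].
  rewrite IU// IV// (pairing_laplace fin nuL sf.1 sf.2 f0 fY) => H.
  by apply/esym; apply: (mulIf (lt0r_neq0 (expR_gt0 (levy_laplace fin f)))).
split=> //; last by move=> A GA; rewrite IU// IV// ce.
apply: (@adapted_ae _ _ _ nu _ (fun om => e * expR (- Y om))) => //.
  exact: information_complete.
apply: (adapted_comp (h := fun y => e * expR (- y))) => //.
by apply: measurable_funM => //; apply: measurableT_comp => //; exact: measurableT_comp.
Qed.

(** The deterministic part of minus the logarithm of the discounted bond price. *)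
Definition mean_discounting s t :=
  \int[leb]_(u in `[s, t]) mu s u + \int[leb]_(u in `[0, s]) mu u u.

Lemma int_forward_rate s t : 0 <= s -> s <= t ->
  {ae nu, forall om, \int[leb]_(u in `[s, t]) F s u om =
    \int[leb]_(u in `[s, t]) mu s u + \int[leb]_(u in `[s, t]) X s u om}.
Proof.
move=> s0 st; have := row_pathint fin nuL mkap kap0 kapM mX pX s0 st.
by apply: filterS => om ip; rewrite -RintegralD//; exact: pathint_mu.
Qed.

Lemma int_spot_rate_ae s t : 0 <= s -> s <= t ->
  {ae nu, forall om, int_spot_rate F s t om =
    \int[leb]_(u in `[s, t]) mu u u + (\int[leb]_(u in `[0, t]) X u u om -
      \int[leb]_(u in `[0, s]) X u u om)}.
Proof.
move=> s0 st; have t0 := le_trans s0 st.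
have := diag_pathint fin nuL mkap kap0 kapM mX pX t0.
apply: filterS => om ip; rewrite /int_spot_rate /spot_rate /forward_rate.
rewrite RintegralD//; [|exact: pathint_mu_diag|exact: pathint_sub s0 (lexx t) ip].
by rewrite (Rintegral_glue s0 st ip) addrAC subrr add0r.
Qed.

Lemma measurable_bond_price s t : 0 <= s -> s <= t -> measurable_fun setT (bond_price F s t).
Proof.
move=> s0 st; apply: measurableT_comp => //; apply: measurableT_comp => //.
have := measurable_row_shift mX s0 st
  (continuous_measurable_fun (mu_clamped_continuous mu_cont s0)).
congr measurable_fun; apply/funext => om; apply: eq_Rintegral => u.
by rewrite inE/= in_itv/= => /andP[su _]; rewrite (max_idPr su).
Qed.

Lemma measurable_int_spot_rate s t : 0 <= s -> measurable_fun setT (int_spot_rate F s t).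
Proof.
move=> s0; have := measurable_diag_shift mX t s0
  (continuous_measurable_fun (mu_diag_continuous mu_cont)).
congr measurable_fun; apply/funext => om; apply: eq_Rintegral => u.
by rewrite inE/= in_itv/= => /andP[su _]; rewrite (max_idPr (le_trans s0 su)).
Qed.

Lemma bond_priceE s t : 0 <= s -> s <= t ->
  (fun om => expR (- \int[leb]_(u in `[s, t]) mu s u) * expR (- (W s t om - W s s om))) =
  bond_price F s t %[ae nu].
Proof.
move=> s0 st; apply: filterS (int_forward_rate s0 st) => om E _.
rewrite /bond_price E -expRD; congr expR; rewrite /discounting.
by rewrite !set_itv1 !Rintegral_set1; ring.
Qed.

Lemma discounted_bond_priceE s t : 0 <= s -> s <= t ->
  (fun om => expR (- mean_discounting s t) * expR (- W s t om)) =
  discounted_bond_price F s t %[ae nu].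
Proof.
move=> s0 st; apply: filterS2 (int_forward_rate s0 st) (int_spot_rate_ae (lexx 0) s0) => om E1 E2 _.
rewrite /discounted_bond_price /bond_price E1 E2 -!expRD; congr expR.
rewrite /mean_discounting /discounting.
by rewrite !set_itv1 !Rintegral_set1; ring.
Qed.

(** The random part W t t - W s s of the integrated spot rate is split at the date s: the first
    summand W s t - W s s, from the noise on x <= s, is also the random part of minus the
    logarithm of the bond price; the second one comes from the strip s < x <= t. *)
Lemma exp_int_spot_rateE s t : 0 <= s -> s <= t ->
  (fun om => expR (- \int[leb]_(u in `[s, t]) mu u u) *
     expR (- ((W s t om - W s s om) + (W t t om - W s t om)))) =
  (fun om => expR (- int_spot_rate F s t om)) %[ae nu].
Proof.
move=> s0 st; apply: filterS (int_spot_rate_ae s0 st) => om E _.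
rewrite E -expRD; congr expR; rewrite /discounting !set_itv1 !Rintegral_set1.
by ring.
Qed.

Lemma mean_discounting_diag s t : 0 <= s -> s <= t ->
  \int[leb]_(u in `[s, t]) mu u u = mean_discounting t t - mean_discounting s s.
Proof.
move=> s0 st; rewrite /mean_discounting !set_itv1 !Rintegral_set1 !add0r.
rewrite (Rintegral_glue s0 st (pathint_mu_diag mu_cont t (lexx 0))); ring.
Qed.

(** The logarithm of the expected discounted bond price. *)
Definition log_mean s t := levy_laplace fin (wk s t) - mean_discounting s t.

Let swk := weighted_kernel_square_integrable mkap kap0 kapM.
Let wk0 s t p : s <= t -> 0 <= wk s t p. Proof. exact: weighted_kernel_ge0. Qed.

Lemma square_integrableB f g : square_integrable f -> square_integrable g ->
  square_integrable (fun p : R * R => f p - g p : R).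
Proof.
move=> sf sg; have := square_integrable_lin (-1) sg sf.
by under eq_fun do rewrite mulN1r addrC.
Qed.

Lemma is_pairingB f g Y Z : square_integrable f -> square_integrable g ->
  is_pairing nu f Y -> is_pairing nu g Z ->
  is_pairing nu (fun p => f p - g p) (fun om => Y om - Z om).
Proof.
move=> [mf _] [mg _] fY gZ; have := is_pairing_lin (-1) mg mf gZ fY.
by under eq_fun do rewrite mulN1r addrC; under [X in is_pairing _ _ X]eq_fun do rewrite mulN1r addrC.
Qed.

Lemma levy_laplace_strip r s t : 0 <= r -> r <= s -> s <= t ->
  levy_laplace fin (fun p => wk s t p - wk r t p) =
  levy_laplace fin (wk s t) - levy_laplace fin (wk r t).
Proof.
move=> r0 rs st; have rt := le_trans rs st.
have strip p := weighted_kernel_strip kap0 p rs st.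
have := @levy_laplaceD _ _ fin (wk r t) (fun p => wk s t p - wk r t p) (swk rt)
  (square_integrableB (swk st) (swk rt)) (fun p => wk0 p rt) (fun p => (strip p).1).
have -> : (fun p => wk r t p + (wk s t p - wk r t p)) = wk s t.
  by apply/funext => p; rewrite addrC subrK.
move=> ->; first by rewrite addrC addKr.
move=> p; have [pr|pr] := leP p.1 r; first by rewrite (strip p).2// mulr0.
by rewrite weighted_kernel_off ?mul0r//; apply/negP; rewrite -ltNge.
Qed.

(** The criterion with W r t for the known part and W s t - W r t for the independent one; by
    additivity the Laplace exponent of the latter is the difference of the exponents. *)
Lemma discounted_bond_price_cond_exp r s t : 0 <= r -> r <= s -> s <= t ->
  is_cond_exp nu (information nu F r) (discounted_bond_price F s t)
    (discounted_bond_price F r t) <-> log_mean s t = log_mean r t.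
Proof.
move=> r0 rs st; have rt := le_trans rs st; have s0 := le_trans r0 rs.
have pW a b (a0 : 0 <= a) (ab : a <= b) := discounting_pairing fin nuL mkap kap0 kapM mX pX a0 ab.
have strip p := weighted_kernel_strip kap0 p rs st.
have mZ a b : 0 <= a -> a <= b -> measurable_fun setT (discounted_bond_price F a b).
  move=> a0 ab; apply: measurable_funM; first exact: measurable_bond_price.
  by apply: measurableT_comp => //; apply: measurableT_comp => //; exact: measurable_int_spot_rate.
have E : (fun om => expR (- mean_discounting s t) * expR (- (W r t om + (W s t om - W r t om)))) =
    discounted_bond_price F s t %[ae nu].
  apply: filterS (discounted_bond_priceE s0 st) => om.
  by rewrite [W r t om + _]addrC subrK.
have C := conditional_expectation_criterion r0 (swk rt) (fun p => wk0 p rt)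
  (fun p => @weighted_kernel_off _ kap r t p) (pW _ _ r0 rt) (discounting_information r0 rt)
  (square_integrableB (swk st) (swk rt)) (fun p => (strip p).1) (fun p => (strip p).2)
  (is_pairingB (swk st) (swk rt) (pW _ _ s0 st) (pW _ _ r0 rt))
  (mZ _ _ s0 st) E (mZ _ _ r0 rt) (discounted_bond_priceE r0 rt).
rewrite C -expRD levy_laplace_strip// /log_mean {C}.
move: (levy_laplace _ _) (levy_laplace _ _) (mean_discounting _ _) (mean_discounting _ _) => *.
by split=> [/expR_inj|] ?; [|congr expR]; lra.
Qed.

Lemma bond_price_cond_exp s t : 0 <= s -> s <= t ->
  is_cond_exp nu (information nu F s) (fun om => expR (- int_spot_rate F s t om))
    (bond_price F s t) <-> log_mean t t = log_mean s t.
Proof.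
move=> s0 st; have t0 := le_trans s0 st.
have pW a b (a0 : 0 <= a) (ab : a <= b) := discounting_pairing fin nuL mkap kap0 kapM mX pX a0 ab.
have strip p := weighted_kernel_strip kap0 p st (lexx t).
have aW : adapted <<s information_events s >> (fun om => W s t om - W s s om).
  have := adapted_lin (-1) (discounting_information s0 (lexx s)) (discounting_information s0 st).
  by under eq_fun do rewrite mulN1r addrC.
have mS : measurable_fun setT (fun om => expR (- int_spot_rate F s t om)).
  by apply: measurableT_comp => //; apply: measurableT_comp => //; exact: measurable_int_spot_rate.
have off p : ~ past s p -> wk s t p - wk s s p = 0.
  by move=> h; rewrite !weighted_kernel_off// subrr.
have C := conditional_expectation_criterion s0 (square_integrableB (swk st) (swk (lexx s)))
  (fun p => weighted_kernel_leS kap0 p st) off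
  (is_pairingB (swk st) (swk (lexx s)) (pW _ _ s0 st) (pW _ _ s0 (lexx s))) aW
  (square_integrableB (swk (lexx t)) (swk st)) (fun p => (strip p).1) (fun p => (strip p).2)
  (is_pairingB (swk (lexx t)) (swk st) (pW _ _ t0 (lexx t)) (pW _ _ s0 st))
  mS (exp_int_spot_rateE s0 st) (measurable_bond_price s0 st) (bond_priceE s0 st).
rewrite C -expRD levy_laplace_strip// mean_discounting_diag// /log_mean.
have -> : \int[leb]_(u in `[s, t]) mu s u = mean_discounting s t - mean_discounting s s.
  by rewrite /mean_discounting !set_itv1 !Rintegral_set1; ring.
move: {C} (levy_laplace _ _) (levy_laplace _ _) (mean_discounting _ _) (mean_discounting _ _)
  (mean_discounting _ _) => *.
by split=> [/expR_inj|] ?; [|congr expR]; lra.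
Qed.

Definition constant_mean := forall r s t, 0 <= r -> r <= s -> s <= t -> log_mean s t = log_mean r t.

Lemma martingale_constant_mean :
  (forall t : R, 0 <= t -> is_martingale nu [set s : R | 0 <= s <= t] (information nu F)
      (fun s => discounted_bond_price F s t)) <-> constant_mean.
Proof.
split=> [H r s t r0 rs st|H t t0].
  apply/(discounted_bond_price_cond_exp r0 rs st).
  have [_ _ M] := H t (le_trans r0 (le_trans rs st)).
  by apply: M => //=; rewrite ?r0 ?(le_trans r0 rs) ?(le_trans rs st).
have CE r s : 0 <= r -> r <= s -> s <= t -> is_cond_exp nu (information nu F r)
    (discounted_bond_price F s t) (discounted_bond_price F r t).
  by move=> r0 rs st; apply/discounted_bond_price_cond_exp => //; exact: H.
split=> [s /andP[s0 st]|s /andP[s0 st]|r s /andP[r0 _] /andP[_ st] rs].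
- by have [] := CE s s s0 (lexx s) st.
- by have [] := CE s s s0 (lexx s) st.
- exact: CE.
Qed.

(** The pricing formula compares each date s with the maturity t, and two dates are compared
    through it. *)
Lemma pricing_constant_mean :
  (forall s t : R, 0 <= s <= t -> is_cond_exp nu (information nu F s)
      (fun om => expR (- int_spot_rate F s t om)) (bond_price F s t)) <-> constant_mean.
Proof.
split=> [H r s t r0 rs st|H s t /andP[s0 st]]; last first.
  by apply/bond_price_cond_exp => //; exact: H.
have s0 := le_trans r0 rs; have rt := le_trans rs st.
transitivity (log_mean t t).
  by apply/esym; apply/(bond_price_cond_exp s0 st); apply: H; rewrite s0.
by apply/(bond_price_cond_exp r0 rt); apply: H; rewrite r0.
Qed.

End forward_rates.

(** * Functions with quadratic increments *)

Section quadratic_increments.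
Context {R : realType}.
Implicit Types (a b t u v C : R) (f g : R -> R).
Local Notation leb := (@lebesgue_measure R).

(** Halving the interval halves the bound C (b - a)^2 on the total increment. *)
Lemma quadratic_increment_constant f a0 b0 C : a0 <= b0 ->
  (forall a b, a0 <= a -> a <= b -> b <= b0 -> `|f b - f a| <= C * (b - a) ^+ 2) ->
  f b0 = f a0.
Proof.
move=> ab0 H.
have D n a b : a0 <= a -> a <= b -> b <= b0 -> `|f b - f a| <= C * (b - a) ^+ 2 / 2 ^+ n.
  elim: n a b => [|n IH] a b aa ab bb; first by rewrite expr0 divr1; exact: H.
  pose c := (a + b) / 2.
  have ac : a <= c by rewrite /c; lra.
  have cb : c <= b by rewrite /c; lra.
  have h1 := IH a c aa ac (le_trans cb bb).
  have h2 := IH c b (le_trans aa ac) cb bb.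
  rewrite (_ : f b - f a = (f b - f c) + (f c - f a)); last by ring.
  rewrite (le_trans (ler_normD _ _))// (le_trans (lerD h2 h1))//.
  rewrite le_eqVlt; apply/orP; left; apply/eqP; rewrite [2 ^+ n.+1]exprS /c.
  by field; rewrite expf_neq0.
apply/eqP; rewrite -subr_eq0 -normr_le0.
have cv : C * (b0 - a0) ^+ 2 / 2 ^+ n @[n --> \oo] --> (0 : R).
  rewrite -(mulr0 (C * (b0 - a0) ^+ 2)); apply: cvgM; first exact: cvg_cst.
  under eq_fun do rewrite -exprVn; apply: cvg_expr.
  by rewrite ger0_norm ?invr_ge0// invf_lt1// ltr1n.
apply: (cvgr_to_ge cv); apply: nearW => n; exact: D.
Qed.

Lemma lipschitz_continuous g C : (forall u v, `|g u - g v| <= C * `|u - v|) -> continuous g.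
Proof.
move=> H u; apply/cvgrPdist_le => e e0.
have C1 : 0 < `|C| + 1 by rewrite ltr_wpDl.
near=> v.
rewrite (le_trans (H u v))// (@le_trans _ _ ((`|C| + 1) * `|u - v|))//.
  by rewrite ler_wpM2r// (le_trans (ler_norm _))// lerDl.
rewrite -ler_pdivlMl// mulrC ltW//; near: v.
by apply: cvgr_dist_lt; rewrite ?divr_gt0//; exact: cvg_id.
Unshelve. all: by end_near. Qed.

Lemma clamp_mono a b u v : a <= b -> v <= u ->
  0 <= Num.max a (Num.min u b) - Num.max a (Num.min v b) <= u - v.
Proof.
move=> ab vu; rewrite /Num.max /Num.min.
by case: (ltP u b) => ?; case: (ltP v b) => ?; (do ?case: ltP => ?);
  apply/andP; split; lra.
Qed.

(** A fundamental theorem of calculus for functions known through a one-sided expansion with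
    quadratic remainder: f minus the integral of g has quadratic increments. *)
Lemma quadratic_increment_integral f g a0 b0 C : 0 <= C -> a0 <= b0 ->
  (forall a b, a0 <= a -> a <= b -> b <= b0 ->
     `|f b - f a - (b - a) * g a| <= C * (b - a) ^+ 2) ->
  (forall a b, a0 <= a -> a <= b -> b <= b0 -> `|g b - g a| <= C * (b - a)) ->
  leb.-integrable `[a0, b0]%classic (EFin \o g) /\
  \int[leb]_(u in `[a0, b0]) g u = f b0 - f a0.
Proof.
move=> C0 ab0 fg gl.
(* clamping to [a0, b0] extends g to a continuous function on the line *)
pose cl u := Num.max a0 (Num.min u b0).
have clI u : a0 <= cl u <= b0.
  by rewrite /cl le_max lexx ge_max ab0 ge_min lexx orbT.
have hl u v : `|g (cl u) - g (cl v)| <= C * `|u - v|.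
  wlog uv : u v / v <= u => [W|].
    by have [/W//|/ltW/W] := leP v u; rewrite distrC [`|v - u|]distrC.
  have /andP[] := clamp_mono ab0 uv; rewrite -/(cl u) -/(cl v) subr_ge0 => c1 c2.
  have /andP[v1 v2] := clI v; have /andP[u1 u2] := clI u.
  rewrite (le_trans (gl _ _ v1 c1 u2))// ler_wpM2l// (le_trans c2)//.
  exact: ler_norm.
have ig a b : a0 <= a -> b <= b0 -> leb.-integrable `[a, b]%classic (EFin \o g).
  move=> aa bb; apply: (continuous_pathint (lipschitz_continuous hl)) => u /andP[au ub].
  congr g; rewrite /cl (min_idPl (le_trans ub bb)).
  by apply/esym/max_idPr; exact: le_trans au.
split; first exact: ig.
pose p u := f u - \int[leb]_(v in `[a0, u]) g v.
suff : p b0 = p a0.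
  by rewrite /p set_itv1 Rintegral_set1 => H; lra.
apply: (quadratic_increment_constant (C := 2 * C)) => // a b aa ab bb.
have split_ab : \int[leb]_(v in `[a0, b]) g v =
    \int[leb]_(v in `[a0, a]) g v + \int[leb]_(v in `[a, b]) g v.
  by apply: Rintegral_glue => //; exact: ig.
have -> : p b - p a = (f b - f a - (b - a) * g a) - (\int[leb]_(v in `[a, b]) g v - (b - a) * g a).
  by rewrite /p split_ab; ring.
rewrite (le_trans (ler_normB _ _))//.
rewrite (_ : 2 * C * (b - a) ^+ 2 = C * (b - a) ^+ 2 + C * (b - a) ^+ 2); last by ring.
rewrite lerD//; first exact: fg.
have -> : \int[leb]_(v in `[a, b]) g v - (b - a) * g a = \int[leb]_(v in `[a, b]) (g v + - g a).
  rewrite RintegralD//; [|exact: ig|exact: pathint_cst].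
  by rewrite Rintegral_cc_cst//; ring.
have igg : leb.-integrable `[a, b]%classic (EFin \o (fun v => g v + - g a)).
  by apply: pathintD; [exact: ig|exact: pathint_cst].
rewrite (le_trans (le_normr_Rintegral _ igg))//.
apply: (@le_trans _ _ (\int[leb]_(v in `[a, b]) (C * (b - a)))).
  apply: le_Rintegral => //; [exact: integrable_norm igg|exact: pathint_cst|].
  move=> v /=; rewrite in_itv/= => /andP[av vb].
  rewrite (le_trans (gl _ _ aa av (le_trans vb bb)))// ler_wpM2l// lerD2r//.
by rewrite Rintegral_cc_cst// -mulrA -expr2.
Qed.

Lemma quadratic_integral_eq0 g t C : continuous g ->
  (forall b, t <= b -> b <= t + 1 -> `|\int[leb]_(u in `[t, b]) g u| <= C * (b - t) ^+ 2) ->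
  g t = 0.
Proof.
move=> cg H; apply: contrapT => /eqP gt0.
have n0 : 0 < `|g t| by rewrite normr_gt0.
have ig a b : leb.-integrable `[a, b]%classic (EFin \o g).
  exact: continuous_pathint cg _.
have [e /= e0 ge] : exists2 e : R, 0 < e & forall u, `|t - u| < e -> `|g t - g u| < `|g t| / 2.
  have n20 : 0 < `|g t| / 2 by rewrite divr_gt0.
  have /cvgrPdist_lt /(_ _ n20) /nbhs_ballP[e /= e0 be] := cg t.
  by exists e => // u tu; exact: be.
have K0 : 0 < `|C| + 1 by rewrite ltr_wpDl.
(* on [t, t + d] the integral of g is at least d |g t| / 2 in absolute value, whereas
   the hypothesis bounds it by d |g t| / 4 *)
pose d := Num.min (e / 2) (Num.min 1 (`|g t| / (4 * (`|C| + 1)))).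
have d0 : 0 < d by rewrite /d !lt_min !divr_gt0// ?ltr01 ?mulr_gt0.
have d1 : d <= 1 by rewrite /d !ge_min lexx orbT.
have de : d <= e / 2 by rewrite /d ge_min lexx.
have dC : (`|C| + 1) * d <= `|g t| / 4.
  rewrite -ler_pdivlMl// (le_trans (_ : d <= `|g t| / (4 * (`|C| + 1))))//.
    by rewrite /d !ge_min lexx !orbT.
  by rewrite le_eqVlt; apply/orP; left; apply/eqP; field; rewrite gt_eqF.
have td : t <= t + d by rewrite lerDl ltW.
have := H _ td; rewrite lerD2l => /(_ d1); set I := \int[leb]_(u in _) _ => HI.
have E : \int[leb]_(u in `[t, t + d]) (g u + - g t) = I - g t * d.
  rewrite RintegralD//; last exact: pathint_cst.
  by rewrite Rintegral_cc_cst// -/I; ring.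
have igg : leb.-integrable `[t, t + d]%classic (EFin \o (fun v => g v + - g t)).
  by apply: pathintD; [exact: ig|exact: pathint_cst].
have := le_normr_Rintegral _ igg; rewrite E => /(_ (measurable_itv _)).
have B : \int[leb]_(u in `[t, t + d]) `|g u + - g t| <= \int[leb]_(u in `[t, t + d]) (`|g t| / 2).
  apply: le_Rintegral => //; [exact: integrable_norm igg|exact: pathint_cst|].
  move=> u /=; rewrite in_itv/= => /andP[tu ud]; rewrite distrC ltW// ge//.
  by rewrite distrC ger0_norm ?subr_ge0// ltrBlDl (le_lt_trans ud)// ltrD2l; lra.
move=> /le_trans /(_ B); rewrite Rintegral_cc_cst//.
have tdd : t + d - t = d by ring.
rewrite tdd in HI *; move=> HJ.
have gd : `|g t| * d <= `|I| + `|I - g t * d|.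
  have {1}-> : `|g t| * d = `|I - (I - g t * d)|.
    by rewrite -[X in _ * X](gtr0_norm d0) -normrM; congr `|_|; ring.
  exact: ler_normB.
have CK : C * d ^+ 2 <= (`|C| + 1) * d * d.
  rewrite expr2 mulrA ler_wpM2r ?(ltW d0)// ler_wpM2r ?(ltW d0)// (le_trans (ler_norm _))//.
  by rewrite lerDl.
have dd : (`|C| + 1) * d * d <= `|g t| / 4 * d by rewrite ler_wpM2r// ltW.
have : `|g t| * d <= `|g t| / 4 * d + `|g t| / 2 * d by lra.
by rewrite -mulrDl ler_pM2r// => h; lra.
Qed.

End quadratic_increments.

(** * Derivatives of the Laplace exponent in the horizon *)

Section hinge.
Context {R : realType}.
Implicit Types (j w h a b x : R).

Definition laplace_exponent z : R := expR (- z) - 1 + z.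

Lemma measurable_laplace_exponent : measurable_fun setT laplace_exponent.
Proof.
rewrite /laplace_exponent; apply: measurable_funD => //; apply: measurable_funB => //.
by apply: measurableT_comp => //; exact: measurableT_comp.
Qed.

Lemma laplace_exponent_bound z : 0 <= z -> 0 <= laplace_exponent z <= z ^+ 2.
Proof. exact: expRN_sub_sqr. Qed.

Lemma one_sub_expR_bound (z : R) : 0 <= z -> 0 <= 1 - expR (- z) <= z.
Proof.
move=> z0; rewrite subr_ge0 -[leRHS]expR0 ler_expR oppr_le0 z0/=.
by have := expR_ge1Dx (- z); lra.
Qed.

(** As a function of the horizon b, the integrand exp(- j w) - 1 + j w with w = max(0, b - x) has
    derivative j (1 - exp(- j w)) and second derivative at most j^2; at the kink b = x the first
    derivative vanishes. *)
Lemma hinge_quadratic j x a b : 0 <= j -> a <= b ->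
  `|laplace_exponent (j * Num.max 0 (b - x)) - laplace_exponent (j * Num.max 0 (a - x)) -
    (b - a) * (j * (1 - expR (- (j * Num.max 0 (a - x)))))| <= (b - a) ^+ 2 * j ^+ 2.
Proof.
move=> j0 ab; have d0 : 0 <= b - a by rewrite subr_ge0.
have [ax|xa] := leP (a - x) 0.
  rewrite mulr0 oppr0 expR0 subrr !mulr0 subr0.
  have -> : laplace_exponent (0 : R) = 0 by rewrite /laplace_exponent oppr0 expR0; ring.
  have h0 : 0 <= Num.max 0 (b - x) by rewrite le_max lexx.
  rewrite subr0; have /andP[e0 e1] := laplace_exponent_bound (mulr_ge0 j0 h0).
  rewrite ger0_norm// (le_trans e1)// exprMn mulrC ler_wpM2r ?sqr_ge0//.
  by rewrite ler_pXn2r// ?nnegrE// ge_max d0/=; lra.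
have -> : Num.max 0 (b - x) = b - x by apply/max_idPr; lra.
set w := a - x; have -> : b - x = w + (b - a) by rewrite /w; ring.
move: (b - a) d0 => h h0.
have -> : laplace_exponent (j * (w + h)) - laplace_exponent (j * w) -
    h * (j * (1 - expR (- (j * w)))) = expR (- (j * w)) * laplace_exponent (j * h).
  by rewrite /laplace_exponent mulrDr opprD expRD; ring.
have /andP[e0 e1] := laplace_exponent_bound (mulr_ge0 j0 h0).
rewrite ger0_norm ?mulr_ge0 ?expR_ge0// -exprMn [h * j]mulrC.
rewrite (le_trans _ e1)// ler_piMl// -expR0 ler_expR oppr_le0 mulr_ge0// /w ltW//.
Qed.

Lemma hinge_lipschitz j x a b : 0 <= j -> a <= b ->
  `|j * (1 - expR (- (j * Num.max 0 (b - x)))) - j * (1 - expR (- (j * Num.max 0 (a - x))))|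
    <= (b - a) * j ^+ 2.
Proof.
move=> j0 ab.
set u := Num.max 0 (a - x); set v := Num.max 0 (b - x).
have u0 : 0 <= u by rewrite /u le_max lexx.
have [k0 k1] : 0 <= v - u /\ v - u <= b - a.
  by rewrite /u /v /Num.max; do ?case: ltP => ?; split; lra.
have [k vE] : exists k, v = u + k by exists (v - u); rewrite addrC subrK.
rewrite vE addrAC subrr add0r in k0 k1 *.
have -> : j * (1 - expR (- (j * (u + k)))) - j * (1 - expR (- (j * u))) =
    j * (expR (- (j * u)) * (1 - expR (- (j * k)))).
  by rewrite [j * (u + k)]mulrDr opprD expRD; ring.
have /andP[e0 e1] := one_sub_expR_bound (mulr_ge0 j0 k0).
rewrite ger0_norm ?mulr_ge0 ?expR_ge0//.
rewrite [leRHS](_ : _ = j * (j * (b - a))); last by ring.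
rewrite ler_wpM2l//; apply: (@le_trans _ _ (j * k)); last by rewrite ler_wpM2l.
by rewrite (le_trans _ e1)// ler_piMl// -expR0 ler_expR oppr_le0 mulr_ge0.
Qed.

End hinge.

Section levy_rates.
Context {R : realType} (sigma : {measure set R -> \bar R}).
Variable fin : finite_second_moment sigma.
Variable kap : R * R -> R.
Hypothesis mkap : measurable_fun setT kap.
Hypothesis kap0 : forall p, 0 <= kap p.
Hypothesis kapM : forall T : R, exists2 M : R, 0 <= M &
  forall p : R * R, 0 <= p.1 <= T -> 0 <= p.2 <= T -> kap p <= M.
Implicit Types (s t u a b T : R) (p : R * R) (q : R * R * R).
Local Notation plane := (@plane_measure R).
Local Notation leb := (@lebesgue_measure R).
Local Notation m := (levy_intensity fin).
Local Notation rect := (rect_kernel kap).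

(** The time left at the horizon u after both coordinates of p; clamped at 0, it makes the
    integrands defined and regular in u on the whole line. *)
Definition hinge u p : R := Num.max 0 (u - Num.max p.1 p.2).

Lemma hinge_ge0 u p : 0 <= hinge u p.
Proof. by rewrite /hinge le_max lexx. Qed.

Lemma measurable_hinge u : measurable_fun setT (fun q => hinge u q.1).
Proof.
apply: measurable_maxr => //; apply: measurable_funB => //.
by apply: measurable_maxr; apply: measurableT_comp => //; exact: measurable_fst.
Qed.

Section region.
(* k is a volatility dominated by that of the square [0, T]^2 wherever both coordinates are
   at most T; everywhere else the hinge at T vanishes *)
Variable k : R * R -> R.
Hypothesis mk : measurable_fun setT k.
Hypothesis k0 : forall p, 0 <= k p.
Hypothesis kr : forall T p, Num.max p.1 p.2 <= T -> k p <= rect T T p.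

Definition rate_exponent u := \int[m]_q laplace_exponent (jump k q * hinge u q.1).
Definition rate_drift u := \int[m]_q (jump k q * (1 - expR (- (jump k q * hinge u q.1)))).

Let j0 q : 0 <= jump k q. Proof. by rewrite mulr_ge0. Qed.
Let r0 T q : 0 <= jump (rect T T) q.
Proof. by rewrite mulr_ge0// rect_kernel_ge0. Qed.

Let dominated u T q : u <= T -> hinge u q.1 = 0 \/ jump k q <= jump (rect T T) q.
Proof.
move=> uT; have [h|h] := leP (u - Num.max q.1.1 q.1.2) 0.
  by left; exact/max_idPl.
by right; rewrite ler_wpM2l// kr//; move: h; rewrite subr_gt0 => /ltW/le_trans; apply.
Qed.

Let rect_hinge T q : 0 <= T -> jump (rect T T) q * hinge T q.1 <= T * jump (rect T T) q.
Proof.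
move=> T0; rewrite mulrC /jump rect_kernelE; case: (boolP (_ && _)); last first.
  by rewrite mul0r !mulr0.
move=> /andP[/andP[x0 _] _]; rewrite ler_wpM2r ?mulr_ge0//.
by rewrite /hinge ge_max T0 gerBl le_max x0.
Qed.

Let jump_hinge T q : 0 <= T -> 0 <= jump k q * hinge T q.1 <= T * jump (rect T T) q.
Proof.
move=> T0; rewrite mulr_ge0 ?hinge_ge0//=.
have [->|h] := dominated q (lexx T); first by rewrite mulr0 mulr_ge0.
by rewrite (le_trans _ (rect_hinge q T0))// ler_wpM2r// hinge_ge0.
Qed.

Let intble_rect T : intble m (fun q => jump (rect T T) q ^+ 2).
Proof.
have [mr roo] := rect_kernel_square_integrable mkap kap0 kapM T T.
exact: intble_jump_sqr.
Qed.

Let measurable_jump_hinge u : measurable_fun setT (fun q => jump k q * hinge u q.1).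
Proof. by apply: measurable_funM; [exact: measurable_jump|exact: measurable_hinge]. Qed.

Lemma measurable_rate_drift u :
  measurable_fun setT (fun q => jump k q * (1 - expR (- (jump k q * hinge u q.1)))).
Proof.
apply: measurable_funM; first exact: measurable_jump.
apply: measurable_funB => //; apply: measurableT_comp => //.
by apply: measurableT_comp => //; exact: measurable_jump_hinge.
Qed.

Lemma intble_rate_exponent u : 0 <= u ->
  intble m (fun q => laplace_exponent (jump k q * hinge u q.1)).
Proof.
move=> u0; apply: intble_le (intbleZ (u ^+ 2) (intble_rect u)) => [|q].
  exact: measurableT_comp measurable_laplace_exponent (measurable_jump_hinge u).
have /andP[h1 h2] := jump_hinge q u0; have /andP[e1 e2] := laplace_exponent_bound h1.
by rewrite ger0_norm// (le_trans e2)// -exprMn ler_pXn2r// ?nnegrE// mulr_ge0.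
Qed.

Lemma rate_drift_bound u q : 0 <= u ->
  0 <= jump k q * (1 - expR (- (jump k q * hinge u q.1))) <= u * jump (rect u u) q ^+ 2.
Proof.
move=> u0; have /andP[h1 h2] := jump_hinge q u0; have /andP[e1 e2] := one_sub_expR_bound h1.
rewrite mulr_ge0//=; have [->|h] := dominated q (lexx u).
  by rewrite mulr0 oppr0 expR0 subrr mulr0 mulr_ge0// sqr_ge0.
by rewrite expr2 mulrCA ler_pM// (le_trans e2).
Qed.

Lemma intble_rate_drift u : 0 <= u ->
  intble m (fun q => jump k q * (1 - expR (- (jump k q * hinge u q.1)))).
Proof.
move=> u0; apply: intble_le (intbleZ u (intble_rect u)) => [|q]; first exact: measurable_rate_drift.
by have /andP[h1 h2] := rate_drift_bound q u0; rewrite ger0_norm.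
Qed.

(** The pointwise estimates for one jump, integrated: the jumps of the square [0, b]^2 have
    finite second moment. *)
Lemma rate_drift_estimates a b : 0 <= a -> a <= b -> exists2 C, 0 <= C &
  (forall c e, a <= c -> c <= e -> e <= b ->
    `|rate_exponent e - rate_exponent c - (e - c) * rate_drift c| <= C * (e - c) ^+ 2) /\
  (forall c e, a <= c -> c <= e -> e <= b -> `|rate_drift e - rate_drift c| <= C * (e - c)).
Proof.
move=> a0 ab; have b0 := le_trans a0 ab.
have H (c e : R) q : a <= c -> c <= e -> e <= b -> (hinge e q.1 = 0 /\ hinge c q.1 = 0) \/
    jump k q ^+ 2 <= jump (rect b b) q ^+ 2.
  move=> ac ce eb; have [he|h] := dominated q eb; [left|by right; rewrite ler_pXn2r// nnegrE].
  split=> //; apply/eqP; rewrite eq_le hinge_ge0 andbT -he /hinge ge_max !le_max lexx/=.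
  by rewrite lerD2r ce orbT.
have i2 := intble_rect b.
exists (\int[m]_q (jump (rect b b) q ^+ 2)).
  by apply: Rintegral_ge0 => q _; exact: sqr_ge0.
split.
- move=> c e ac ce eb; have c0 := le_trans a0 ac; have e0 := le_trans c0 ce.
  rewrite /rate_exponent /rate_drift -RintegralZl//; last exact: intble_rate_drift.
  rewrite -RintegralB//; [|exact: intble_rate_exponent..].
  rewrite -RintegralB//; last 2 first.
  + by apply: intbleB; exact: intble_rate_exponent.
  + by apply: intbleZ; exact: intble_rate_drift.
  rewrite mulrC -RintegralZl//; apply: normr_Rintegral_le.
  + apply: (intble_measurable (mu := m)); apply: intbleB; last by apply: intbleZ; exact: intble_rate_drift.
    by apply: intbleB; exact: intble_rate_exponent.
  + exact: intbleZ.
  + move=> q; have [[-> ->]|h] := H c e q ac ce eb.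
      by rewrite !(mulr0, oppr0, expR0, subrr, normr0) mulr_ge0 ?sqr_ge0.
    by rewrite (le_trans (hinge_quadratic _ (j0 q) ce))// ler_wpM2l// sqr_ge0.
- move=> c e ac ce eb; have c0 := le_trans a0 ac; have e0 := le_trans c0 ce.
  rewrite /rate_drift -RintegralB//; [|exact: intble_rate_drift..].
  rewrite mulrC -RintegralZl//; apply: normr_Rintegral_le.
  + by apply: (intble_measurable (mu := m)); apply: intbleB; exact: intble_rate_drift.
  + exact: intbleZ.
  + move=> q; have [[-> ->]|h] := H c e q ac ce eb.
      by rewrite subrr normr0 mulr_ge0 ?sqr_ge0// subr_ge0.
    by rewrite (le_trans (hinge_lipschitz _ (j0 q) ce))// ler_wpM2l// subr_ge0.
Qed.

Lemma rate_drift_integral a b : 0 <= a -> a <= b ->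
  leb.-integrable `[a, b]%classic (EFin \o rate_drift) /\
  \int[leb]_(u in `[a, b]) rate_drift u = rate_exponent b - rate_exponent a.
Proof.
move=> a0 ab; have [C C0 [H1 H2]] := rate_drift_estimates a0 ab.
exact: quadratic_increment_integral C0 ab H1 H2.
Qed.

End region.

(** The volatility on the strip 0 <= x <= s of the quadrant: the upper bound of a rectangle
    is set to the coordinate itself, which makes it void. The kernel of W s t is the product of
    this volatility with the hinge at t. *)
Definition strip_kernel s p := rect s p.2 p.
(** On the diagonal s = t the hinge at s already restricts x to [0, s], so that the strip can
    be replaced by the whole quadrant, independently of s. *)
Definition quadrant_kernel p := rect p.1 p.2 p.

Lemma measurable_strip_kernel s : measurable_fun setT (strip_kernel s).
Proof. by apply: (measurable_rect_kernel_comp mkap). Qed.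

Lemma measurable_quadrant_kernel : measurable_fun setT quadrant_kernel.
Proof. by apply: (measurable_rect_kernel_comp mkap). Qed.

Lemma strip_kernel_le s T p : Num.max p.1 p.2 <= T -> strip_kernel s p <= rect T T p.
Proof.
rewrite ge_max => /andP[xT yT]; rewrite /strip_kernel !rect_kernelE ler_wpM2r// ler_nat.
by rewrite xT yT lexx !andbT; case: (0 <= p.1); case: (0 <= p.2); case: (_ <= s).
Qed.

Lemma quadrant_kernel_le T p : Num.max p.1 p.2 <= T -> quadrant_kernel p <= rect T T p.
Proof.
rewrite ge_max => /andP[xT yT]; rewrite /quadrant_kernel !rect_kernelE ler_wpM2r// ler_nat.
by rewrite xT yT !lexx.
Qed.

Definition rate s t := rate_drift (strip_kernel s) t.

Lemma weighted_kernel_strip_hinge s t p : s <= t ->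
  weighted_kernel kap s t p = strip_kernel s p * hinge t p.
Proof.
move=> st; rewrite /weighted_kernel /strip_kernel !rect_kernelE lexx andbT.
have [xs|_] := leP p.1 s; last by rewrite !andbF !mul0r.
rewrite !andbT; have [yt|ty] := leP p.2 t.
  rewrite andbT /hinge; congr (_ * _); apply/esym/max_idPr.
  by rewrite subr_ge0 ge_max yt (le_trans xs).
rewrite !andbF !mul0r /hinge (max_idPl _) ?mulr0// subr_le0 le_max (ltW ty) orbT//.
Qed.

Lemma quadrant_hinge s p : strip_kernel s p * hinge s p = quadrant_kernel p * hinge s p.
Proof.
rewrite /strip_kernel /quadrant_kernel !rect_kernelE !lexx !andbT.
have [xs|sx] := leP p.1 s; first by rewrite andbT.
by rewrite /hinge (max_idPl _) ?mulr0// subr_le0 le_max (ltW sx).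
Qed.

Lemma jumpM (f g : R * R -> R) q : jump (fun p => f p * g p) q = jump f q * g q.1.
Proof. by rewrite /jump mulrA. Qed.

Lemma levy_laplace_row s t : s <= t ->
  levy_laplace fin (weighted_kernel kap s t) = rate_exponent (strip_kernel s) t.
Proof.
move=> st; apply: eq_Rintegral => q _; rewrite /laplace_exponent -jumpM.
by congr (expR (- _) - 1 + _); rewrite /jump weighted_kernel_strip_hinge.
Qed.

(** The volatility no longer depends on s, so that the derivative along the diagonal is
    taken in the hinge only. *)
Lemma levy_laplace_diag s :
  levy_laplace fin (weighted_kernel kap s s) = rate_exponent quadrant_kernel s.
Proof.
rewrite levy_laplace_row//; apply: eq_Rintegral => q _.
by rewrite -!jumpM /jump quadrant_hinge.
Qed.

Lemma rate_diag s : rate s s = rate_drift quadrant_kernel s.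
Proof.
apply: eq_Rintegral => q _; rewrite -!jumpM /jump quadrant_hinge.
rewrite /hinge; have [sx|h] := leP (s - Num.max q.1.1 q.1.2) 0.
  by rewrite !mulr0 oppr0 expR0 subrr !mulr0.
congr (_ * _ * _); rewrite /strip_kernel /quadrant_kernel !rect_kernelE !lexx !andbT.
by move: h; rewrite subr_gt0 gt_max => /andP[/ltW -> _]; rewrite andbT.
Qed.

Let strip0 s p : 0 <= strip_kernel s p. Proof. exact: rect_kernel_ge0. Qed.

Lemma rate_integral s t : 0 <= s -> s <= t ->
  leb.-integrable `[s, t]%classic (EFin \o rate s) /\
  \int[leb]_(u in `[s, t]) rate s u =
    levy_laplace fin (weighted_kernel kap s t) - levy_laplace fin (weighted_kernel kap s s).
Proof.
move=> s0 st; rewrite !levy_laplace_row//.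
exact: (rate_drift_integral (measurable_strip_kernel s) (strip0 s) (@strip_kernel_le s) s0 st).
Qed.

Lemma levy_laplace_increment s t : 0 <= s -> s <= t -> exists C, forall b,
  t <= b -> b <= t + 1 ->
  `|levy_laplace fin (weighted_kernel kap s b) - levy_laplace fin (weighted_kernel kap s t) -
    (b - t) * rate s t| <= C * (b - t) ^+ 2.
Proof.
move=> s0 st; have t0 := le_trans s0 st; have t1 : t <= t + 1 by rewrite lerDl.
have [C _ [H _]] := rate_drift_estimates (measurable_strip_kernel s) (strip0 s)
  (@strip_kernel_le s) t0 t1.
exists C => b tb bt; rewrite !levy_laplace_row// ?(le_trans st)//.
exact: H.
Qed.

Lemma rate_diag_integral s : 0 <= s ->
  leb.-integrable `[0, s]%classic (EFin \o (fun u => rate u u)) /\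
  \int[leb]_(u in `[0, s]) rate u u = levy_laplace fin (weighted_kernel kap s s).
Proof.
move=> s0; under eq_Rintegral do rewrite rate_diag.
under [X in _.-integrable _ (_ \o X)]eq_fun do rewrite rate_diag.
have q0 p : 0 <= quadrant_kernel p by exact: rect_kernel_ge0.
have [h1 h2] := rate_drift_integral measurable_quadrant_kernel q0 quadrant_kernel_le (lexx 0) s0.
split=> //; rewrite h2 levy_laplace_diag [X in _ - X](_ : _ = 0) ?subr0//.
transitivity (\int[m]_q (0 : R)); last by rewrite /Rintegral integral0.
apply: eq_Rintegral => q _.
rewrite -jumpM /jump /quadrant_kernel rect_kernelE !lexx !andbT /hinge.
case: (boolP (_ && _)) => [/andP[x0 _]|_].
  by rewrite (max_idPl _) ?mulr0 /laplace_exponent ?oppr0 ?expR0 ?subrr ?addr0// sub0r oppr_le0 le_max x0.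
by rewrite !mul0r mulr0 /laplace_exponent oppr0 expR0 subrr addr0.
Qed.

End levy_rates.

(** * The drift condition *)

Section iterated_integral.
Context {R : realType} (sigma : {measure set R -> \bar R}).
Variable fin : finite_second_moment sigma.
Variable kap : R * R -> R.
Hypothesis mkap : measurable_fun setT kap.
Hypothesis kap0 : forall p, 0 <= kap p.
Hypothesis kapM : forall T : R, exists2 M : R, 0 <= M &
  forall p : R * R, 0 <= p.1 <= T -> 0 <= p.2 <= T -> kap p <= M.
Local Notation plane := (@plane_measure R).
Local Notation leb := (@lebesgue_measure R).
Local Notation m := (levy_intensity fin).
Local Notation rect := (rect_kernel kap).
Variables s t : R.
Hypotheses (s0 : 0 <= s) (st : s <= t).

Let t0 : 0 <= t. Proof. exact: le_trans st. Qed.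
Let k := strip_kernel kap s.
Let Q (q : R * R * R) := jump k q * (1 - expR (- (jump k q * hinge t q.1))).
Let H (p : R * R) := \int[levy_part fin]_tau Q (p, tau).

Let mQ : measurable_fun setT Q.
Proof. apply: measurable_rate_drift; exact: measurable_strip_kernel. Qed.

Let Q_bound q : 0 <= Q q <= t * jump (rect t t) q ^+ 2.
Proof.
have k0 p : 0 <= k p by exact: rect_kernel_ge0.
have kr T p : Num.max p.1 p.2 <= T -> k p <= rect T T p by exact: strip_kernel_le.
exact: rate_drift_bound.
Qed.

Let Q_ge0 q : (0 <= (Q q)%:E)%E. Proof. by rewrite lee_fin; case/andP: (Q_bound q). Qed.

Let mQE : measurable_fun setT (EFin \o Q). Proof. exact/measurable_EFinP. Qed.

Let sqr_levy : intble (levy_part fin) (fun tau : R => tau ^+ 2).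
Proof.
apply/integrableP; split; first by apply/measurable_EFinP; exact: measurable_funX.
under eq_integral do rewrite /= ger0_norm ?sqr_ge0//.
rewrite integral_levy_part//; last by apply/measurable_EFinP; exact: measurable_funX.
Qed.

Let mQp p : measurable_fun setT (fun tau : R => Q (p, tau)).
Proof. exact: (measurableT_comp mQ (measurable_pair1 p)). Qed.

Let Q_bound' p tau : `|Q (p, tau)| <= t * rect t t p ^+ 2 * tau ^+ 2.
Proof.
have /andP[h1 h2] := Q_bound (p, tau); rewrite ger0_norm// (le_trans h2)//.
by rewrite /jump/= exprMn real_normK ?num_real// mulrA mulrAC.
Qed.

Let intble_Q p : intble (levy_part fin) (fun tau => Q (p, tau)).
Proof.
apply: intble_le (intbleZ (t * rect t t p ^+ 2) sqr_levy) => [|tau]; first exact: mQp.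
exact: Q_bound'.
Qed.

Let HE p : ((H p)%:E = \int[levy_part fin]_tau (Q (p, tau))%:E)%E.
Proof. by rewrite intble_fineK. Qed.

Let S := \int[levy_part fin]_tau (tau ^+ 2).

Let S0 : 0 <= S. Proof. by apply: Rintegral_ge0 => tau _; exact: sqr_ge0. Qed.

Let H_bound p : `|H p| <= (t * S) * rect t t p ^+ 2.
Proof.
rewrite (le_trans (normr_Rintegral_le (mQp p) (intbleZ (t * rect t t p ^+ 2) sqr_levy) _))//.
by rewrite RintegralZl//; rewrite -/S le_eqVlt; apply/orP; left; apply/eqP; ring.
Qed.

Let mH : measurable_fun setT H.
Proof.
have mF : measurable_fun setT (fubini_F (levy_part fin) (EFin \o Q)).
  by apply: measurable_fun_fubini_tonelli_F; [exact: mQE|exact: Q_ge0].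
rewrite (_ : H = (fun p => fine (fubini_F (levy_part fin) (EFin \o Q) p)))//.
by apply: measurableT_comp => //; exact: mF.
Qed.

Let intble_H : intble plane H.
Proof.
have [mr roo] := rect_kernel_square_integrable mkap kap0 kapM t t.
have ii : intble plane (fun p => rect t t p ^+ 2) by exact: sqint_intble.
have iK : intble plane (fun p => t * S * rect t t p ^+ 2) by exact: intbleZ.
by apply: intble_le iK => [|p]; [exact: mH|exact: H_bound].
Qed.

Let Q0 p tau : ~ (0 <= p.1 <= s /\ 0 <= p.2 <= t) -> Q (p, tau) = 0.
Proof.
move=> h; rewrite /Q /k /jump/= /strip_kernel rect_kernelE lexx andbT.
case: (boolP (_ && _)) => [/andP[xs y0]|_]; last by rewrite mul0r mulr0 mul0r.
have ty : t <= p.2.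
  by rewrite leNgt; apply/negP => /ltW yt; apply: h; split=> //; rewrite y0.
by rewrite /hinge (max_idPl _) ?mulr0 ?oppr0 ?expR0 ?subrr ?mulr0// subr_le0 le_max ty orbT.
Qed.

Let H0 p : ~ (0 <= p.1 <= s /\ 0 <= p.2 <= t) -> H p = 0.
Proof.
by move=> h; rewrite /H /Rintegral integral0_eq// => tau _; rewrite Q0.
Qed.

Let row_restrict y : (fun x => H (x, y)) \_ `[0, s]%classic = (fun x => H (x, y)).
Proof.
apply/funext => x; rewrite patchE; case: ifPn => // /negP xs.
by rewrite H0// => -[/= h _]; apply: xs; rewrite inE/= in_itv.
Qed.

Let intble_row y : intble leb (fun x => H (x, y)).
Proof.
have mD : measurable (`[0, s]%classic : set R) by exact: measurable_itv.
have [M M0 kM] := kapM t.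
have i1 : leb.-integrable `[0, s]%classic (EFin \o (fun x => H (x, y))).
  have mHy : measurable_fun setT (fun x => H (x, y)).
    exact: (measurableT_comp mH (measurable_pair2 y)).
  apply: integrable_on_le (pathint_cst 0 s (t * S * M ^+ 2)).
  - exact: measurable_itv.
  - exact: measurable_funTS.
  move=> x _; rewrite (le_trans (H_bound _))// ler_wpM2l ?mulr_ge0//.
  rewrite ler_pXn2r// ?nnegrE// ?rect_kernel_ge0// rect_kernelE.
  by case: (boolP (_ && _)) => [/andP[h1 h2]|_]; rewrite ?mul0r// mul1r; exact: kM.
have i2 : leb.-integrable setT ((EFin \o (fun x => H (x, y))) \_ `[0, s]%classic).
  by apply: (iffLR (integrable_mkcond _ _)) i1; exact: measurable_itv.
by rewrite restrict_EFin row_restrict in i2.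
Qed.

(** Fubini, for a nonnegative integrand dominated by t times the square of the jumps of the
    square [0, t]^2. *)
Lemma rate_iterated :
  \int[leb]_(y in `[0, t]) \int[leb]_(x in `[0, s]) \int[sigma]_(tau in `]0, +oo[)
    (tau * kap (x, y) * (1 - expR (- (tau * kap (x, y) * (t - Num.max x y))))) =
  rate fin kap s t.
Proof.
transitivity (\int[leb]_(y in `[0, t]) \int[leb]_(x in `[0, s]) H (x, y)).
  apply: eq_Rintegral => y; rewrite inE/= in_itv/= => yt.
  apply: eq_Rintegral => x; rewrite inE/= in_itv/= => xs.
  rewrite /H /Rintegral integral_levy_part; last by apply/measurable_EFinP; exact: mQp.
  congr fine; apply: eq_integral => tau; rewrite inE/= in_itv/= andbT => tau0.
  have /andP[y0 y_t] := yt; have /andP[x0 x_s] := xs.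
  rewrite /Q /k /jump/= gtr0_norm// /strip_kernel rect_kernelE/= x0 x_s y0 lexx/= mul1r.
  rewrite /hinge/= (_ : Num.max 0 (t - Num.max x y) = t - Num.max x y)//.
  by apply/max_idPr; rewrite subr_ge0 ge_max y_t (le_trans x_s).
transitivity (\int[plane]_p H p); last first.
  rewrite /rate /rate_drift /Rintegral; congr fine.
  have iQ : intble m Q.
    have mk : measurable_fun setT k by exact: measurable_strip_kernel.
    have k0 p : 0 <= k p by exact: rect_kernel_ge0.
    have kr T p : Num.max p.1 p.2 <= T -> k p <= rect T T p by exact: strip_kernel_le.
    exact: (intble_rate_drift fin mkap kap0 kapM mk k0 kr t0).
  rewrite -[RHS](@integral12_prod_meas1 _ _ _ _ _ plane (levy_part fin) _ iQ).
  by apply: eq_integral => p _; rewrite HE.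
transitivity (\int[leb]_y \int[leb]_x H (x, y)).
  rewrite Rintegral_mkcond; apply: eq_Rintegral => y _; rewrite patchE; case: ifPn => [_|/negP yt].
    by rewrite Rintegral_mkcond row_restrict.
  rewrite /Rintegral integral0_eq// => x _; rewrite H0// => -[_ /= h].
  by apply: yt; rewrite inE/= in_itv.
rewrite /Rintegral; congr fine.
rewrite -[RHS](@integral21_prod_meas1 _ _ _ _ _ leb leb _ intble_H).
by apply: eq_integral => y _; exact: (intble_fineK (intble_row y)).
Qed.

End iterated_integral.

Section drift_condition.
Context {R : realType} (sigma : {measure set R -> \bar R}).
Variable fin : finite_second_moment sigma.
Variable kap : R * R -> R.
Hypothesis mkap : measurable_fun setT kap.
Hypothesis kap0 : forall p, 0 <= kap p.
Hypothesis kapM : forall T : R, exists2 M : R, 0 <= M &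
  forall p : R * R, 0 <= p.1 <= T -> 0 <= p.2 <= T -> kap p <= M.
Variable mu : R -> R -> R.
Hypothesis mu_cont : {within [set p : R * R | 0 <= p.1 <= p.2],
                  continuous (fun p => mu p.1 p.2)}.
Implicit Types s t u : R.
Local Notation leb := (@lebesgue_measure R).
Local Notation rate := (rate fin kap).
Local Notation Lam s t := (levy_laplace fin (weighted_kernel kap s t)).

(** The strip of width 0 is a null set. *)
Lemma rate0 t : 0 <= t -> rate 0 t = 0.
Proof.
move=> t0; rewrite -(rate_iterated fin mkap kap0 kapM (lexx 0) t0).
rewrite /Rintegral integral0_eq// => y _; congr EFin.
by rewrite set_itv1 integral_set1.
Qed.

Lemma levy_laplace_rate s t : 0 <= s -> s <= t ->
  Lam s t = \int[leb]_(u in `[s, t]) rate s u + \int[leb]_(u in `[0, s]) rate u u.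
Proof.
move=> s0 st; rewrite (rate_integral fin mkap kap0 kapM s0 st).2.
by rewrite (rate_diag_integral fin mkap kap0 kapM s0).2 subrK.
Qed.

Lemma levy_laplace0 t : 0 <= t -> Lam 0 t = 0.
Proof.
move=> t0; rewrite levy_laplace_rate// set_itv1 Rintegral_set1 addr0.
by rewrite /Rintegral integral0_eq// => u; rewrite /= in_itv/= => /andP[u0 _]; rewrite rate0.
Qed.

(** Given (b), the integrals of the rate in [log_mean] cancel and leave the integral of mu 0 over
    [0, t]. Conversely, the integral of mu s u - mu 0 u - rate s t over [t, b] is, by
    hypothesis, the remainder of the expansion of the Laplace exponent at t, of order
    (b - t)^2; as b tends to t the integrand vanishes at t. *)
Lemma constant_mean_drift : constant_mean fin kap mu <->
  (forall s t, 0 <= s <= t -> mu s t = mu 0 t + rate s t).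
Proof.
have i0 (a b : R) : 0 <= a -> leb.-integrable `[a, b]%classic (EFin \o mu 0).
  by move=> a0; apply: pathint_sub a0 (lexx b) _; exact: pathint_mu.
split=> [C s t /andP[s0 st]|B r s t r0 rs st]; last first.
  suff E u : 0 <= u -> u <= t -> log_mean fin kap mu u t = - \int[leb]_(v in `[0, t]) mu 0 v.
    by rewrite !E// ?(le_trans r0)// (le_trans rs).
  move=> u0 ut; have [i1 _] := rate_integral fin mkap kap0 kapM u0 ut.
  have [i2 _] := rate_diag_integral fin mkap kap0 kapM u0.
  rewrite /log_mean levy_laplace_rate// /mean_discounting.
  have -> : \int[leb]_(v in `[u, t]) mu u v =
      \int[leb]_(v in `[u, t]) mu 0 v + \int[leb]_(v in `[u, t]) rate u v.
    transitivity (\int[leb]_(v in `[u, t]) (mu 0 v + rate u v)).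
      by apply: eq_Rintegral => v; rewrite inE/= in_itv/= => /andP[uv _]; rewrite B// u0.
    exact: (RintegralD _ (i0 u t u0) i1).
  have -> : \int[leb]_(v in `[0, u]) mu v v =
      \int[leb]_(v in `[0, u]) mu 0 v + \int[leb]_(v in `[0, u]) rate v v.
    transitivity (\int[leb]_(v in `[0, u]) (mu 0 v + rate v v)).
      by apply: eq_Rintegral => v; rewrite inE/= in_itv/= => /andP[v0 _]; rewrite B// v0/=.
    exact: (RintegralD _ (i0 0 u (lexx 0)) i2).
  have -> := Rintegral_glue u0 ut (i0 0 t (lexx 0)).
  move: (\int[leb]_(v in `[u, t]) mu 0 v) (\int[leb]_(v in `[0, u]) mu 0 v)
    (\int[leb]_(v in `[u, t]) rate u v) (\int[leb]_(v in `[0, u]) rate v v) => *; ring.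
have t0 := le_trans s0 st.
(* clamping makes g continuous on the line *)
pose g u := mu s (Num.max s u) - mu 0 (Num.max 0 u) - rate s t.
have cg : continuous g.
  move=> u; apply: cvgB; last exact: cvg_cst.
  by apply: cvgB; exact: mu_clamped_continuous.
have [K HK] := levy_laplace_increment fin mkap kap0 kapM s0 st.
suff : g t = 0.
  rewrite /g (max_idPr st) (max_idPr t0) => /eqP; rewrite subr_eq0 => /eqP <-.
  by rewrite addrC subrK.
apply: (quadratic_integral_eq0 (C := K) cg) => b tb bt1.
have sb := le_trans st tb; have b0 := le_trans s0 sb.
have is_ := pathint_mu mu_cont b s0.
have -> : \int[leb]_(u in `[t, b]) g u = \int[leb]_(u in `[t, b]) mu s u -
    \int[leb]_(u in `[t, b]) mu 0 u - rate s t * (b - t).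
  have i1 := pathint_sub st (lexx b) is_; have i2 := i0 t b t0.
  have i3 : leb.-integrable `[t, b]%classic (EFin \o (fun u => mu s u + -1 * mu 0 u)).
    by apply: pathintD => //; exact: pathintZ.
  transitivity (\int[leb]_(u in `[t, b]) ((mu s u + -1 * mu 0 u) + - rate s t)).
    apply: eq_Rintegral => u; rewrite inE/= in_itv/= => /andP[tu _].
    by rewrite /g mulN1r (max_idPr (le_trans st tu)) (max_idPr (le_trans t0 tu)).
  rewrite RintegralD//; last exact: pathint_cst.
  rewrite RintegralD//; last exact: pathintZ.
  by rewrite RintegralZl// Rintegral_cc_cst// mulN1r mulNr.
rewrite [_ * (b - t)]mulrC.
have := C 0 s b (lexx 0) s0 sb; have := C 0 s t (lexx 0) s0 st.
rewrite /log_mean !levy_laplace0// /mean_discounting.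
rewrite (Rintegral_glue t0 tb (i0 0 b (lexx 0))) (Rintegral_glue st tb is_).
rewrite !set_itv1 !Rintegral_set1 => Ht Hb.
have := HK b tb bt1; congr (`| _ - _ | <= _).
move: Ht Hb; move: (Lam s b) (Lam s t) (\int[leb]_(u in `[s, t]) mu s u)
  (\int[leb]_(u in `[t, b]) mu s u) (\int[leb]_(u in `[0, t]) mu 0 u)
  (\int[leb]_(u in `[t, b]) mu 0 u) (\int[leb]_(u in `[0, s]) mu u u) => *; lra.
Qed.

End drift_condition.

(** * The equivalence *)

Section local_boundedness.
Context {R : realType} (kappa : R * R -> R).
Hypothesis kappa_bnd : locally_bounded_on quadrant kappa.

(** Local bounds are uniform over the compact square. *)
Lemma locally_bounded_square (T : R) : exists2 M : R, 0 <= M &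
  forall p : R * R, 0 <= p.1 <= T -> 0 <= p.2 <= T -> `|kappa p| <= M.
Proof.
have cK : compact (`[0, T]%classic `*` `[0, T]%classic : set (R * R)).
  by apply: compact_setX; exact: segment_compact.
have NC := iffLR (compact_near_coveringP _) cK.
have := NC R (pinfty_nbhs R) (fun M p => quadrant p -> `|kappa p| <= M) _.
case=> [p [/=]|M0 [_ HM]].
  rewrite !in_itv/= => /andP[x0 _] /andP[y0 _].
  have [M HM] := kappa_bnd (conj x0 y0 : quadrant p).
  exists ([set q | quadrant q -> `|kappa q| <= M], [set M' | M <= M']) => /=.
    by split=> //; exact: nbhs_pinfty_ge (num_real M).
  by move=> [q M'] /= [h MM'] qq; exact: le_trans (h qq) MM'.
exists (Num.max 0 (M0 + 1)); first by rewrite le_max lexx.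
move=> p x y; have := HM (M0 + 1); rewrite ltrDl => /(_ ltr01) /(_ p).
have /andP[x0 _] := x; have /andP[y0 _] := y.
move=> /(_ _ (conj x0 y0)) h; rewrite (le_trans (h _))//; last by rewrite le_max lexx orbT.
Qed.

End local_boundedness.

Lemma measurable_quadrant (R : realType) : measurable (@quadrant R).
Proof.
have -> : @quadrant R = `[0, +oo[%classic `*` `[0, +oo[%classic.
  by apply/seteqP; split=> p; rewrite /quadrant/= !in_itv/= !andbT.
by apply: measurableX; exact: measurable_itv.
Qed.

Theorem theorem2p1 (R : realType)
    (sigma : {measure set R -> \bar R})
    (sigma2 : (\int[sigma]_(tau in `]0%R, +oo[) (tau ^+ 2)%:E < +oo)%E)
    (nu : probability (Dprime R) R)
    (nuL : is_levy_noise sigma nu)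
    (kappa : R * R -> R)
    (kappa_ge0 : forall p, quadrant p -> 0 <= kappa p)
    (kappa_meas : measurable_fun quadrant kappa)
    (kappa_bnd : locally_bounded_on quadrant kappa)
    (X : R -> R -> Dprime R -> R)
    (XE : is_levy_field nu kappa X)
    (mu : R -> R -> R)
    (mu_cont : {within [set p : R * R | 0 <= p.1 <= p.2],
                  continuous (fun p => mu p.1 p.2)}) :
  let F := forward_rate mu X in
  let a := forall t : R, 0 <= t ->
    is_martingale nu [set s : R | 0 <= s <= t] (information nu F)
      (fun s => discounted_bond_price F s t) in
  let b := forall s t : R, 0 <= s <= t ->
    mu s t = mu 0 t +
      \int[lebesgue_measure]_(y in `[0, t])
        \int[lebesgue_measure]_(x in `[0, s])
          \int[sigma]_(tau in `]0, +oo[)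
            (tau * kappa (x, y) *
             (1 - expR (- (tau * kappa (x, y) * (t - Num.max x y))))) in
  let c := forall s t : R, 0 <= s <= t ->
    is_cond_exp nu (information nu F s)
      (fun om => expR (- int_spot_rate F s t om))
      (bond_price F s t) in
  (a <-> b) /\ (b <-> c).
Proof.
move=> F a b c.
have fin : finite_second_moment sigma := sigma2.
have mq := @measurable_quadrant R.
(* extended by 0, kappa is nonnegative and measurable on the whole plane, and the kernels of
   the field are unchanged *)
pose kap := kappa \_ (@quadrant R).
have mkap : measurable_fun setT kap by exact: (iffLR (measurable_restrictT _ mq)).
have kapE p : quadrant p -> kap p = kappa p by move=> qp; rewrite /kap patchE mem_set.
have kap0 p : 0 <= kap p.
  by rewrite /kap patchE; case: ifPn => //; rewrite inE; exact: kappa_ge0.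
have kapM T : exists2 M : R, 0 <= M &
    forall p : R * R, 0 <= p.1 <= T -> 0 <= p.2 <= T -> kap p <= M.
  have [M M0 kM] := locally_bounded_square kappa_bnd T.
  exists M => // p x y; have /andP[x0 _] := x; have /andP[y0 _] := y.
  by rewrite kapE; [rewrite (le_trans (ler_norm _))//; exact: kM|split].
have [mXq pXq] := XE.
(* clamped time parameters make the field measurable on the whole product *)
have mX : measurable_fun setT
    (fun q : (R * R) * Dprime R => X (Num.max 0 q.1.1) (Num.max 0 q.1.2) q.2).
  pose h (q : (R * R) * Dprime R) := ((Num.max 0 q.1.1, Num.max 0 q.1.2), q.2).
  have mh : measurable_fun setT h.
    apply: measurable_fun_pair; last exact: measurable_snd.
    apply: measurable_fun_pair; apply: measurable_maxr => //;
      by apply: measurableT_comp => //; exact: measurable_fst.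
  have mQ : measurable (@quadrant R `*` [set: Dprime R]) by exact: measurableX.
  apply: (measurable_comp mQ _ mXq mh) => _ [q _ <-].
  by split=> //; split; rewrite /= le_max lexx.
have pX s t : 0 <= s -> 0 <= t -> is_pairing nu (rect_kernel kap s t) (X s t).
  move=> s0 t0; have := pXq s t s0 t0; congr (is_pairing nu _ _).
  apply/funext => p; rewrite rect_kernelE !indic_cc -natrM mulnb.
  case: (boolP (_ && _)) => [/andP[/andP[x0 _] /andP[y0 _]]|_]; last by rewrite !mul0r.
  by rewrite kapE.
have M := martingale_constant_mean fin nuL mkap kap0 kapM mX pX mu_cont.
have P := pricing_constant_mean fin nuL mkap kap0 kapM mX pX mu_cont.
have D := constant_mean_drift fin mkap kap0 kapM mu_cont.
have bE : b <-> (forall s t : R, 0 <= s <= t -> mu s t = mu 0 t + rate fin kap s t).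
  suff E s t : 0 <= s <= t -> rate fin kap s t =
      \int[lebesgue_measure]_(y in `[0, t])
        \int[lebesgue_measure]_(x in `[0, s])
          \int[sigma]_(tau in `]0, +oo[)
            (tau * kappa (x, y) *
             (1 - expR (- (tau * kappa (x, y) * (t - Num.max x y))))).
    by split=> H s t st; [rewrite E//; exact: H|rewrite -E//; exact: H].
  move=> /andP[s0 st]; rewrite -(rate_iterated fin mkap kap0 kapM s0 st).
  apply: eq_Rintegral => y; rewrite inE/= in_itv/= => /andP[y0 _].
  apply: eq_Rintegral => x; rewrite inE/= in_itv/= => /andP[x0 _].
  by rewrite kapE.
have MB : a <-> b by rewrite bE -D; exact: M.
have PB : b <-> c by rewrite bE -D; apply: iff_sym; exact: P.
by split.
Qed.
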